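(* Let $H\in(0,1)$ and $\Delta>0$, and let $Y$ be the solution of $Y_t=x+\int_0^t b(Y_s)\,ds+\sigma B_t$, $t\ge 0$, where $B$ is a $d$-dimensional fractional Brownian motion with Hurst parameter $H$, $\sigma$ is a real $d\times d$ matrix, $x\in\mathbb{R}^d$, and $b:\mathbb{R}^d\to\mathbb{R}^d$ is continuous and such that, for some constants $\alpha,L>0$, $\langle b(y)-b(z),y-z\rangle\le-\alpha|y-z|^2$ and $|b(y)-b(z)|\le L|y-z|$ for all $y,z\in\mathbb{R}^d$. Then: (i) there exists a constant $C_{H,\Delta,\sigma}>0$ such that for all $n\in\mathbb{N}^*$, all Lipschitz functions $F:((\mathbb{R}^d)^n,d_n)\to(\mathbb{R},|\cdot|)$ and all $\lambda>0$, setting $F_Y:=F(Y_{\Delta},Y_{2\Delta},\dots,Y_{n\Delta})$, $$\mathbb{E}\left[\exp\left(\lambda(F_Y-\mathbb{E}[F_Y])\right)\right]\le\exp\left(C_{H,\Delta,\sigma}\|F\|_{\rm Lip}^2\lambda^2 n^{2H\vee 1}\right);$$ (ii) there exists a constant $\tilde C_{H,\sigma}>0$ such that for all $T\ge 1$, all Lipschitz functions $\tilde F:(\mathcal{C}([0,T],\mathbb{R}^d),d_T)\to(\mathbb{R},|\cdot|)$ and all $\lambda>0$, setting $\tilde F_Y:=\tilde F((Y_t)_{t\in[0,T]})$, $$\mathbb{E}\left[\exp\left(\lambda(\tilde F_Y-\mathbb{E}[\tilde F_Y])\right)\right]\le\exp\left(\tilde C_{H,\sigma}\|\tilde F\|_{\rm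 Lip}^2\lambda^2 T^{2H\vee 1}\right).$$
   Context: $|\cdot|$ is the Euclidean norm and $\langle\cdot,\cdot\rangle$ the scalar product on $\mathbb{R}^d$; $a\vee b=\max(a,b)$; $\mathbb{N}^*=\{1,2,\dots\}$. For $x,y\in(\mathbb{R}^d)^n$, $d_n(x,y)=\sum_{i=1}^n|x_i-y_i|$. For $x,y\in\mathcal{C}([0,T],\mathbb{R}^d)$ (continuous functions), $d_T(x,y)=\int_0^T|x_t-y_t|\,dt$. For a Lipschitz map $F$ between metric spaces $(E,d_E)$ and $(E',d_{E'})$, $\|F\|_{\rm Lip}=\sup_{x\ne y}d_{E'}(F(x),F(y))/d_E(x,y)$. A $d$-dimensional fractional Brownian motion with Hurst parameter $H$ has independent components that are continuous centered Gaussian processes with covariance $\frac12(t^{2H}+s^{2H}-|t-s|^{2H})$. The dimension $d$ and the drift $b$ are fixed data, on which constants may depend; apart from these, $C_{H,\Delta,\sigma}$ depends only on $H,\Delta,\sigma$, and $\tilde C_{H,\sigma}$ only on $H,\sigma$. *)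

(* Defs.v *)
From HB Require Import structures.
From mathcomp Require Import all_boot all_order all_algebra.
From mathcomp Require Import all_classical all_reals all_analysis.

Set Implicit Arguments.
Unset Strict Implicit.
Unset Printing Implicit Defensive.

Import Order.TTheory GRing.Theory Num.Theory.
Import numFieldNormedType.Exports.

Local Open Scope classical_set_scope.
Local Open Scope ring_scope.

(* The library norm on matrices is the maximum norm, hence [enorm]. *)
Definition dotp (R : realType) (d : nat) (u v : 'cV[R]_d) : R :=
  \sum_(i < d) u i 0 * v i 0.

Definition enorm (R : realType) (d : nat) (u : 'cV[R]_d) : R :=
  Num.sqrt (dotp u u).

Definition dist_n (R : realType) (d n : nat) (x y : 'I_n -> 'cV[R]_d) : R :=
  \sum_(i < n) enorm (x i - y i).

Definition dist_T (R : realType) (d : nat) (T : R) (x y : R -> 'cV[R]_d) : R :=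
  \int[lebesgue_measure]_(t in `[0, T]) enorm (x t - y t).

Definition path_on (R : realType) (d : nat) (T : R) (x : R -> 'cV[R]_d) :
    R -> 'cV[R]_d :=
  patch (fun=> 0) `[0, T] x.

(* An element of C([0, T], R^d) is encoded by its extension by 0 outside of
   [0, T], so that each continuous path on [0, T] has exactly one
   representative and [dist_T T] separates points. *)
Definition Cpaths (R : realType) (d : nat) (T : R) : set (R -> 'cV[R]_d) :=
  [set x | {within `[0, T], continuous x} /\ path_on T x = x].

Definition is_lipschitz (R : realType) (E : Type) (A : set E)
    (dE : E -> E -> R) (F : E -> R) : Prop :=
  exists K : R, forall x y, A x -> A y -> `|F x - F y| <= K * dE x y.

(* Meaningful when [is_lipschitz A dE F]; equal to 0 if A has at most one
   point, by the convention sup set0 = 0. *)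
Definition lip_norm (R : realType) (E : Type) (A : set E)
    (dE : E -> E -> R) (F : E -> R) : R :=
  sup [set r | exists x y : E,
    [/\ A x, A y, x <> y & r = `|F x - F y| / dE x y]].

(* [normal_prob m 0] is not a Dirac mass in the library (it is the uniform
   probability on [0, 1]): the degenerate case is treated separately. *)
Definition gaussian_prob (R : realType) (m s : R) (A : set R) : \bar R :=
  if s == 0 then \d_m A else normal_prob m s A.

Definition is_gaussian (disp : measure_display) (Omega : measurableType disp)
    (R : realType) (P : probability Omega R) (X : Omega -> R) : Prop :=
  measurable_fun setT X /\
  exists m s : R, forall A : set R, measurable A ->
    P (X @^-1` A) = gaussian_prob m s A.

(* Processes indexed by t >= 0 are functions on R whose values at t < 0 are
   irrelevant. *)
Definition is_gaussian_process (disp : measure_display)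
    (Omega : measurableType disp) (R : realType) (P : probability Omega R)
    (X : R -> Omega -> R) : Prop :=
  forall (n : nat) (t c : 'I_n -> R), (forall k, 0 <= t k) ->
    is_gaussian P (fun w => \sum_(k < n) c k * X (t k) w).

Definition is_fbm1 (disp : measure_display) (Omega : measurableType disp)
    (R : realType) (P : probability Omega R) (H : R) (X : R -> Omega -> R)
    : Prop :=
  [/\ is_gaussian_process P X,
      forall w, {within `[0, +oo[, continuous (fun t => X t w)},
      forall t, 0 <= t -> ('E_P[X t] = 0)%E &
      forall s t, 0 <= s -> 0 <= t -> covariance P (X s) (X t) =
        (2^-1 * (t `^ (2 * H) + s `^ (2 * H) - `|t - s| `^ (2 * H)))%:E].

Definition process_sigma (disp : measure_display) (Omega : measurableType disp)
    (R : realType) (X : R -> Omega -> R) : set (set Omega) :=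
  <<s [set A | exists (t : R) (U : set R),
         [/\ 0 <= t, measurable U & A = X t @^-1` U]] >>.

Definition independent_processes (disp : measure_display)
    (Omega : measurableType disp) (R : realType) (P : probability Omega R)
    (I : finType) (X : I -> R -> Omega -> R) : Prop :=
  forall (J : {set I}) (A : I -> set Omega),
    (forall i, i \in J -> process_sigma (X i) (A i)) ->
    P (\bigcap_(i in [set` J]) A i) = (\prod_(i in J) P (A i))%E.

Definition is_fbm (disp : measure_display) (Omega : measurableType disp)
    (R : realType) (P : probability Omega R) (d : nat) (H : R)
    (B : R -> Omega -> 'cV[R]_d) : Prop :=
  (forall i : 'I_d, is_fbm1 P H (fun t w => B t w i 0)) /\
  independent_processes P (fun (i : 'I_d) t w => B t w i 0).

Definition is_solution (disp : measure_display) (Omega : measurableType disp)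
    (R : realType) (P : probability Omega R) (d : nat)
    (b : 'cV[R]_d -> 'cV[R]_d) (sigma : 'M[R]_d) (x : 'cV[R]_d)
    (B Y : R -> Omega -> 'cV[R]_d) : Prop :=
  [/\ forall t (i : 'I_d), 0 <= t -> measurable_fun setT (fun w => Y t w i 0),
      forall w, {within `[0, +oo[, continuous (fun t => Y t w)} &
      {ae P, forall w, forall t, 0 <= t ->
        Y t w = x
          + \col_i \int[lebesgue_measure]_(s in `[0, t]) (b (Y s w) i 0)
          + sigma *m B t w}].

(* Main.v *)
(* The Euler scheme of Y is run block by block, on n blocks of length l and with
   M steps per block, the noise being restarted at the start of every block.
   Since b is contracting, a functional of the grid values that is Lipschitz for
   the weighted l^1 distance is a Lipschitz function of the restarted noises
   B_(jl+mh) - B_(jl), with constants that do not depend on M.  These noises form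
   a centered Gaussian vector whose covariances, summed over pairs of blocks, are
   at most of order n^max(2H,1).  A Gaussian vector with covariance A A^T has the
   law of A g with g standard (uniqueness of Fourier transforms), and the
   one-dimensional Prekopa-Leindler inequality, tensorized, bounds
   E exp(Phi) E exp(-Phi) by exp of the variance term.  This uncentered product
   form passes to the limit M -> oo by Fatou's lemma without any integrability,
   and Jensen's inequality then gives both integrability and the centered bound.
   For (i), l = Delta; for (ii), n is the integer part of T, l = T / n lies in
   [1, 2], and the path is interpolated from its grid values. *)
Require Import Defs.
From HB Require Import structures.
From mathcomp Require Import all_boot all_order all_algebra.
From mathcomp Require Import all_classical all_reals all_analysis.
From mathcomp Require Import measurable_realfun.
From mathcomp Require Import ring lra.
Set Implicit Arguments.
Unset Strict Implicit.
Unset Printing Implicit Defensive.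
Import Order.TTheory GRing.Theory Num.Theory.
Import numFieldNormedType.Exports.
Local Open Scope classical_set_scope.
Local Open Scope ring_scope.

(** Inside a block the recursion is written for Y minus sigma times the restarted noise. The noise
    then enters only through the argument of b, so that each intermediate value has a weight of
    order h L and the M weights of a block add up to order l L; only the last value of a block,
    which shifts the next starting point, has a weight of order 1. This, besides the weights of the
    functional itself, is why no constant sees M, whatever the roughness of the noise. Restarting
    matters for n: covariances between values of B at times up to n l are of order n^(2H), which
    would give n^(2H+2) after summation over pairs of blocks. Covariances of increments over two
    blocks are second differences of u^(2H); for each block, their sum over the other blocks stays
    bounded if 2H <= 1 and is of order n^(2H-1) otherwise. The Lipschitz weights are the same in all
    blocks, so the variance term is a sum of absolute values of covariances and no spectral estimate
    of the covariance matrix enters. *)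

Section lebesgue_translation.
Context {R : realType}.
Local Notation mu := (@lebesgue_measure R).

(** The image of Lebesgue measure under a translation gives half-open intervals their length, which
    characterizes Lebesgue measure. *)
Lemma lebesgue_measure_translation (c : R) (A : set R) : measurable A ->
  mu ((fun x => x + c) @^-1` A) = mu A.
Proof.
move=> mA; symmetry.
pose f : measurableTypeR R -> measurableTypeR R := fun x => x + c.
have mf : measurable_fun setT f by exact: measurable_funD.
pose nu : {measure set (measurableTypeR R) -> \bar R} :=
  measure_function_pushforward__canonical__measure_function_Measure mu mf.
apply: (@lebesgue_measure_unique R nu) => // _ [[a b] _ <-].
rewrite /nu/= /pushforward /=.
suff -> : f @^-1` `]a, b] = `](a - c), (b - c)]%classic.
  rewrite !lebesgue_measure_itv/= !lte_fin ltrD2r -!EFinB; case: ifPn => // _; congr (_%:E); ring.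
by apply/seteqP; split => x /=; rewrite !in_itv/= lerBrDr ltrBlDr.
Qed.
End lebesgue_translation.

(** * Layer-cake formula and integration against a density *)

Lemma measurable_set_ltr d (T : measurableType d) (R : realType) (f g : T -> R) :
  measurable_fun setT f -> measurable_fun setT g -> measurable [set x | f x < g x].
Proof.
move=> mf mg; have := measurable_fun_ltr mf mg => /(_ measurableT [set true]).
rewrite setTI (_ : _ @^-1` [set true] = [set x | f x < g x])//; first exact.
Qed.

Section layer_cake.
Context d (T : measurableType d) {R : realType}.
Variable m : {sigma_finite_measure set T -> \bar R}.
Local Notation mu := (@lebesgue_measure R).

Lemma measurable_superlevel_prod (f : T -> R) : measurable_fun setT f ->
  measurable_fun setT (fun tx : measurableTypeR R * T => ((tx.1 < f tx.2)%R%:R)%:E : \bar R).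
Proof.
move=> mf; apply/measurable_EFinP.
rewrite (_ : (fun _ => _) = \1_[set tx : measurableTypeR R * T | (tx.1 < f tx.2)%R]).
  apply: measurable_indic; apply: measurable_set_ltr => //.
  exact: measurableT_comp.
by apply/funext => x; rewrite indicE mem_setE.
Qed.

Lemma measurable_superlevel_measure (f : T -> R) : measurable_fun setT f ->
  measurable_fun setT (fun t : measurableTypeR R => m [set x | t < f x]).
Proof.
move=> mf.
have := measurable_fun_fubini_tonelli_F (m2 := m) _
  (measurable_superlevel_prod mf) (fun tx => _).
move=> /(_ ltac:(by move=> tx; rewrite lee_fin)).
apply: eq_measurable_fun => t _; rewrite /fubini_F/=.
transitivity (\int[m]_x (\1_[set x | (t < f x)%R] x)%:E)%E.
  by apply: eq_integral => x _; rewrite indicE mem_setE.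
by rewrite integral_indic ?setIT//; exact: measurable_set_ltr.
Qed.

(** Tonelli's theorem for the indicator of t < f x. Only levels in [0, 1[ are kept: in the
    Prekopa-Leindler argument these are the levels where the normalized functions have nonempty
    superlevel sets, and the third function may exceed 1. *)
Lemma layer_cake01 (f : T -> R) : measurable_fun setT f -> (forall x, 0 <= f x) ->
  (\int[mu]_(t in `[0%R, 1%R[) m [set x | (t < f x)%R] =
   \int[m]_x (Num.min (f x) 1)%:E)%E.
Proof.
move=> mf f0.
pose F := (fun tx : measurableTypeR R * T =>
  ((\1_(`[0, 1[%classic : set R) tx.1 : R) * (tx.1 < f tx.2)%R%:R)%:E : \bar R).
have mF : measurable_fun setT F.
  apply/measurable_EFinP; apply: measurable_funM.
    by apply: measurableT_comp => //; exact: measurable_indic.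
  by apply/measurable_EFinP; exact: measurable_superlevel_prod.
have F0 tx : (0 <= F tx)%E by rewrite lee_fin mulr_ge0.
have := fubini_tonelli (m1 := mu) (m2 := m) F mF F0.
move=> FT; transitivity (\int[mu]_t \int[m]_x F (t, x))%E.
  rewrite integral_mkcond; apply: eq_integral => t _; rewrite patchE; case: ifPn => t01.
    transitivity (\int[m]_x (\1_[set x | (t < f x)%R] x)%:E)%E.
      by rewrite integral_indic ?setIT//; exact: measurable_set_ltr.
    apply: eq_integral => x _; rewrite /F/= !indicE t01 mul1r.
    by rewrite mem_setE.
  by rewrite integral0_eq// => x _; rewrite /F/= indicE (negbTE t01) mul0r.
rewrite FT; apply: eq_integral => x _.
transitivity (\int[mu]_t (\1_(`[0%R, Num.min (f x) 1[%classic : set R) t)%:E)%E.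
  apply: eq_integral => t _; rewrite /F/= !indicE !mem_setE -natrM mulnb.
  rewrite !in_itv/= lt_min; congr (_%:R%:E).
  by case: (0 <= t); case: (t < f x); case: (t < 1).
rewrite integral_indic//= setIT lebesgue_measure_itv/= lte_fin.
rewrite lt_min ltr01 andbT; case: ltP => [_|h]; first by rewrite -EFinB subr0.
by congr EFin; apply/eqP; rewrite eq_le le_min f0 ler01/= ge_min h.
Qed.
End layer_cake.

(** The density [p] agrees almost everywhere with the Radon-Nikodym derivative, to which the change
    of variables applies. *)
Lemma ge0_integral_density d (T : measurableType d) (R : realType)
    (mu : {sigma_finite_measure set T -> \bar R}) (nu : {finite_measure set T -> \bar R})
    (p : T -> R) : measurable_fun setT p ->
  (forall A, measurable A -> nu A = (\int[mu]_(x in A) (p x)%:E)%E) ->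
  forall f : T -> \bar R, measurable_fun setT f -> (forall x, (0 <= f x)%E) ->
  (\int[nu]_x f x = \int[mu]_x (f x * (p x)%:E))%E.
Proof.
move=> mp nuE f mf f0.
have mpE : measurable_fun setT (EFin \o p) by exact/measurable_EFinP.
have numu : nu `<< mu.
  apply/null_content_dominatesP => A mA muA; rewrite nuE//.
  by apply: null_set_integral => //; exact: measurable_funTS.
rewrite -(Radon_Nikodym_SigmaFinite.change_of_variables numu f0 measurableT mf).
have ig := Radon_Nikodym_SigmaFinite.f_integrable numu.
have gp : ae_eq mu setT (Radon_Nikodym_SigmaFinite.f nu mu) (EFin \o p).
  apply: integral_ae_eq => // E _ mE.
  by rewrite -Radon_Nikodym_SigmaFinite.f_integral// nuE.
apply: ae_eq_integral => //.
- by apply: emeasurable_funM => //; exact: measurable_int ig.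
- exact: emeasurable_funM.
- by apply: filterS gp => x /= h _; rewrite h.
Qed.

(** * Brunn-Minkowski and Prekopa-Leindler inequalities on the line *)

Section brunn_minkowski.
Context {R : realType}.
Local Notation mu := (@lebesgue_measure R).
Implicit Types A B C : set R.

(** Continuity of the measure from below. The null point [s] stands for an extremum of [A] that no
    [D n] contains. *)
Lemma lebesgue_le_exhaustion A (D : (set R)^nat) (s : R) (c : \bar R) :
  measurable A -> (forall n, measurable (D n)) -> nondecreasing_seq D ->
  A `\ s `<=` \bigcup_n D n -> (forall n, (mu (A `&` D n) <= c)%E) ->
  (mu A <= c)%E.
Proof.
move=> mA mD ndD AD ADc.
have mAD n : measurable (A `&` D n) by exact: measurableI.
have cv : mu (A `&` D n) @[n --> \oo] --> mu (\bigcup_n (A `&` D n)).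
  apply: nondecreasing_cvg_mu => //; first exact: bigcupT_measurable.
  by move=> m n mn; apply/subsetPset; apply: setIS; apply/subsetPset; exact: ndD.
have le1 : (mu (\bigcup_n (A `&` D n)) <= c)%E.
  rewrite -(cvg_lim _ cv)//; apply: lime_le; first exact: cvgP cv.
  exact: nearW.
apply: le_trans le1.
have m1 : measurable (\bigcup_n (A `&` D n)) by exact: bigcupT_measurable.
have <- : mu ((\bigcup_n (A `&` D n)) `|` [set s]) = mu (\bigcup_n (A `&` D n)).
  apply/eqP; rewrite eq_le; apply/andP; split; last first.
    by apply: le_measure; rewrite ?inE//; try exact: measurableU; exact: subsetUl.
  have -> : mu (\bigcup_n (A `&` D n)) = (mu (\bigcup_n (A `&` D n)) + mu [set s])%E.
    by rewrite lebesgue_measure_set1 adde0.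
  exact: measureU2.
apply: le_measure; rewrite ?inE//; first exact: measurableU.
move=> x Ax; have [->|/eqP xs] := eqVneq x s; first by right.
by left; have [n _ Dx] := AD x (conj Ax xs); exists n.
Qed.

(** If [A] is bounded above, each half-line ending strictly before [sup A] is contained in one
    ending at a point of [A], and only [sup A] itself is missed. Otherwise the half-lines ending at
    integers exhaust the line, and the excluded point 0 is a dummy. *)
Lemma lebesgue_le_left_parts A (c : \bar R) : measurable A -> A !=set0 ->
  (forall a, A a -> (mu (A `&` `]-oo, a]) <= c)%E) -> (mu A <= c)%E.
Proof.
move=> mA A0 Ac.
have [ubA|nubA] := pselect (has_ubound A).
- have supA : has_sup A by [].
  apply: (@lebesgue_le_exhaustion _ (fun n => `]-oo, sup A - n.+1%:R^-1]%classic) (sup A)) => //.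
  + move=> m n mn; apply/subsetPset => x /=; rewrite !in_itv/= => /le_trans; apply.
    by rewrite lerD2l lerN2 lef_pV2 ?posrE// ler_nat ltnS.
  + move=> x [Ax /eqP xs]; have xsA : x < sup A by rewrite lt_neqAle xs ub_le_sup.
    have := near_infty_natSinv_lt (PosNum (ltac:(by rewrite subr_gt0; exact: xsA) : 0 < sup A - x)).
    case=> N _ /(_ N (leqnn N)) /= hN; exists N => //=; rewrite in_itv/=.
    by rewrite lerBrDr -lerBrDl ltW.
  + move=> n; have [a Aa an] := sup_adherent (ltac:(by []) : 0 < n.+1%:R^-1 :> R) supA.
    apply: le_trans (Ac a Aa); apply: le_measure; rewrite ?inE//; try exact: measurableI.
    by apply: setIS => x /=; rewrite !in_itv/= => /le_trans; apply; exact: ltW.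
- apply: (@lebesgue_le_exhaustion _ (fun n => `]-oo, n%:R]%classic) 0) => //.
  + move=> m n mn; apply/subsetPset => x /=; rewrite !in_itv/= => /le_trans; apply.
    by rewrite ler_nat.
  + move=> x _; exists (Num.bound `|x|) => //=; rewrite in_itv/=.
    by apply/ltW/(le_lt_trans (ler_norm _)); exact: archi_boundP.
  + move=> n; have [a Aa an] : exists2 a, A a & n%:R <= a.
      apply: contrapT => h; apply: nubA; exists n%:R => a Aa; rewrite leNgt.
      by apply/negP => na; apply: h; exists a => //; exact: ltW.
    apply: le_trans (Ac a Aa); apply: le_measure; rewrite ?inE//; try exact: measurableI.
    by apply: setIS => x /=; rewrite !in_itv/= => /le_trans; apply.
Qed.

Lemma lebesgue_le_right_parts A (c : \bar R) : measurable A -> A !=set0 ->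
  (forall a, A a -> (mu (A `&` `]a, +oo[) <= c)%E) -> (mu A <= c)%E.
Proof.
move=> mA A0 Ac.
have [lbA|nlbA] := pselect (has_lbound A).
- have infA : has_inf A by [].
  apply: (@lebesgue_le_exhaustion _ (fun n => `]inf A + n.+1%:R^-1, +oo[%classic) (inf A)) => //.
  + move=> m n mn; apply/subsetPset => x /=; rewrite !in_itv/= !andbT => /(le_lt_trans _); apply.
    by rewrite lerD2l lef_pV2 ?posrE// ler_nat ltnS.
  + move=> x [Ax /eqP xs]; have xsA : inf A < x.
      by rewrite lt_neqAle eq_sym xs; exact: ge_inf.
    have := near_infty_natSinv_lt (PosNum (ltac:(by rewrite subr_gt0; exact: xsA) : 0 < x - inf A)).
    case=> N _ /(_ N (leqnn N)) /= hN; exists N => //=; rewrite in_itv/= andbT.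
    by rewrite -ltrBrDl.
  + move=> n; have [a Aa an] := inf_adherent (ltac:(by []) : 0 < n.+1%:R^-1 :> R) infA.
    apply: le_trans (Ac a Aa); apply: le_measure; rewrite ?inE//; try exact: measurableI.
    by apply: setIS => x /=; rewrite !in_itv/= !andbT; exact: lt_trans.
- apply: (@lebesgue_le_exhaustion _ (fun n => `](- n%:R), +oo[%classic) 0) => //.
  + move=> m n mn; apply/subsetPset => x /=; rewrite !in_itv/= !andbT => /(le_lt_trans _); apply.
    by rewrite lerN2 ler_nat.
  + move=> x _; exists (Num.bound `|x|) => //=; rewrite in_itv/= andbT ltrNl.
    by rewrite -(normrN x); apply: le_lt_trans (archi_boundP (normr_ge0 _)); rewrite ler_norm.
  + move=> n; have [a Aa an] : exists2 a, A a & a <= - n%:R.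
      apply: contrapT => h; apply: nlbA; exists (- n%:R) => a Aa; rewrite leNgt.
      by apply/negP => na; apply: h; exists a => //; exact: ltW.
    apply: le_trans (Ac a Aa); apply: le_measure; rewrite ?inE//; try exact: measurableI.
    by apply: setIS => x /=; rewrite !in_itv/= !andbT; exact: le_lt_trans.
Qed.

Lemma brunn_minkowski1 A B C : measurable A -> measurable B -> measurable C ->
  A !=set0 -> B !=set0 -> (forall a b, A a -> B b -> C (a + b)) ->
  (mu A + mu B <= mu C)%E.
Proof.
move=> mA mB mC A0 B0 ABC.
(* The translates by b of A `&` ]-oo, a] and by a of B `&` ]b, +oo[ are disjoint
   subsets of C. *)
have key a b : A a -> B b -> (mu (A `&` `]-oo, a]) + mu (B `&` `]b, +oo[) <= mu C)%E.
  move=> Aa Bb.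
  have mA' : measurable (A `&` `]-oo, a]) by exact: measurableI.
  have mB' : measurable (B `&` `]b, +oo[) by exact: measurableI.
  rewrite -(lebesgue_measure_translation (- b) mA') -(lebesgue_measure_translation (- a) mB').
  have mt c D : measurable D -> measurable ((fun x : R => x + c) @^-1` D).
    move=> mD; rewrite -[X in measurable X]setTI.
    by apply: (measurable_funD (measurable_id (D := setT)) (measurable_cst c)).
  rewrite -measureU//; [|exact: mt|exact: mt|].
    apply: le_measure; rewrite ?inE//; first by apply: measurableU; exact: mt.
    move=> x [[/= Ax _]|[/= Bx _]].
      by rewrite -(subrK b x); exact: ABC.
    by rewrite -(subrK a x) addrC; exact: ABC.
  apply/seteqP; split => // x [[/= _ +] [/= _]]; rewrite !in_itv/= andbT; lra.
(* The suprema over [a] and over [b] are taken one after the other, each after moving the other term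
   across the inequality; this subtraction needs finite measures. *)
have [->|Cfin] := eqVneq (mu C) +oo%E; first by rewrite leey.
have Clty : (mu C < +oo)%E by rewrite ltey.
have fA a b : A a -> B b -> mu (A `&` `]-oo, a]) \is a fin_num.
  move=> Aa Bb; rewrite ge0_fin_numE//; apply: le_lt_trans Clty.
  by apply: le_trans (key a b Aa Bb); rewrite leeDl.
have fB a b : A a -> B b -> mu (B `&` `]b, +oo[) \is a fin_num.
  move=> Aa Bb; rewrite ge0_fin_numE//; apply: le_lt_trans Clty.
  by apply: le_trans (key a b Aa Bb); rewrite leeDr.
have [a0 Aa0] := A0; have [b0 Bb0] := B0.
have h1 b : B b -> (mu A <= mu C - mu (B `&` `]b, +oo[))%E.
  move=> Bb; apply: lebesgue_le_left_parts => // a Aa.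
  by rewrite leeBrDr ?(fB a)//; exact: key.
have fmA : mu A \is a fin_num.
  rewrite ge0_fin_numE//; apply: le_lt_trans (h1 b0 Bb0) _.
  by apply: le_lt_trans Clty; rewrite leeBlDr ?(fB a0)// leeDl.
rewrite addeC -leeBrDr//; apply: lebesgue_le_right_parts => // b Bb.
by rewrite leeBrDr// addeC -leeBrDr ?(fB a0)//; exact: h1.
Qed.

End brunn_minkowski.

Section prekopa_leindler.
Context {R : realType}.
Local Notation mu := (@lebesgue_measure R).

(** At a level t < 1, f x > t and g y > t force h (x + y) > t, so the one-dimensional
    Brunn-Minkowski inequality applies to the superlevel sets; it is then integrated over t. The
    last two conditions on [f] and [g] provide the nonempty sets that it requires. *)
Lemma prekopa_leindler_sup1 (f g h : R -> R) :
  measurable_fun setT f -> measurable_fun setT g -> measurable_fun setT h ->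
  (forall x, 0 <= f x <= 1) -> (forall x, 0 <= g x <= 1) -> (forall x, 0 <= h x) ->
  (forall t, t < 1 -> exists x, t < f x) -> (forall t, t < 1 -> exists x, t < g x) ->
  (forall x y, f x * g y <= h (x + y) ^+ 2) ->
  (\int[mu]_x (f x)%:E + \int[mu]_x (g x)%:E <= \int[mu]_x (h x)%:E)%E.
Proof.
move=> mf mg mh f01 g01 h0 fs gs fgh.
have f0 x : 0 <= f x by have /andP[] := f01 x.
have g0 x : 0 <= g x by have /andP[] := g01 x.
have -> : (\int[mu]_x (f x)%:E = \int[mu]_(t in `[0%R, 1%R[) mu [set x | (t < f x)%R])%E.
  rewrite layer_cake01//; apply: eq_integral => x _.
  by rewrite min_l//; have /andP[] := f01 x.
have -> : (\int[mu]_x (g x)%:E = \int[mu]_(t in `[0%R, 1%R[) mu [set x | (t < g x)%R])%E.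
  rewrite layer_cake01//; apply: eq_integral => x _.
  by rewrite min_l//; have /andP[] := g01 x.
apply: (@le_trans _ _ (\int[mu]_(t in `[0%R, 1%R[) mu [set x | (t < h x)%R])%E); last first.
  rewrite layer_cake01//; apply: ge0_le_integral => //=.
  - by move=> x _; rewrite lee_fin le_min h0 ler01.
  - by apply/measurable_EFinP; apply: measurable_minr.
  - exact/measurable_EFinP.
  - by move=> x _; rewrite lee_fin ge_min lexx.
rewrite -ge0_integralD//; last 2 first.
- by apply: measurable_funTS; exact: measurable_superlevel_measure.
- by apply: measurable_funTS; exact: measurable_superlevel_measure.
apply: ge0_le_integral => //.
- by move=> t _; rewrite adde_ge0.
- by apply: measurable_funTS; apply: emeasurable_funD; exact: measurable_superlevel_measure.
- by apply: measurable_funTS; exact: measurable_superlevel_measure.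
move=> t /=; rewrite in_itv/= => /andP[t0 t1].
apply: brunn_minkowski1; [exact: measurable_set_ltr..|exact: fs|exact: gs|].
move=> a b /= ta tb; rewrite -(@ltr_pXn2r _ 2%N) ?nnegrE//.
by apply: lt_le_trans (fgh a b); rewrite expr2; apply: ltr_pM.
Qed.

(** Dividing [f] and [g] by their suprema F and G, and [h] by the square root of F G, reduces to
    suprema equal to 1. The bound on the sum of the integrals becomes one on their product by 4 a b
    <= (a + b)^2, whence the 4. *)
Lemma prekopa_leindler1 (f g h : R -> R) (r : R) :
  measurable_fun setT f -> measurable_fun setT g -> measurable_fun setT h ->
  (forall x, 0 <= f x) -> (forall x, 0 <= g x) -> (forall x, 0 <= h x) ->
  has_ubound (range f) -> has_ubound (range g) ->
  (forall x y, f x * g y <= h (x + y) ^+ 2) ->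
  (\int[mu]_x (h x)%:E = r%:E)%E ->
  ((\int[mu]_x (f x)%:E) * (\int[mu]_x (g x)%:E) <= (r ^+ 2 / 4)%:E)%E.
Proof.
move=> mf mg mh f0 g0 h0 ubf ubg fgh hr.
have r2 : (0 <= (r ^+ 2 / 4)%:E)%E by rewrite lee_fin divr_ge0 ?sqr_ge0.
pose F := sup (range f); pose G := sup (range g).
have fF x : f x <= F by apply: ub_le_sup => //; exists x.
have gG x : g x <= G by apply: ub_le_sup => //; exists x.
have rf : range f !=set0 by exists (f 0), 0.
have rg : range g !=set0 by exists (g 0), 0.
have : 0 <= F by apply: le_trans (f0 0) (fF 0).
rewrite le_eqVlt => /orP[/eqP F0|F0].
  rewrite integral0_eq ?mul0e// => x _; congr EFin; apply/eqP.
  by rewrite eq_le f0 andbT F0.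
have : 0 <= G by apply: le_trans (g0 0) (gG 0).
rewrite le_eqVlt => /orP[/eqP G0|G0].
  rewrite [X in (_ * X)%E]integral0_eq ?mule0// => x _; congr EFin; apply/eqP.
  by rewrite eq_le g0 andbT G0.
pose k := Num.sqrt (F * G).
have k0 : 0 < k by rewrite sqrtr_gt0 mulr_gt0.
have k2 : k ^+ 2 = F * G by rewrite sqr_sqrtr// mulr_ge0// ltW.
have intM (u : R -> R) (c : R) : measurable_fun setT u -> (forall x, 0 <= u x) -> 0 < c ->
    (\int[mu]_x (u x / c)%:E = c^-1%:E * \int[mu]_x (u x)%:E)%E.
  move=> mu' u0 c0; rewrite -ge0_integralZl//.
  - by apply: eq_integral => x _; rewrite -EFinM mulrC.
  - exact/measurable_EFinP.
  - by move=> x _; rewrite lee_fin.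
  - by rewrite lee_fin invr_ge0 ltW.
have := @prekopa_leindler_sup1 (fun x => f x / F) (fun x => g x / G) (fun x => h x / k).
rewrite !intM// hr => /(_ _ _ _ _ _ _ _ _ _)/wrap[].
- exact: measurable_funM.
- exact: measurable_funM.
- exact: measurable_funM.
- by move=> x; rewrite divr_ge0 ?(ltW F0)//= ler_pdivrMr// mul1r.
- by move=> x; rewrite divr_ge0 ?(ltW G0)//= ler_pdivrMr// mul1r.
- by move=> x; rewrite divr_ge0 // ltW.
- move=> t t1; have := @sup_gt _ (range f) (t * F) rf.
  rewrite gtr_pMl// => /(_ t1) [_ [x _ <-] ?]; exists x.
  by rewrite ltr_pdivlMr.
- move=> t t1; have := @sup_gt _ (range g) (t * G) rg.
  rewrite gtr_pMl// => /(_ t1) [_ [x _ <-] ?]; exists x.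
  by rewrite ltr_pdivlMr.
- move=> x y; rewrite expr_div_n k2 mulf_div ler_pM2r ?invr_gt0 ?mulr_gt0//.
have If0 : (0 <= \int[mu]_x (f x)%:E)%E by apply: integral_ge0 => x _; rewrite lee_fin.
have Ig0 : (0 <= \int[mu]_x (g x)%:E)%E by apply: integral_ge0 => x _; rewrite lee_fin.
have gtFy : (F^-1%:E * +oo = +oo)%E by rewrite gt0_muley// lte_fin invr_gt0.
have gtGy : (G^-1%:E * +oo = +oo)%E by rewrite gt0_muley// lte_fin invr_gt0.
move: (\int[mu]_x (f x)%:E)%E (\int[mu]_x (g x)%:E)%E If0 Ig0 => [a| |] [b| |]//=;
  rewrite ?lee_fin ?gtFy ?gtGy => a0 b0; [|by []..].
move=> habr.
have ha : 0 <= a / F by rewrite divr_ge0// ltW.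
have hb : 0 <= b / G by rewrite divr_ge0// ltW.
have h4 : 4 * (a / F * (b / G)) <= (r / k) ^+ 2.
  apply: (@le_trans _ _ ((a / F + b / G) ^+ 2)).
    by rewrite -subr_ge0 (_ : _ - _ = (a / F - b / G) ^+ 2) ?sqr_ge0//; ring.
  rewrite ler_pXn2r ?nnegrE ?addr_ge0//.
    by rewrite !(mulrC _ _^-1).
  by apply: le_trans (addr_ge0 ha hb) _; rewrite !(mulrC _ _^-1).
move: h4; rewrite expr_div_n k2 mulf_div mulrA ler_pM2r ?invr_gt0 ?mulr_gt0// => h4.
by rewrite ler_pdivlMr ?ltr0n// mulrC.
Qed.

End prekopa_leindler.

(** * Property (tau) of the Gaussian measure and its tensorization *)

Definition gauss {R : realType} : probability (measurableTypeR R) R := normal_prob (0:R) 1.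

Section gauss_density.
Context {R : realType}.
Local Notation mu := (@lebesgue_measure R).

Lemma ge0_integral_normal (m s : R) (f : R -> \bar R) :
  measurable_fun setT f -> (forall x, (0 <= f x)%E) ->
  (\int[normal_prob m s]_x f x = \int[mu]_x (f x * (normal_pdf m s x)%:E))%E.
Proof.
move=> mf f0; apply: (@ge0_integral_density _ _ R mu (normal_prob m s)) => //.
exact: measurable_normal_pdf.
Qed.

End gauss_density.

(* Maurey's property (tau) with cost [c]. *)
Definition has_prekopa {R : realType} d (W : measurableType d) (Q : probability W R)
    (c : W -> W -> R) : Prop :=
  forall u v : W -> \bar R, measurable_fun setT u -> measurable_fun setT v ->
    (forall w, 0 <= u w)%E -> (forall w, 0 <= v w)%E ->
    (forall w w', u w * v w' <= (expR (c w w'))%:E)%E ->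
    (\int[Q]_w u w * \int[Q]_w v w <= 1)%E.

Section gauss_prekopa.
Context {R : realType}.
Local Notation mu := (@lebesgue_measure R).

Lemma normal_pdf1E (x : R) :
  normal_pdf 0 1 x = (Num.sqrt (pi *+ 2))^-1 * expR (- (x ^+ 2 / 2)).
Proof.
rewrite normal_pdfE ?oner_neq0// /= /normal_peak /normal_fun.
by rewrite subr0 expr1n mul1r mulNr.
Qed.

(** Parallelogram identity x^2/2 + y^2/2 - (x - y)^2/4 = (x + y)^2/4. It dictates the cost and the
    third function of the Prekopa-Leindler inequality, twice a normal density; its integral is 2, so
    that the bound r^2/4 equals 1. *)
Lemma normal_pdf_midpoint (x y : R) :
  expR ((x - y) ^+ 2 / 4) * (normal_pdf 0 1 x * normal_pdf 0 1 y) =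
  (2 * normal_pdf 0 2 (x + y)) ^+ 2.
Proof.
rewrite !normal_pdf1E (@normal_pdfE _ 0 2) ?pnatr_eq0// /= /normal_peak /normal_fun subr0.
have p0 : 0 < @pi R by exact: pi_gt0.
have -> : (2 : R) ^+ 2 * pi *+ 2 = 2 ^+ 2 * (pi *+ 2) by ring.
rewrite sqrtrM ?sqr_ge0// sqrtr_sqr ger0_norm//.
set q := Num.sqrt (pi *+ 2); have q0 : q != 0 by rewrite gt_eqF// sqrtr_gt0 pmulrn_lgt0.
rewrite !exprMn -expRM_natl.
transitivity (q^-1 ^+ 2 * (expR ((x - y) ^+ 2 / 4) * expR (- (x ^+ 2 / 2)) * expR (- (y ^+ 2 / 2)))).
  by ring.
rewrite -!expRD mulrA; congr (_ * expR _); first by field.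
by field.
Qed.

Lemma gauss_has_prekopa : has_prekopa gauss (fun x y : R => (x - y) ^+ 2 / 4).
Proof.
move=> u v mu_ mv u0 v0 uv.
have [[y0 vy0]|nv] := pselect (exists y, v y != 0%E); last first.
  rewrite [X in (_ * X)%E]integral0_eq ?mule0// => y _.
  by apply/eqP; apply: contrapT => h; apply: nv; exists y; exact/negP.
have [[x0 ux0]|nu] := pselect (exists x, u x != 0%E); last first.
  rewrite integral0_eq ?mul0e// => y _.
  by apply/eqP; apply: contrapT => h; apply: nu; exists y; exact/negP.
(* As [v y0] is positive, an infinite [u x] would make the product exceed the finite cost. *)
have ufin x : u x \is a fin_num.
  have := uv x y0; have := v0 y0; have := u0 x; move: vy0.
  case: (u x) => [//| |//]; case: (v y0) => [r| |]//= r0 _ rge0.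
    by rewrite gt0_mulye// lt_def r0 rge0.
have vfin x : v x \is a fin_num.
  have := uv x0 x; have := v0 x; have := u0 x0; move: ux0.
  case: (v x) => [//| |//]; case: (u x0) => [r| |]//= r0 rge0 _.
    by rewrite gt0_muley// lt_def r0 rge0.
pose f x := fine (u x) * normal_pdf 0 1 x.
pose g x := fine (v x) * normal_pdf 0 1 x.
pose h z : R := 2 * normal_pdf 0 2 z.
have mpdf s : measurable_fun setT (normal_pdf (0:R) s) by exact: measurable_normal_pdf.
have mfine (w : R -> \bar R) : measurable_fun setT w -> measurable_fun setT (fun x => fine (w x)).
  by move=> mw; exact: (measurableT_comp (fine_measurable measurableT) mw).
have mf : measurable_fun setT f.
  by apply: measurable_funM; [exact: (mfine _ mu_)|exact: mpdf].
have mg : measurable_fun setT g by apply: measurable_funM; [exact: (mfine _ mv)|exact: mpdf].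
have mh : measurable_fun setT h by apply: measurable_funM.
have f0 x : 0 <= f x by rewrite mulr_ge0 ?fine_ge0 ?normal_pdf_ge0.
have g0 x : 0 <= g x by rewrite mulr_ge0 ?fine_ge0 ?normal_pdf_ge0.
have h0 x : 0 <= h x by rewrite mulr_ge0 ?normal_pdf_ge0.
have uvr x y : fine (u x) * fine (v y) <= expR ((x - y) ^+ 2 / 4).
  by have := uv x y; rewrite -(fineK (ufin x)) -(fineK (vfin y)) lee_fin.
have fgh x y : f x * g y <= h (x + y) ^+ 2.
  rewrite /h -normal_pdf_midpoint /f /g mulrACA ler_wpM2r//.
  by rewrite mulr_ge0 ?normal_pdf_ge0.
(* Freezing the other function at a point [z] where it is positive bounds [w] by a multiple of exp
   ((x - z)^2/4). The Gaussian factor wins: (x - z)^2/4 - x^2/2 = z^2/2 - (x + z)^2/4. *)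
have bnd (w : R -> R) (z : R) c : 0 < c -> (forall x, w x * c <= expR ((x - z) ^+ 2 / 4)) ->
    has_ubound (range (fun x => w x * normal_pdf 0 1 x)).
  move=> c0 wc; exists (c^-1 * ((Num.sqrt (pi *+ 2))^-1 * expR (z ^+ 2 / 2))) => _ [x _ <-].
  rewrite normal_pdf1E mulrCA [leRHS]mulrCA ler_wpM2l ?invr_ge0//.
  rewrite ler_pdivlMl// mulrA [c * _]mulrC.
  apply: (@le_trans _ _ (expR ((x - z) ^+ 2 / 4) * expR (- (x ^+ 2 / 2)))).
    by rewrite ler_wpM2r ?expR_ge0.
  rewrite -expRD ler_expR -subr_ge0.
  rewrite (_ : _ - _ = (x + z) ^+ 2 / 4); first by rewrite divr_ge0 ?sqr_ge0.
  by field.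
have cv : 0 < fine (v y0) by rewrite fine_gt0// lt_def vy0 v0 ltey_eq vfin.
have cu : 0 < fine (u x0) by rewrite fine_gt0// lt_def ux0 u0 ltey_eq ufin.
have ubf : has_ubound (range f) by apply: (bnd _ y0 _ cv).
have ubg : has_ubound (range g).
  apply: (bnd _ x0 _ cu) => x; rewrite mulrC.
  by apply: le_trans (uvr _ _) _; rewrite -sqrrN opprB.
have hI : (\int[mu]_x (h x)%:E = 2%:E)%E.
  rewrite /h; under eq_integral do rewrite EFinM.
  rewrite ge0_integralZl//; first by rewrite integral_normal_pdf mule1.
  - by apply/measurable_EFinP; exact: mpdf.
  - by move=> x _; rewrite lee_fin normal_pdf_ge0.
have := prekopa_leindler1 mf mg mh f0 g0 h0 ubf ubg fgh hI.
rewrite (_ : 2 ^+ 2 / 4 = 1 :> R); last by field.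
congr (_ * _ <= _)%E; rewrite ge0_integral_normal//; apply: eq_integral => x _.
  by rewrite EFinM fineK.
by rewrite EFinM fineK.
Qed.

End gauss_prekopa.

Section probability_aux.
Context d (T : measurableType d) {R : realType} (P : probability T R).

Lemma integrable_bounded (f : T -> R) (M : R) : measurable_fun setT f ->
  (forall x, `|f x| <= M) -> P.-integrable setT (EFin \o f).
Proof.
move=> mf fM; have := finite_measure_integrable_cst P M measurableT.
apply: le_integrable => //; first exact/measurable_EFinP.
by move=> x _; rewrite /= lee_fin (le_trans (fM x))// ler_norm.
Qed.

Lemma integral_prob_cst (c : R) : (\int[P]_x c%:E = c%:E)%E.
Proof. by rewrite integral_cst//= probability_setT mule1. Qed.

End probability_aux.

Lemma measurable_box d (T : measurableType d) (I : finType) d' (T' : I -> measurableType d')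
    (X : forall i, T -> T' i) (A : forall i, set (T' i)) :
  (forall i, measurable_fun setT (X i)) -> (forall i, measurable (A i)) ->
  measurable [set w | forall i, A i (X i w)].
Proof.
move=> mX mA; rewrite (_ : mkset _ = \bigcap_(i in [set: I]) (X i @^-1` A i)).
  apply: fin_bigcap_measurable => [|i _]; first exact: finite_finset.
  by rewrite -[X in measurable X]setTI; exact: (mX i measurableT _ (mA i)).
by apply/seteqP; split => [w h i _|w h i]; [exact: h|exact: (h i Logic.I)].
Qed.

Section product_probability.
Context d1 d2 (T1 : measurableType d1) (T2 : measurableType d2) {R : realType}
  (P1 : probability T1 R) (P2 : probability T2 R).

(** A named copy of the product measure, to which the structure of a probability is attached. *)
Definition prob_prod : set (T1 * T2) -> \bar R := (P1 \x P2)%E.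

HB.instance Definition _ := Measure.on prob_prod.

Let prob_prod_setT : prob_prod setT = 1%E.
Proof. by rewrite /prob_prod -setXTT product_measure1E//= !probability_setT mule1. Qed.

HB.instance Definition _ := Measure_isProbability.Build _ _ _ prob_prod prob_prod_setT.

(** For fixed x and x', property (tau) of the second factor, applied to u (x, .) divided by exp (c1
    x x') and to v (x', .), says that the partial integrals of u and v satisfy the hypothesis of
    property (tau) for the first factor. *)
Lemma has_prekopa_prod (c1 : T1 -> T1 -> R) (c2 : T2 -> T2 -> R) :
  has_prekopa P1 c1 -> has_prekopa P2 c2 ->
  has_prekopa prob_prod (fun w w' => c1 w.1 w'.1 + c2 w.2 w'.2).
Proof.
move=> h1 h2 u v mu mv u0 v0 uv.
have sec (w : T1 * T2 -> \bar R) x : measurable_fun setT w -> measurable_fun setT (fun y => w (x, y)).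
  by move=> mw; exact: measurableT_comp.
rewrite (fubini_tonelli1 u mu u0) (fubini_tonelli1 v mv v0).
apply: h1.
- exact: measurable_fun_fubini_tonelli_F.
- exact: measurable_fun_fubini_tonelli_F.
- by move=> x; exact: integral_ge0.
- by move=> x; exact: integral_ge0.
move=> x x'; rewrite /fubini_F.
have := h2 (fun y => (expR (- c1 x x'))%:E * u (x, y))%E (fun y => v (x', y)).
rewrite ge0_integralZl//; last exact: sec.
move=> /(_ _ _ _ _ _)/wrap[].
- by apply: emeasurable_funM => //; exact: sec.
- exact: sec.
- by move=> y; rewrite mule_ge0// lee_fin expR_ge0.
- by [].
- move=> y y'; rewrite -muleA expRN muleC lee_pdivrMr ?expR_gt0// -EFinM -expRD.
  by rewrite (addrC (c2 _ _)); exact: uv.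
- by rewrite -muleA expRN muleC lee_pdivrMr ?expR_gt0// mul1e.
Qed.

End product_probability.

Section prekopa_power.
Context d0 (W0 : measurableType d0) {R : realType} (Q0 : probability W0 R).

(** The power is an iterated binary product with coordinate maps [p]. The last two clauses serve to
    identify laws: independence on boxes, and multiplicativity of characteristic functions in real
    form, since an integral of cos (t + e) equal to k cos t for every phase t means that the
    characteristic function of e takes the real value k at 1. *)
Lemma prekopa_power (c0 : W0 -> W0 -> R) (n : nat) : has_prekopa Q0 c0 ->
  exists d (W : measurableType d) (Q : probability W R) (p : 'I_n -> W -> W0),
  [/\ forall i, measurable_fun setT (p i),
      has_prekopa Q (fun w w' => \sum_(i < n) c0 (p i w) (p i w')),
      forall A : 'I_n -> set W0, (forall i, measurable (A i)) ->
        Q [set w | forall i, A i (p i w)] = (\prod_(i < n) Q0 (A i))%E &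
      forall (e : 'I_n -> W0 -> R) (k : 'I_n -> R), (forall i, measurable_fun setT (e i)) ->
        (forall i t, (\int[Q0]_w (cos (t + e i w))%:E = (k i * cos t)%:E)%E) ->
        forall t, (\int[Q]_w (cos (t + \sum_(i < n) e i (p i w)))%:E
                   = ((\prod_(i < n) k i) * cos t)%:E)%E].
Proof.
move=> h0; elim: n => [|n [d [W [Q [p [mp hQ boxQ cosQ]]]]]].
  (* The empty power is the point mass, with cost 0. *)
  exists _, unit, (@dirac _ unit tt R : probability _ _), (fun=> fun=> point).
  split.
  - by case.
  - move=> u v mu mv u0 v0 uv.
    rewrite !integral_dirac// !diracE !mem_set// !mul1e.
    by have := uv tt tt; rewrite big_ord0 expR0.
  - by move=> A mA; rewrite big_ord0 /= diracE mem_set//=; case.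
  - move=> e k me ke t; rewrite integral_dirac// diracE mem_set// mul1e.
    by rewrite !big_ord0 addr0 mul1r.
pose q (i : 'I_n.+1) (w : W0 * W) : W0 :=
  if unlift ord0 i is Some j then p j w.2 else w.1.
have q0 w : q ord0 w = w.1 by rewrite /q unlift_none.
have qS j w : q (lift ord0 j) w = p j w.2 by rewrite /q liftK.
exists _, (W0 * W)%type, (prob_prod Q0 Q : probability _ _), q; split.
- move=> i; have [->|[j ->]] : i = ord0 \/ exists j, i = lift ord0 j.
    by case: (unliftP ord0 i) => [j ->|->]; [right; exists j|left].
  + by apply: eq_measurable_fun measurable_fst => w _; rewrite q0.
  + apply: (@eq_measurable_fun _ _ _ _ _ (p j \o snd)) => [w _|]; first by rewrite qS.
    exact: measurableT_comp.
- have -> : (fun w w' => \sum_(i < n.+1) c0 (q i w) (q i w')) =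
    (fun w w' => c0 w.1 w'.1 + \sum_(i < n) c0 (p i w.2) (p i w'.2)).
    apply/funext => w; apply/funext => w'; rewrite big_ord_recl !q0; congr +%R.
    by apply: eq_bigr => i _; rewrite !qS.
  exact: (has_prekopa_prod h0 hQ).
- move=> A mA.
  have -> : [set w | forall i, A i (q i w)] =
    A ord0 `*` [set w | forall i : 'I_n, A (lift ord0 i) (p i w)].
    apply/seteqP; split => [w /= Aw|w /= [Aw0 AwS] i].
      by split => [|i]; [have := Aw ord0; rewrite q0|have := Aw (lift ord0 i); rewrite qS].
    by case: (unliftP ord0 i) => [j ->|->]; rewrite ?qS ?q0.
  rewrite [LHS]product_measure1E//.
    by rewrite big_ord_recl; congr (_ * _)%E; exact: (boxQ (fun i => A (lift ord0 i))).
  exact: (measurable_box (A := fun i => A (lift ord0 i))).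
- move=> e k me ke t.
  have -> : (fun w => (cos (t + \sum_(i < n.+1) e i (q i w)))%:E) =
    (fun w => (cos (t + e ord0 w.1 + \sum_(i < n) e (lift ord0 i) (p i w.2)))%:E).
    apply/funext => w; rewrite big_ord_recl !q0 addrA; congr (cos (_ + _))%:E.
    by apply: eq_bigr => i _; rewrite !qS.
  set f := (f in (\int[_]_w f w)%E).
  have mf : measurable_fun setT (fun w : W0 * W => cos (t + e ord0 w.1 + \sum_(i < n) e (lift ord0 i) (p i w.2))).
    apply: (@measurableT_comp _ _ _ _ _ _ (@cos R)).
      by apply: continuous_measurable_fun; exact: continuous_cos.
    apply: measurable_funD; first by apply: measurable_funD => //; exact: measurableT_comp.
    apply: measurable_sum => i; apply: measurableT_comp => //.
    by apply: measurableT_comp => //; exact: mp.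
  have intf : (Q0 \x Q)%E.-integrable setT f.
    apply: (@integrable_bounded _ _ _ (prob_prod Q0 Q) _ 1) => // w.
    by rewrite ler_norml cos_geN1 cos_le1.
  transitivity (\int[Q0]_x \int[Q]_y f (x, y))%E.
    by rewrite -[RHS]/(\int[Q0]_x (fubini_F Q f x))%E integral12_prod_meas1.
  have h x : (\int[Q]_y f (x, y) =
      (\prod_(i < n) k (lift ord0 i))%:E * (cos (t + e ord0 x))%:E)%E.
    by rewrite /f/= -EFinM; apply: (cosQ (fun i => e (lift ord0 i)) (fun i => k (lift ord0 i))).
  under eq_integral do rewrite h.
  rewrite integralZl//; last first.
    apply: (@integrable_bounded _ _ _ Q0 (fun x => cos (t + e ord0 x)) 1) => //.
      apply: measurableT_comp.
        by apply: continuous_measurable_fun; exact: continuous_cos.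
      exact: measurable_funD.
    by move=> w; rewrite ler_norml cos_geN1 cos_le1.
  by rewrite ke -EFinM big_ord_recl mulrA (mulrC (\prod_(i < n) _)).
Qed.

End prekopa_power.

(** * Normal laws *)

Section integral_derivative.
Context {R : realType}.
Local Notation mu := (@lebesgue_measure R).

(** Fundamental theorem of calculus on [-(n + 1), n + 1], then dominated convergence with dominating
    function the absolute value of [g']. *)
Lemma integral_derivative_eq0 (g g' : R -> R) :
  (forall x, is_derive x (1 : R) g (g' x)) -> continuous g' ->
  mu.-integrable setT (EFin \o g') ->
  (fun n => g n.+1%:R) @ \oo --> (0 : R) -> (fun n => g (- n.+1%:R)) @ \oo --> (0 : R) ->
  (\int[mu]_x (g' x)%:E = 0)%E.
Proof.
move=> dg cg' ig' gy gNy.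
have mg' : measurable_fun setT g' by exact: continuous_measurable_fun.
have cg : continuous g.
  by move=> x; apply/differentiable_continuous/derivable1_diffP; have [] := dg x.
pose A n : set R := `[- n.+1%:R, n.+1%:R]%classic.
have h n : (\int[mu]_x ((EFin \o g') \_ (A n)) x = (g n.+1%:R - g (- n.+1%:R))%:E)%E.
  rewrite -integral_mkcond /= (@continuous_FTC2 R g' g)//.
  - by apply: (@lt_trans _ _ 0); rewrite ?oppr_lt0 ?ltr0n.
  - exact: continuous_subspaceT.
  - split; first by move=> x _; have [] := dg x.
    + exact/cvg_at_right_filter/cg.
    + exact/cvg_at_left_filter/cg.
  - by move=> x _; rewrite derive1E; have [_ ->] := dg x.
have mR n : measurable_fun setT ((EFin \o g') \_ (A n)).
  apply: (iffLR (measurable_restrictT _ _)); first exact: measurable_itv.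
  exact/measurable_funTS/measurable_EFinP.
have cv1 : (fun n => \int[mu]_x ((EFin \o g') \_ (A n)) x)%E @ \oo --> (\int[mu]_x (g' x)%:E)%E.
  apply: (@dominated_cvg _ _ _ mu setT measurableT _ _ (fun x => `|g' x|%:E)%E) => //.
  - move=> x _; apply: (cvg_trans _ (@cvg_cst _ (g' x)%:E _ \oo _)) => //.
    apply: near_eq_cvg; near=> n; rewrite patchE mem_set// /A/= in_itv/= -ler_norml.
    have : (Num.bound `|x| <= n)%N by near: n; exact: nbhs_infty_ge.
    move=> hn; apply: (le_trans (ltW (archi_boundP (normr_ge0 x)))).
    by rewrite ler_nat (leq_trans hn).
  - exact: integrable_norm.
  - by move=> n x _; rewrite patchE; case: ifPn => _ //=; rewrite ?normr0 lee_fin.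
have cv2 : (fun n => \int[mu]_x ((EFin \o g') \_ (A n)) x)%E @ \oo --> (0 : \bar R)%E.
  under eq_fun do rewrite h.
  apply: cvg_EFin; first exact: nearW.
  have := cvgB gy gNy; rewrite subr0; exact.
exact: (cvg_unique _ cv1 cv2).
Unshelve. all: by end_near. Qed.

End integral_derivative.

Lemma integral_density d (T : measurableType d) (R : realType)
    (mu : {sigma_finite_measure set T -> \bar R}) (nu : {finite_measure set T -> \bar R})
    (p : T -> R) : measurable_fun setT p -> (forall x, 0 <= p x) ->
  (forall A, measurable A -> nu A = (\int[mu]_(x in A) (p x)%:E)%E) ->
  forall f : T -> R, measurable_fun setT f ->
  (\int[nu]_x (f x)%:E = \int[mu]_x (f x * p x)%:E)%E.
Proof.
move=> mp p0 nuE f mf; rewrite [LHS]integralE [RHS]integralE.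
have mfE : measurable_fun setT (EFin \o f) by exact/measurable_EFinP.
have posE x : ((fun x => (f x * p x)%:E)^\+ x = (fun x => (f x)%:E)^\+ x * (p x)%:E)%E.
  by rewrite !funeposE EFinM maxeMl ?mul0e ?lee_fin.
have negE x : ((fun x => (f x * p x)%:E)^\- x = (fun x => (f x)%:E)^\- x * (p x)%:E)%E.
  by rewrite !funenegE EFinM -mulNe maxeMl ?mul0e ?lee_fin.
congr (_ - _)%E.
  rewrite (ge0_integral_density mp nuE)//; last exact: measurable_funepos.
  by apply: eq_integral => x _; rewrite posE.
rewrite (ge0_integral_density mp nuE)//; last exact: measurable_funeneg.
by apply: eq_integral => x _; rewrite negE.
Qed.

Lemma norm_sqr {R : realDomainType} (x : R) : `|x| ^+ 2 = x ^+ 2.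
Proof. by rewrite real_normK ?num_real. Qed.

Section normal_moments.
Context {R : realType}.
Variables (m s : R).
Hypothesis s0 : s != 0.
Local Notation mu := (@lebesgue_measure R).
Local Notation p := (normal_pdf m s).

Let sq_gt0 : 0 < s ^+ 2. Proof. by rewrite exprn_even_gt0. Qed.

Lemma normal_pdf_exp x : p x = normal_peak s * expR (- ((x - m) ^+ 2 / (2 * s ^+ 2))).
Proof. by rewrite normal_pdfE//= /normal_fun mulNr mulr_natl. Qed.

Lemma is_derive_normal_pdf x : is_derive x (1 : R) p (- ((x - m) / s ^+ 2) * p x).
Proof.
rewrite normal_pdf_exp.
have -> : p = (fun x => normal_peak s * expR (- ((x - m) ^+ 2 / (2 * s ^+ 2)))).
  by apply/funext => z; rewrite normal_pdf_exp.
apply: is_derive_eq; rewrite /GRing.scale/=.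
by field.
Qed.

(** One half of the Gaussian exponent absorbs a quadratic factor; the remaining half is the exponent
    of the normal density of standard deviation [s']. *)
Let s' := Num.sqrt 2 * s.
Let s'0 : s' != 0. Proof. by rewrite mulf_neq0// gt_eqF// sqrtr_gt0. Qed.
Let s'2 : s' ^+ 2 = 2 * s ^+ 2. Proof. by rewrite exprMn sqr_sqrtr. Qed.

Let q4 : 0 < 4 * s ^+ 2. Proof. by apply: mulr_gt0. Qed.
Let q4p : 0 <= 4 * s ^+ 2 * normal_peak s.
Proof. by apply: mulr_ge0; [exact: ltW|exact: normal_peak_ge0]. Qed.
Let q4pp : 0 <= 4 * s ^+ 2 * normal_peak s / normal_peak s'.
Proof. by apply: divr_ge0 => //; exact: normal_peak_ge0. Qed.

Lemma sqr_expR_le (u : R) : u * expR (- (u / (2 * s ^+ 2))) <=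
  4 * s ^+ 2 * expR (- (u / (4 * s ^+ 2))).
Proof.
have -> : - (u / (2 * s ^+ 2)) = - (u / (4 * s ^+ 2)) + - (u / (4 * s ^+ 2)).
  by field.
rewrite expRD mulrA ler_wpM2r ?expR_ge0// expRN ler_pdivrMr ?expR_gt0//.
rewrite -ler_pdivrMl//.
apply: le_trans (expR_ge1Dx _); rewrite mulrC.
by rewrite lerDr.
Qed.

(** The same [K] has two uses: domination by another normal density makes quadratic functions
    integrable, and boundedness kills the boundary terms in the integration by parts. *)
Lemma sqr_normal_pdf_le : exists K, 0 <= K /\
  (forall x, (x - m) ^+ 2 * p x <= K * normal_pdf m s' x) /\
  (forall x, (x - m) ^+ 2 * p x <= K).
Proof.
exists (4 * s ^+ 2 * normal_peak s / normal_peak s' + 4 * s ^+ 2 * normal_peak s); split.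
  exact: addr_ge0.
have h x : (x - m) ^+ 2 * p x <= 4 * s ^+ 2 * normal_peak s * expR (- ((x - m) ^+ 2 / (4 * s ^+ 2))).
  rewrite normal_pdf_exp mulrCA [leRHS]mulrAC mulrC ler_wpM2r ?normal_peak_ge0//.
  exact: sqr_expR_le.
split=> x; apply: (le_trans (h x)).
  apply: (@le_trans _ _ (4 * s ^+ 2 * normal_peak s / normal_peak s' * normal_pdf m s' x)); last first.
    by apply: ler_wpM2r; [exact: normal_pdf_ge0|rewrite lerDl].
  rewrite normal_pdfE//= /normal_fun s'2.
  rewrite [leRHS]mulrA divfK ?gt_eqF ?normal_peak_gt0// mulNr.
  by rewrite (_ : 2 * s ^+ 2 *+ 2 = 4 * s ^+ 2)//; ring.
apply: ler_wpDl => //.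
rewrite ler_piMr// -[leRHS]expR0 ler_expR oppr_le0.
by apply: divr_ge0; [exact: sqr_ge0|exact: (ltW q4)].
Qed.

Lemma integrable_quadratic_normal (f : R -> R) (C : R) : measurable_fun setT f ->
  (forall x, `|f x| <= C * (1 + (x - m) ^+ 2)) ->
  mu.-integrable setT (EFin \o (fun x => f x * p x)).
Proof.
move=> mf fC; have [K [K0 [Kp _]]] := sqr_normal_pdf_le.
have C0 : 0 <= C.
  have := fC m; rewrite subrr expr0n/= addr0 mulr1; exact: le_trans.
have ip : mu.-integrable setT (EFin \o (fun x => C * (p x + K * normal_pdf m s' x))).
  rewrite (_ : _ \o _ = (fun x => C%:E * ((p x)%:E + K%:E * (normal_pdf m s' x)%:E))%E)//.
  apply: integrableZl => //; apply: integrableD => //; first exact: integrable_normal_pdf.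
  by apply: integrableZl => //; exact: integrable_normal_pdf.
apply: le_integrable ip => //.
  apply/measurable_EFinP; apply: measurable_funM => //; exact: measurable_normal_pdf.
move=> x _; rewrite /= lee_fin normrM (ger0_norm (normal_pdf_ge0 _ _ _)).
apply: (@le_trans _ _ (C * (1 + (x - m) ^+ 2) * p x)); first by rewrite ler_wpM2r ?normal_pdf_ge0.
apply: le_trans (ler_norm _); rewrite -mulrA ler_wpM2l// mulrDl mul1r.
by rewrite lerD2l.
Qed.

(** Stein's identity: the integrand is the derivative of G p, because p' = - ((x - m)/s^2) p. The
    boundary terms vanish because G grows at most linearly while (x - m)^2 p is bounded. The mean,
    the variance and the characteristic function of normal laws all come from this identity. *)
Lemma normal_integration_by_parts (G G' : R -> R) (C : R) :
  (forall x, is_derive x (1 : R) G (G' x)) -> continuous G' ->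
  (forall x, `|G x| <= C * (1 + `|x - m|)) -> (forall x, `|G' x| <= C) ->
  (\int[mu]_x ((G' x - G x * ((x - m) / s ^+ 2)) * p x)%:E = 0)%E.
Proof.
move=> dG cG' GC G'C; have [K [K0 [_ Kp]]] := sqr_normal_pdf_le.
have C0 : 0 <= C by apply: le_trans (G'C 0).
have cG : continuous G.
  by move=> x; apply/differentiable_continuous/derivable1_diffP; have [] := dG x.
have cym : continuous (fun x : R => (x - m) / s ^+ 2).
  by move=> x; apply: cvgMl; apply: cvgB; [exact: cvg_id|exact: cvg_cst].
have cf : continuous (fun x => G' x - G x * ((x - m) / s ^+ 2)).
  move=> x; apply: cvgB; first exact: cG'.
  by apply: cvgM; [exact: cG|exact: cym].
have yle (x : R) : `|x - m| <= 1 + (x - m) ^+ 2.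
  by rewrite -subr_ge0 -(@norm_sqr _ (x - m)); nra.
have pub x : p x <= normal_peak s by apply: normal_pdf_ub.
have p0 x : 0 <= p x by apply: normal_pdf_ge0.
pose M := C * (normal_peak s + 2 * K).
have M0 : 0 <= M by rewrite mulr_ge0 ?addr_ge0 ?normal_peak_ge0 ?mulr_ge0.
have gM x : `|G x * p x| * `|x - m| <= M.
  rewrite normrM (ger0_norm (p0 x)).
  apply: (@le_trans _ _ (C * (1 + `|x - m|) * p x * `|x - m|)).
    by do 2 apply: ler_wpM2r => //.
  rewrite -!mulrA ler_wpM2l// mulrCA.
  apply: (@le_trans _ _ (p x * (1 + 2 * (x - m) ^+ 2))).
    apply: ler_wpM2l => //; rewrite mulrDl mul1r -expr2 norm_sqr.
    by have := yle x; lra.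
  rewrite mulrDr mulr1 lerD// mulrCA ler_wpM2l// mulrC.
  exact: Kp.
have cvg0 (z : nat -> R) : (forall n, n.+1%:R - `|m| <= `|z n - m|) ->
    (fun n => G (z n) * p (z n)) @ \oo --> (0 : R).
  move=> zn; apply/cvgr0Pnorm_le => e e0; near=> n.
  have hn : (Num.bound (`|m| + (M + 1) / e) <= n)%N by near: n; exact: nbhs_infty_ge.
  have b0 : 0 <= `|m| + (M + 1) / e by rewrite addr_ge0// divr_ge0 ?addr_ge0// ltW.
  have hz : (M + 1) / e <= `|z n - m|.
    apply: le_trans (zn n); rewrite lerBrDl.
    apply: (le_trans (ltW (archi_boundP b0))).
    by rewrite ler_nat (leq_trans hn).
  have zpos : 0 < `|z n - m|.
    by apply: lt_le_trans hz; rewrite divr_gt0// ltr_wpDl.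
  rewrite -(ler_pM2r zpos); apply: (le_trans (gM _)).
  move: hz; rewrite ler_pdivrMr// mulrC; apply: le_trans.
  by rewrite lerDl.
apply: (@integral_derivative_eq0 R (fun x => G x * p x)).
- move=> x; have dGx := dG x; have dpx := is_derive_normal_pdf x.
  apply: is_derive_eq; rewrite /GRing.scale/=; ring.
- by move=> x; apply: cvgM; [exact: cf|exact: continuous_normal_pdf].
- apply: (@integrable_quadratic_normal _ (C + 2 * C / s ^+ 2)).
    exact: continuous_measurable_fun.
  move=> x; apply: (le_trans (ler_normB _ _)).
  rewrite [leRHS]mulrDl lerD//.
    by apply: le_trans (G'C x) _; rewrite ler_peMr// lerDl sqr_ge0.
  rewrite normrM normf_div (ger0_norm (ltW sq_gt0)) [leLHS]mulrA [leRHS]mulrAC ler_pM2r ?invr_gt0//.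
  apply: (@le_trans _ _ (C * (1 + `|x - m|) * `|x - m|)); first exact: ler_wpM2r.
  rewrite (mulrC 2) -!mulrA ler_wpM2l//.
  rewrite mulrDl mul1r -expr2 norm_sqr.
  by have := yle x; have := sqr_ge0 (x - m); lra.
- apply: cvg0 => n; rewrite -[X in X - _ <= _](ger0_norm (ler0n R n.+1)).
  exact: lerB_dist.
- apply: cvg0 => n; rewrite -[X in X - _ <= _](ger0_norm (ler0n R n.+1)).
  by rewrite -(normrN n.+1%:R); exact: lerB_dist.
Unshelve. all: by end_near. Qed.

End normal_moments.

Lemma integral_law d d' (T : measurableType d) (T' : measurableType d') (R : realType)
    (P : {measure set T -> \bar R}) (nu : {measure set T' -> \bar R}) (X : T -> T')
    (f : T' -> \bar R) :
  measurable_fun setT X -> (forall A, measurable A -> P (X @^-1` A) = nu A) ->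
  measurable_fun setT f -> (\int[P]_w f (X w) = \int[nu]_x f x)%E.
Proof.
move=> mX law mf.
have ge0 (g : T' -> \bar R) : measurable_fun setT g -> (forall x, 0 <= g x)%E ->
    (\int[P]_w g (X w) = \int[nu]_x g x)%E.
  move=> mg g0; rewrite -(@ge0_integral_pushforward _ _ _ _ _ _ mX _ setT)//.
  apply: (@eq_measure_integral _ _ _ setT nu
    (measure_function_pushforward__canonical__measure_function_Measure P mX)) => A mA _.
  exact: law.
rewrite [LHS]integralE [RHS]integralE; congr (_ - _)%E.
  rewrite -ge0//; last exact: measurable_funepos.
  by apply: eq_integral => x _; rewrite !funeposE.
rewrite -ge0//; last exact: measurable_funeneg.
by apply: eq_integral => x _; rewrite !funenegE.
Qed.

Section normal_integrals.
Context {R : realType}.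
Variables (m s : R).
Hypothesis s0 : s != 0.
Local Notation mu := (@lebesgue_measure R).
Local Notation p := (normal_pdf m s).
Local Notation N := (normal_prob m s).

Lemma integral_normal (f : R -> R) : measurable_fun setT f ->
  (\int[N]_x (f x)%:E = \int[mu]_x (f x * p x)%:E)%E.
Proof.
move=> mf; apply: integral_density => //; first exact: measurable_normal_pdf.
by move=> x; exact: normal_pdf_ge0.
Qed.

Lemma normal_mean_centered : (\int[mu]_x ((x - m) * p x)%:E = 0)%E.
Proof.
have sq : s ^+ 2 != 0 by rewrite sqrf_eq0.
have h : (\int[mu]_x ((0 - 1 * ((x - m) / s ^+ 2)) * p x)%:E = 0)%E.
  apply: (@normal_integration_by_parts _ m s s0 (cst 1) (cst 0) 1).
  - by move=> x; exact: cvg_cst.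
  - by move=> x /=; rewrite normr1 mul1r lerDl.
  - by move=> x /=; rewrite normr0.
have i1 : mu.-integrable setT (EFin \o (fun x => (x - m) * p x)).
  apply: (@integrable_quadratic_normal _ m s s0 _ 1); first exact: measurable_funB.
  by move=> x; rewrite mul1r -(@norm_sqr _ (x - m)); have := normr_ge0 (x - m); nra.
have : (\int[mu]_x ((- (s ^+ 2)^-1)%:E * ((x - m) * p x)%:E) = 0)%E.
  rewrite -h; apply: eq_integral => x _; rewrite -EFinM; congr EFin.
  by field.
rewrite integralZl// => /eqP; rewrite mule_eq0 => /orP[|/eqP//].
by rewrite eqe oppr_eq0 invr_eq0 (negbTE sq).
Qed.

Lemma normal_variance : (\int[mu]_x ((x - m) ^+ 2 * p x)%:E = (s ^+ 2)%:E)%E.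
Proof.
have sq : s ^+ 2 != 0 by rewrite sqrf_eq0.
have h : (\int[mu]_x ((1 - (x - m) * ((x - m) / s ^+ 2)) * p x)%:E = 0)%E.
  apply: (@normal_integration_by_parts _ m s s0 (fun x => x - m) (cst 1) 1).
  - by move=> x; apply: is_derive_eq; rewrite subr0.
  - by move=> x; exact: cvg_cst.
  - by move=> x /=; rewrite mul1r lerDr.
  - by move=> x /=; rewrite normr1.
have i2 : mu.-integrable setT (EFin \o (fun x => (x - m) ^+ 2 * p x)).
  apply: (@integrable_quadratic_normal _ m s s0 _ 1); first exact/measurable_funX/measurable_funB.
  by move=> x; rewrite mul1r ger0_norm ?sqr_ge0// lerDr.
have : (\int[mu]_x ((p x)%:E - (s ^+ 2)^-1%:E * ((x - m) ^+ 2 * p x)%:E) = 0)%E.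
  rewrite -h; apply: eq_integral => x _; rewrite -EFinM -EFinB; congr EFin.
  by field.
rewrite integralB//; last 2 first.
- exact: integrable_normal_pdf.
- exact: integrableZl.
rewrite integralZl// integral_normal_pdf.
have := integrable_fin_num measurableT i2; rewrite /comp/=.
case: (\int[mu]_x _)%E => // r _; rewrite -EFinM -EFinB => -[] /eqP.
rewrite subr_eq0 => /eqP h1; congr EFin.
by rewrite -[RHS]mulr1 h1 mulrA mulfV ?mul1r.
Qed.

(** Characteristic function of the centered normal law at [a], in real form: the phase [t] covers
    both the real and the imaginary part. *)
Let phi t a : R := (\int[mu]_x (cos (t + a * (x - m)) * p x))%R.

Let mcos (u : R -> R) : measurable_fun setT u -> measurable_fun setT (fun x => cos (u x)).
Proof.
move=> h; apply: measurableT_comp => //.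
by apply: continuous_measurable_fun; exact: continuous_cos.
Qed.

Let msin (u : R -> R) : measurable_fun setT u -> measurable_fun setT (fun x => sin (u x)).
Proof.
move=> h; apply: measurableT_comp => //.
by apply: continuous_measurable_fun; exact: continuous_sin.
Qed.

Let maff t a : measurable_fun setT (fun x : R => t + a * (x - m)).
Proof. by apply: measurable_funD => //; apply: measurable_funM => //; exact: measurable_funB. Qed.

Let icos t a : mu.-integrable setT (EFin \o (fun x => cos (t + a * (x - m)) * p x)).
Proof.
apply: (@integrable_quadratic_normal _ m s s0 _ 1); first by apply: mcos; exact: maff.
move=> x; rewrite mul1r; apply: (@le_trans _ _ 1); last by rewrite lerDl sqr_ge0.
by rewrite ler_norml cos_geN1 cos_le1.
Qed.

Let isin t a : mu.-integrable setT (EFin \o (fun x => (x - m) * sin (t + a * (x - m)) * p x)).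
Proof.
apply: (@integrable_quadratic_normal _ m s s0 _ 1).
  apply: measurable_funM; [exact: measurable_funB|by apply: msin; exact: maff].
move=> x; rewrite mul1r normrM; apply: (@le_trans _ _ (`|x - m| * 1)).
  by rewrite ler_wpM2l// ler_norml sin_geN1 sin_le1.
by rewrite -(@norm_sqr _ (x - m)); have := normr_ge0 (x - m); nra.
Qed.

Let is_derive_aff t a x : is_derive x (1 : R) (fun x => t + a * (x - m)) a.
Proof. by apply: is_derive_eq; rewrite /GRing.scale/=; ring. Qed.

Let phi_parts t a : (\int[mu]_x ((x - m) * sin (t + a * (x - m)) * p x))%R = s ^+ 2 * (a * phi t a).
Proof.
have h : (\int[mu]_x ((a * cos (t + a * (x - m)) - sin (t + a * (x - m)) * ((x - m) / s ^+ 2)) * p x)%:E = 0)%E.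
  apply: (@normal_integration_by_parts _ m s s0 (fun x => sin (t + a * (x - m)))
    (fun x => a * cos (t + a * (x - m))) (1 + `|a|)).
  - by move=> x; have := is_derive_aff t a x => dax; apply: is_derive_eq; rewrite /GRing.scale/= mulrC.
  - move=> x; apply: cvgM; first exact: cvg_cst.
    apply: continuous_comp; last exact: continuous_cos.
    by apply: cvgD; [exact: cvg_cst|apply: cvgM; [exact: cvg_cst|apply: cvgB; [exact: cvg_id|exact: cvg_cst]]].
  - move=> x; apply: (@le_trans _ _ 1); first by rewrite ler_norml sin_geN1 sin_le1.
    by have := normr_ge0 a; have := normr_ge0 (x - m); nra.
  - move=> x; rewrite normrM; apply: (@le_trans _ _ (`|a| * 1)).
      by rewrite ler_wpM2l// ler_norml cos_geN1 cos_le1.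
    by rewrite mulr1 lerDr.
have sq : s ^+ 2 != 0 by rewrite sqrf_eq0.
have : (\int[mu]_x (a * (cos (t + a * (x - m)) * p x)
    - (s ^+ 2)^-1 * ((x - m) * sin (t + a * (x - m)) * p x)))%R = 0.
  rewrite /Rintegral (_ : (\int[mu]_x _)%E = 0%E)// -[RHS]h.
  by apply: eq_integral => x _; congr EFin; field.
rewrite RintegralB//; last 2 first.
- by have := integrableZl measurableT a (icos t a).
- by have := integrableZl measurableT (s ^+ 2)^-1 (isin t a).
rewrite !RintegralZl// => /eqP; rewrite subr_eq0 => /eqP ->.
by rewrite mulrA mulfV// mul1r.
Qed.

(** Differentiation under the integral sign, dominated by [|x - m|] times the density, followed by
    Stein's identity for the sine. *)
Let is_derive_phi t a : is_derive a (1 : R) (phi t) (- (s ^+ 2 * (a * phi t a))).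
Proof.
pose f a x := cos (t + a * (x - m)) * p x.
have df b x : is_derive b (1 : R) (f ^~ x) (- ((x - m) * sin (t + b * (x - m)) * p x)).
  by apply: is_derive_eq; rewrite /GRing.scale/=; ring.
have d1 b x : partial1of2 f b x = - ((x - m) * sin (t + b * (x - m)) * p x).
  by rewrite /partial1of2 derive1E; have [_ ->] := df b x.
have aI : `](a - 1), (a + 1)[%classic a by rewrite /= in_itv/= ltrBlDr ltrDl ltr01.
have ig : mu.-integrable setT (EFin \o (fun x => `|x - m| * p x)).
  apply: (@integrable_quadratic_normal _ m s s0 _ 1).
    by apply: measurableT_comp => //; exact: measurable_funB.
  by move=> x; rewrite mul1r normr_id -(@norm_sqr _ (x - m)); have := normr_ge0 (x - m); nra.
have g0 x : 0 <= `|x - m| * p x by rewrite mulr_ge0 ?normal_pdf_ge0.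
have gub b x : `](a - 1), (a + 1)[%classic b -> [set: R] x -> `|partial1of2 f b x| <= `|x - m| * p x.
  move=> _ _; rewrite d1 normrN 2!normrM (ger0_norm (normal_pdf_ge0 _ _ _)).
  rewrite ler_wpM2r ?normal_pdf_ge0// ler_piMr//.
  by rewrite ler_norml sin_geN1 sin_le1.
have fder b x : `](a - 1), (a + 1)[%classic b -> [set: R] x -> derivable (f ^~ x) b 1.
  by move=> _ _; have [] := df b x.
have fint b : `](a - 1), (a + 1)[%classic b -> mu.-integrable setT (EFin \o f b).
  by move=> _; exact: icos.
apply: DeriveDef.
  exact: (derivable_under_integral measurableT aI fint fder g0 ig gub).
rewrite -derive1E (differentiation_under_integral measurableT aI fint fder g0 ig gub).
rewrite -phi_parts -mulN1r -RintegralZl//.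
by apply: eq_Rintegral => x _; rewrite d1 mulN1r.
Qed.

(** The linear differential equation is solved by its integrating factor: phi times exp (s^2 a^2/2)
    has derivative 0 and equals cos t at a = 0. *)
Let phiE t a : phi t a = expR (- (s ^+ 2 * a ^+ 2 / 2)) * cos t.
Proof.
have h b : is_derive b (1 : R) (fun b => phi t b * expR (s ^+ 2 * b ^+ 2 / 2)) 0.
  have := is_derive_phi t b => dphi; apply: is_derive_eq; rewrite /GRing.scale/=.
  by field.
have := @is_derive_0_is_cst _ _ a 0 h; rewrite expr0n/= mulr0 mul0r expR0 mulr1 => ha.
rewrite -[LHS](mulfK (lt0r_neq0 (expR_gt0 (s ^+ 2 * a ^+ 2 / 2)))) ha expRN mulrC; congr (_ * _).
rewrite /phi -[RHS]mulr1.
have <- : (\int[mu]_x (p x))%R = 1 by rewrite /Rintegral integral_normal_pdf.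
rewrite -RintegralZl//; last exact: integrable_normal_pdf.
by apply: eq_Rintegral => x _; rewrite mul0r addr0.
Qed.

Lemma normal_cos t a :
  (\int[N]_x (cos (t + a * x))%:E = (expR (- (s ^+ 2 * a ^+ 2 / 2)) * cos (t + a * m))%:E)%E.
Proof.
rewrite integral_normal//; last by apply: mcos; apply: measurable_funD => //; exact: measurable_funM.
rewrite -phiE /phi /Rintegral fineK; last first.
  by apply: integrable_fin_num => //; exact: icos.
apply: eq_integral => x _; congr (cos _ * _)%:E; ring.
Qed.

Lemma integrable_normal_quadratic (f : R -> R) (C : R) : measurable_fun setT f ->
  (forall x, `|f x| <= C * (1 + (x - m) ^+ 2)) -> N.-integrable setT (EFin \o f).
Proof.
move=> mf fC; apply/integrableP; split; first exact/measurable_EFinP.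
have := integrable_quadratic_normal s0 mf fC => /integrableP[_].
have -> : (\int[N]_x `|(EFin \o f) x| = \int[mu]_x (`|f x| * p x)%:E)%E.
  by apply: (@integral_normal (fun x => `|f x|)); exact: measurableT_comp.
apply: le_lt_trans; rewrite le_eqVlt; apply/orP; left; apply/eqP.
apply: eq_integral => x _ /=.
by rewrite normrM (ger0_norm (normal_pdf_ge0 _ _ _)).
Qed.

End normal_integrals.

(** * Gaussian variables, Gaussian vectors and factorization of their covariance *)

Section gaussian_variable.
Context d (T : measurableType d) {R : realType} (P : probability T R).

Lemma gaussian_sq_integrable (X : T -> R) : is_gaussian P X ->
  P.-integrable setT (EFin \o (fun w => X w ^+ 2)).
Proof.
move=> [mX [m [s law]]].
have mX2 : measurable_fun setT (fun w => X w ^+ 2) by exact: measurable_funX.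
have mabs : measurable_fun setT (fun x : R => (`|x ^+ 2|%:E)).
  by apply/measurable_EFinP; apply: measurableT_comp => //; exact: measurable_funX.
apply/integrableP; split; first exact/measurable_EFinP.
have [s0|s0] := eqVneq s 0.
  rewrite (@integral_law _ _ _ _ R P (dirac m) X (fun x => `|x ^+ 2|%:E)%E)//.
    by rewrite integral_dirac// diracT mul1e ltry.
  by move=> A mA; have := law A mA; rewrite /gaussian_prob s0 eqxx.
rewrite (@integral_law _ _ _ _ R P (normal_prob m s) X (fun x => `|x ^+ 2|%:E)%E)//; last first.
  by move=> A mA; have := law A mA; rewrite /gaussian_prob (negbTE s0).
have : (normal_prob m s).-integrable setT (EFin \o (fun x : R => x ^+ 2)).
  (* From x^2 <= 2 (x - m)^2 + 2 m^2, that is, (x - 2 m)^2 >= 0. *)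
  apply: (@integrable_normal_quadratic _ m s s0 _ (2 + 2 * m ^+ 2)).
    exact: measurable_funX.
  move=> x; rewrite ger0_norm ?sqr_ge0//.
  have h1 := sqr_ge0 (x - 2 * m); have h2 : 0 <= m ^+ 2 * (x - m) ^+ 2 by rewrite mulr_ge0 ?sqr_ge0.
  nra.
by move=> /integrableP[].
Qed.

(** The first two moments identify the parameters of the law, m = 0 and s^2 = v; the Dirac case is
    the one where v = 0. *)
Lemma gaussian_cos (X : T -> R) (v : R) : is_gaussian P X -> ('E_P[X] = 0)%E ->
  (\int[P]_w (X w ^+ 2)%:E = v%:E)%E ->
  forall t, (\int[P]_w (cos (t + X w))%:E = (expR (- (v / 2)) * cos t)%:E)%E.
Proof.
move=> [mX [m [s law]]] EX EX2 t.
have mcos : measurable_fun setT (fun x : R => (cos (t + x))%:E).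
  apply/measurable_EFinP; apply: measurableT_comp; last exact: measurable_funD.
  by apply: continuous_measurable_fun; exact: continuous_cos.
have msq : measurable_fun setT (fun x : R => (x ^+ 2)%:E).
  by apply/measurable_EFinP; exact: measurable_funX.
have [s0|s0] := eqVneq s 0.
  have L f : measurable_fun setT f -> (\int[P]_w f (X w) = f m)%E.
    move=> mf; rewrite (@integral_law _ _ _ _ R P (dirac m) X f)//.
      by rewrite integral_dirac// diracT mul1e.
    by move=> A mA; have := law A mA; rewrite /gaussian_prob s0 eqxx.
  have m0 : m = 0.
    move: EX; rewrite unlock (L (fun x => x%:E))//; first by move=> [].
    exact/measurable_EFinP.
  move: EX2; rewrite (L _ msq) m0 expr0n => -[<-].
  by rewrite (L _ mcos) m0 addr0 mul0r oppr0 expR0 mul1r.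
have L f : measurable_fun setT f -> (\int[P]_w f (X w) = \int[normal_prob m s]_x f x)%E.
  move=> mf; apply: (@integral_law _ _ _ _ R P (normal_prob m s) X f) => //.
  by move=> A mA; have := law A mA; rewrite /gaussian_prob (negbTE s0).
have i1 : (normal_prob m s).-integrable setT (EFin \o (fun x : R => x - m)).
  apply: (@integrable_normal_quadratic _ m s s0 _ 1); first exact: measurable_funB.
  by move=> x; rewrite mul1r -(@norm_sqr _ (x - m)); have := normr_ge0 (x - m); nra.
have Em : (\int[normal_prob m s]_x (x - m)%:E = 0)%E.
  by rewrite integral_normal ?normal_mean_centered//; exact: measurable_funB.
have m0 : m = 0.
  move: EX; rewrite unlock (L (fun x => x%:E)); last exact/measurable_EFinP.
  have -> : (\int[normal_prob m s]_x x%:E = \int[normal_prob m s]_x ((x - m)%:E + m%:E))%E.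
    by apply: eq_integral => x _; rewrite -EFinD subrK.
  rewrite integralD//; last first.
    by have := finite_measure_integrable_cst (normal_prob m s) m measurableT.
  by rewrite Em add0e (integral_prob_cst (normal_prob m s)) => -[].
move: EX2; rewrite (L _ msq) integral_normal; last exact: measurable_funX.
have := @normal_variance _ m s s0; rewrite m0.
under eq_integral do rewrite subr0.
move=> -> [<-]; rewrite (L _ mcos).
transitivity (\int[normal_prob m s]_x (cos (t + 1 * x))%:E)%E.
  by apply: eq_integral => x _; rewrite mul1r.
by rewrite normal_cos// m0 mulr0 addr0 expr1n mulr1.
Qed.

End gaussian_variable.

Section gaussian_vector.
Context d (T : measurableType d) {R : realType} (P : probability T R).
Variables (N : nat) (X : 'I_N -> T -> R) (S : 'I_N -> 'I_N -> R).
Hypothesis gX : forall c : 'I_N -> R, is_gaussian P (fun w => \sum_(k < N) c k * X k w).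
Hypothesis EX : forall k, ('E_P[X k] = 0)%E.
Hypothesis covX : forall k l, (\int[P]_w (X k w * X l w)%:E = (S k l)%:E)%E.

Lemma gaussian_vector_coord k : is_gaussian P (X k).
Proof.
have := gX (fun l => (l == k)%:R); congr (is_gaussian _ _).
apply/funext => w; rewrite (bigD1 k)//= eqxx mul1r big1 ?addr0// => l /negbTE ->.
by rewrite mul0r.
Qed.

Lemma gaussian_vector_integrable k : P.-integrable setT (EFin \o X k).
Proof.
have [mX _] := gaussian_vector_coord k.
have i2 := gaussian_sq_integrable (gaussian_vector_coord k).
have i1 := finite_measure_integrable_cst P 1 measurableT.
have := integrableD measurableT i1 i2.
apply: le_integrable => //; first exact/measurable_EFinP.
move=> w _; rewrite /= lee_fin.
rewrite [leRHS]ger0_norm ?addr_ge0 ?sqr_ge0// -(@norm_sqr _ (X k w)).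
by have := normr_ge0 (X k w); nra.
Qed.

Lemma gaussian_vector_prod_integrable k l :
  P.-integrable setT (EFin \o (fun w => X k w * X l w)).
Proof.
have [mX _] := gaussian_vector_coord k; have [mY _] := gaussian_vector_coord l.
have i1 := gaussian_sq_integrable (gaussian_vector_coord k).
have i2 := gaussian_sq_integrable (gaussian_vector_coord l).
have := integrableD measurableT i1 i2.
apply: le_integrable => //; first by apply/measurable_EFinP; exact: measurable_funM.
move=> w _; rewrite /= lee_fin.
rewrite [leRHS]ger0_norm ?addr_ge0 ?sqr_ge0// normrM.
rewrite -(@norm_sqr _ (X k w)) -(@norm_sqr _ (X l w)).
by have := normr_ge0 (X k w); have := normr_ge0 (X l w); nra.
Qed.

Lemma gaussian_vector_variance (c : 'I_N -> R) :
  (\int[P]_w ((\sum_(k < N) c k * X k w) ^+ 2)%:E =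
   (\sum_(k < N) \sum_(l < N) c k * c l * S k l)%:E)%E.
Proof.
transitivity (\int[P]_w (\sum_(k < N) \sum_(l < N) (c k * c l)%:E * (X k w * X l w)%:E))%E.
  apply: eq_integral => w _; rewrite expr2 mulr_suml -sumEFin.
  apply: eq_bigr => k _; rewrite mulr_sumr -sumEFin; apply: eq_bigr => l _.
  by rewrite -EFinM; congr EFin; ring.
have i k l : P.-integrable setT (fun w => (c k * c l)%:E * (X k w * X l w)%:E)%E.
  by apply: integrableZl => //; exact: gaussian_vector_prod_integrable.
rewrite integral_sum//; last by move=> k; apply: integrable_sum.
rewrite -sumEFin; apply: eq_bigr => k _.
rewrite integral_sum//; rewrite -sumEFin; apply: eq_bigr => l _.
by rewrite integralZl ?covX//; exact: gaussian_vector_prod_integrable.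
Qed.

Lemma gaussian_vector_psd (c : 'I_N -> R) :
  0 <= \sum_(k < N) \sum_(l < N) c k * c l * S k l.
Proof.
rewrite -lee_fin -gaussian_vector_variance; apply: integral_ge0 => w _.
by rewrite lee_fin sqr_ge0.
Qed.

Lemma gaussian_vector_cos (c : 'I_N -> R) t :
  (\int[P]_w (cos (t + \sum_(k < N) c k * X k w))%:E =
   (expR (- ((\sum_(k < N) \sum_(l < N) c k * c l * S k l) / 2)) * cos t)%:E)%E.
Proof.
apply: gaussian_cos => //; last exact: gaussian_vector_variance.
rewrite unlock.
transitivity (\int[P]_w (\sum_(k < N) (c k)%:E * (X k w)%:E))%E.
  by apply: eq_integral => w _; rewrite -sumEFin.
rewrite integral_sum//.
  rewrite big1// => k _; rewrite integralZl//; last exact: gaussian_vector_integrable.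
  by have := EX k; rewrite unlock => ->; rewrite mule0.
by move=> k; apply: integrableZl => //; exact: gaussian_vector_integrable.
Qed.

End gaussian_vector.

(** Cholesky factorization: the first column is split off and the induction hypothesis is applied to
    the Schur complement [S']. If the pivot vanishes, so does its column; since division by 0 gives
    0, the same formulas then remain valid. *)
Lemma psd_factorization {R : rcfType} (N : nat) (S : 'I_N -> 'I_N -> R) :
  (forall k l, S k l = S l k) ->
  (forall c : 'I_N -> R, 0 <= \sum_(k < N) \sum_(l < N) c k * c l * S k l) ->
  exists A : 'I_N -> 'I_N -> R, forall k l, S k l = \sum_(j < N) A k j * A l j.
Proof.
elim: N S => [|N IHN] S Ssym Spsd; first by exists S; case.
have quad (x : R) (c : 'I_N -> R) :
    \sum_(k < N.+1) \sum_(l < N.+1)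
      (if unlift ord0 k is Some k' then c k' else x) *
      (if unlift ord0 l is Some l' then c l' else x) * S k l =
    x ^+ 2 * S ord0 ord0 + 2 * x * (\sum_(k < N) c k * S (lift ord0 k) ord0) +
    \sum_(k < N) \sum_(l < N) c k * c l * S (lift ord0 k) (lift ord0 l).
  rewrite big_ord_recl big_ord_recl unlift_none -!addrA -expr2; congr (_ + _).
  have -> : \sum_(i < N) x * (if unlift ord0 (lift ord0 i) is Some l' then c l' else x) *
      S ord0 (lift ord0 i) = x * \sum_(k < N) c k * S (lift ord0 k) ord0.
    rewrite mulr_sumr; apply: eq_bigr => i _; rewrite liftK Ssym; ring.
  have -> : \sum_(i < N) \sum_(l < N.+1)
     (if unlift ord0 (lift ord0 i) is Some k' then c k' else x) *
     (if unlift ord0 l is Some l' then c l' else x) * S (lift ord0 i) l =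
     x * (\sum_(k < N) c k * S (lift ord0 k) ord0) +
     \sum_(k < N) \sum_(l < N) c k * c l * S (lift ord0 k) (lift ord0 l).
    rewrite mulr_sumr -big_split; apply: eq_bigr => i _.
    rewrite big_ord_recl unlift_none !liftK; congr (_ + _); first ring.
    by apply: eq_bigr => j _; rewrite liftK.
  ring.
have S00 : 0 <= S ord0 ord0.
  have := Spsd (fun k => if unlift ord0 k is Some k' then 0 else 1).
  rewrite (quad 1 (fun=> 0)) expr1n mul1r.
  rewrite big1 ?mulr0 ?addr0; last by move=> i _; rewrite mul0r.
  by rewrite big1 ?addr0// => i _; rewrite big1// => j _; rewrite !mul0r.
pose S' k l := S (lift ord0 k) (lift ord0 l) -
   S (lift ord0 k) ord0 * S (lift ord0 l) ord0 / S ord0 ord0.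
have S0 : S ord0 ord0 = 0 -> forall k, S (lift ord0 k) ord0 = 0.
  move=> S00e k; apply/eqP/negPn/negP => Sk0.
  set y := S (lift ord0 k) ord0; set z := S (lift ord0 k) (lift ord0 k).
  (* With a zero pivot the form at this vector equals 2 x y + z, and this choice of x makes it
     -1. *)
  pose x := - (z + 1) / (2 * y).
  have := Spsd (fun l => if unlift ord0 l is Some l' then (l' == k)%:R else x).
  rewrite (quad x (fun l => (l == k)%:R)) S00e mulr0 add0r.
  rewrite (bigD1 k)//= eqxx mul1r big1 ?addr0; last by move=> i /negbTE ->; rewrite mul0r.
  rewrite (bigD1 k)//= (bigD1 k)//= eqxx !mul1r big1 ?addr0; last first.
    by move=> i /negbTE ->; rewrite mulr0 mul0r.
  rewrite big1 ?addr0; last by move=> i /negbTE ->; rewrite big1// => j _; rewrite !mul0r.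
  rewrite -/y -/z /x (_ : 2 * (- (z + 1) / (2 * y)) * y = - (z + 1)); last by field.
  lra.
have [||A hA] := IHN S'.
- by move=> k l; rewrite /S' Ssym; congr (_ - _ / _); rewrite mulrC.
- move=> c; pose b := \sum_(k < N) c k * S (lift ord0 k) ord0.
  have -> : \sum_(k < N) \sum_(l < N) c k * c l * S' k l =
    \sum_(k < N) \sum_(l < N) c k * c l * S (lift ord0 k) (lift ord0 l) - b * b / S ord0 ord0.
    rewrite {1}/b !mulr_suml -sumrB; apply: eq_bigr => k _.
    rewrite /b mulr_sumr mulr_suml -sumrB; apply: eq_bigr => l _.
    by rewrite /S'; ring.
  have [S00e|S00n] := eqVneq (S ord0 ord0) 0.
    have -> : b = 0 by rewrite /b big1// => k _; rewrite S0// mulr0.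
    rewrite !mul0r subr0.
    have := Spsd (fun l => if unlift ord0 l is Some l' then c l' else 0).
    by rewrite (quad 0 c) expr0n/= !(mul0r, mulr0, add0r).
  (* The first entry minimizes the form when the others are [c]; the minimum is the Schur complement
     at [c]. *)
  have := Spsd (fun l => if unlift ord0 l is Some l' then c l' else - b / S ord0 ord0).
  rewrite (quad _ c) -/b; congr (0 <= _).
  by field.
exists (fun k j =>
  if unlift ord0 k is Some k' then
    (if unlift ord0 j is Some j' then A k' j' else S k ord0 / Num.sqrt (S ord0 ord0))
  else (if unlift ord0 j is Some j' then 0 else Num.sqrt (S ord0 ord0))).
have sq : Num.sqrt (S ord0 ord0) * Num.sqrt (S ord0 ord0) = S ord0 ord0.
  by rewrite -expr2 sqr_sqrtr.
move=> k l; rewrite big_ord_recl unlift_none.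
case: (unliftP ord0 k) => [k' ->|->]; case: (unliftP ord0 l) => [l' ->|->].
- under eq_bigr do rewrite liftK.
  rewrite -hA /S' mulf_div sq; ring.
- rewrite big1 ?addr0; last by move=> i _; rewrite liftK mulr0.
  have [S00e|S00n] := eqVneq (S ord0 ord0) 0; first by rewrite S00e sqrtr0 S0// mulr0.
  by rewrite divfK// sqrtr_eq0 -ltNge lt_def S00n.
- rewrite big1 ?addr0; last by move=> i _; rewrite liftK mul0r.
  have [S00e|S00n] := eqVneq (S ord0 ord0) 0; first by rewrite Ssym S00e sqrtr0 S0// mul0r.
  by rewrite mulrC divfK 1?Ssym// sqrtr_eq0 -ltNge lt_def S00n.
- rewrite big1 ?addr0 ?sq// => i _; rewrite liftK mul0r//.
Qed.

(** * Uniqueness of Fourier transforms *)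

Section weighted_law.
Context d (T : measurableType d) {R : realType} (P : probability T R).
Variables (z X : T -> R).
Hypothesis mz : measurable_fun setT z.
Hypothesis z0 : forall w, 0 <= z w.
Hypothesis mX : measurable_fun setT X.

(** The law of [X] under the measure with density [z]. Weights allow uniqueness of Fourier
    transforms to be used for one coordinate of a vector at a time, the other coordinates being
    absorbed in [z]. *)
Definition weighted_law (A : set (measurableTypeR R)) : \bar R :=
  (\int[P]_(w in X @^-1` A) (z w)%:E)%E.

Let weighted_law0 : weighted_law set0 = 0%E.
Proof. by rewrite /weighted_law preimage_set0 integral_set0. Qed.

Let weighted_law_ge0 A : (0 <= weighted_law A)%E.
Proof. by apply: integral_ge0 => w _; rewrite lee_fin. Qed.

Let weighted_law_sigma_additive : semi_sigma_additive weighted_law.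
Proof.
move=> F mF tF mUF; rewrite /weighted_law preimage_bigcup; apply: cvg_toP.
  apply: ereal_nondecreasing_is_cvgn => m n mn.
  apply: lee_sum_nneg_natr => // k _ _; exact: weighted_law_ge0.
rewrite ge0_integral_bigcup//=.
- by move=> k; have := mX measurableT (mF k); rewrite setTI.
- by apply/measurable_EFinP/measurable_funTS.
- by move=> w _; rewrite lee_fin.
- apply/trivIsetP => /= i j _ _ ij; rewrite -preimage_setI.
  by move/trivIsetP : tF => /(_ _ _ _ _ ij) ->//; rewrite preimage_set0.
Qed.

HB.instance Definition _ := isMeasure.Build _ _ _
  weighted_law weighted_law0 weighted_law_ge0 weighted_law_sigma_additive.

Definition weighted_law_measure : {measure set (measurableTypeR R) -> \bar R} :=
  weighted_law.

Lemma weighted_lawE (A : set R) : measurable A ->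
  weighted_law A = (\int[P]_w (z w * \1_A (X w))%:E)%E.
Proof.
move=> mA; rewrite /weighted_law integral_mkcond; apply: eq_integral => w _.
rewrite patchE indicE; case: ifPn => h.
  by rewrite mem_set ?mulr1//; rewrite inE in h.
by rewrite memNset ?mulr0//; rewrite notin_setE in h.
Qed.

End weighted_law.

Section bounded_convergence.
Context d (T : measurableType d) {R : realType} (P : probability T R).

Lemma bounded_cvg_integral (f_ : (T -> R)^nat) (f : T -> R) (M : R) :
  (forall n, measurable_fun setT (f_ n)) -> (forall n w, `|f_ n w| <= M) ->
  (forall w, (fun n => f_ n w) @ \oo --> f w) ->
  (fun n => \int[P]_w (f_ n w)%:E)%E @ \oo --> (\int[P]_w (f w)%:E)%E.
Proof.
move=> mf fM ff; apply: (@dominated_cvg _ _ _ P setT measurableT _ _ (EFin \o cst M)) => //.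
- by move=> n; exact/measurable_EFinP.
- by move=> w _; apply: cvg_EFin; [exact: nearW|exact: ff].
- exact: (finite_measure_integrable_cst P M measurableT).
- by move=> n w _; rewrite /= lee_fin.
Qed.

End bounded_convergence.

Section normal_tail.
Context {R : realType}.
Variables (m s : R).
Hypothesis s0 : s != 0.

(** Chebyshev's inequality. *)
Lemma normal_prob_tail (r : R) (A : set R) : 0 < r -> measurable A ->
  (forall y, A y -> r <= `|y - m|) -> (normal_prob m s A <= (s ^+ 2 / r ^+ 2)%:E)%E.
Proof.
move=> r0 mA Ar; rewrite /normal_prob.
have p0 y : 0 <= normal_pdf m s y by exact: normal_pdf_ge0.
have mp : measurable_fun setT (normal_pdf m s) by exact: measurable_normal_pdf.
have mq : measurable_fun setT (fun y : R => (y - m) ^+ 2 * normal_pdf m s y).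
  by apply: measurable_funM => //; apply: measurable_funX; exact: measurable_funB.
rewrite mulrC EFinM -(normal_variance m s0) -ge0_integralZl//; last 3 first.
- exact/measurable_EFinP.
- by move=> y _; rewrite lee_fin mulr_ge0 ?sqr_ge0.
- by rewrite lee_fin invr_ge0 sqr_ge0.
have q0 y : 0 <= (r ^+ 2)^-1 * ((y - m) ^+ 2 * normal_pdf m s y).
  by rewrite mulr_ge0 ?invr_ge0 ?sqr_ge0// mulr_ge0 ?sqr_ge0.
apply: (@le_trans _ _ (\int[lebesgue_measure]_(y in A)
   ((r ^+ 2)^-1 * ((y - m) ^+ 2 * normal_pdf m s y))%:E)%E).
  apply: ge0_le_integral => //.
  - by move=> y _; rewrite lee_fin.
  - exact/measurable_EFinP/measurable_funTS.
  - by apply/measurable_EFinP/measurable_funTS; exact: measurable_funM.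
  - move=> y Ay; rewrite lee_fin mulrA ler_peMl// -ler_pdivrMl ?invr_gt0 ?exprn_gt0//.
    by rewrite invrK mulr1 -(@norm_sqr _ (y - m)) ler_pXn2r ?nnegrE ?(ltW r0)//; exact: Ar.
under [leRHS]eq_integral do rewrite -EFinM.
apply: ge0_subset_integral => //.
- by apply/measurable_EFinP; exact: measurable_funM.
- by move=> y _; rewrite lee_fin.
Qed.

End normal_tail.

Section fourier_uniqueness.
Context {R : realType} d1 (T1 : measurableType d1) (P1 : probability T1 R)
  d2 (T2 : measurableType d2) (P2 : probability T2 R).
Local Notation mu := (@lebesgue_measure R).

Let mcos : measurable_fun setT (@cos R).
Proof. by apply: continuous_measurable_fun; exact: continuous_cos. Qed.

(** Up to the factor [normal_peak s], the normal density is the characteristic function of a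
    standard Gaussian u at (X - y)/s. Fubini's theorem then expresses the smoothed weighted law
    through the characteristic function of the weighted law alone. *)
Lemma weighted_gauss_kernel d (T : measurableType d) (P : probability T R)
    (z X : T -> R) (M s y : R) : s != 0 ->
  measurable_fun setT z -> (forall w, 0 <= z w <= M) -> measurable_fun setT X ->
  (\int[P]_w (z w * normal_pdf (X w) s y)%:E =
   \int[gauss]_u ((normal_peak s)%:E *
     \int[P]_w (z w * cos (- (u / s * y) + u / s * X w))%:E))%E.
Proof.
move=> s0 mz zM mX.
have z0 w : 0 <= z w by have /andP[] := zM w.
pose F (wu : T * measurableTypeR R) : \bar R :=
  (normal_peak s * (z wu.1 * cos (- (wu.2 / s * y) + wu.2 / s * X wu.1)))%:E.
have mF : measurable_fun setT (fun wu : T * measurableTypeR R =>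
    normal_peak s * (z wu.1 * cos (- (wu.2 / s * y) + wu.2 / s * X wu.1))).
  apply: measurable_funM => //; apply: measurable_funM; first exact: measurableT_comp.
  apply: measurableT_comp => //.
  have m2 : measurable_fun setT (fun wu : T * measurableTypeR R => wu.2 / s).
    by apply: measurable_funM.
  apply: measurable_funD.
    by apply: measurable_funN; apply: measurable_funM.
  by apply: measurable_funM => //; exact: measurableT_comp.
have bF wu : `|normal_peak s * (z wu.1 * cos (- (wu.2 / s * y) + wu.2 / s * X wu.1))|
     <= normal_peak s * M.
  rewrite normrM (ger0_norm (normal_peak_ge0 s)) ler_wpM2l ?normal_peak_ge0// normrM.
  rewrite -[leRHS]mulr1 ler_pM//; first by rewrite ger0_norm//; have /andP[] := zM wu.1.
  by rewrite ler_norml cos_geN1 cos_le1.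
have iF : (P \x gauss)%E.-integrable setT F.
  exact: (@integrable_bounded _ _ _ (prob_prod P gauss) _ (normal_peak s * M)).
have FUB := Fubini iF.
transitivity (\int[P]_w \int[gauss]_u F (w, u))%E.
  apply: eq_integral => w _; rewrite /F/=.
  transitivity ((normal_peak s * z w)%:E * \int[gauss]_u (cos (0 + ((X w - y) / s) * u))%:E)%E.
    rewrite (normal_cos 0 (@oner_neq0 _)) mulr0 addr0 cos0 mulr1 expr1n mul1r -EFinM.
    congr EFin; rewrite mulrAC mulrC; congr (_ * _).
    rewrite normal_pdf_exp//; congr (_ * expR (- _)).
    by rewrite -(sqrrN (y - _)) opprB; field.
  rewrite -integralZl//.
    by apply: eq_integral => u _; rewrite -EFinM; congr EFin; rewrite -!mulrA; congr (_ * (_ * cos _)); field.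
  apply: (@integrable_bounded _ _ _ gauss _ 1).
    by apply: measurableT_comp => //; apply: measurable_funD => //; exact: measurable_funM.
  by move=> u; rewrite ler_norml cos_geN1 cos_le1.
rewrite FUB; apply: eq_integral => u _; rewrite /F/= -integralZl//.
apply: (@integrable_bounded _ _ _ P _ M).
  apply: measurable_funM => //; apply: measurableT_comp => //.
  by apply: measurable_funD => //; apply: measurable_funM.
move=> w; rewrite normrM -[leRHS]mulr1 ler_pM//.
  by rewrite ger0_norm//; have /andP[] := zM w.
by rewrite ler_norml cos_geN1 cos_le1.
Qed.

Lemma measurable_normal_pdf2 d (T : measurableType d) (X : T -> R) (s : R) : s != 0 ->
  measurable_fun setT X ->
  measurable_fun setT (fun wy : T * measurableTypeR R => normal_pdf (X wy.1) s wy.2).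
Proof.
move=> s0 mX; rewrite (_ : (fun _ => _) = (fun wy : T * measurableTypeR R =>
   normal_peak s * expR (- ((wy.2 - X wy.1) ^+ 2 / (2 * s ^+ 2))))); last first.
  by apply/funext => wy; rewrite normal_pdf_exp.
apply: measurable_funM => //; apply: measurableT_comp => //; apply: measurable_funN.
apply: measurable_funM => //; apply: measurable_funX; apply: measurable_funB => //.
exact: measurableT_comp.
Qed.

(** Tonelli's theorem. [normal_prob (X w) s B] is the probability that [X w] plus a centered
    Gaussian noise of standard deviation [s] lies in [B]. *)
Lemma weighted_tail_fubini d (T : measurableType d) (P : probability T R)
    (z X : T -> R) (s : R) (B : set R) : s != 0 -> measurable B ->
  measurable_fun setT z -> (forall w, 0 <= z w) -> measurable_fun setT X ->
  (\int[P]_w (z w * fine (normal_prob (X w) s B))%:E =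
   \int[mu]_(y in B) \int[P]_w (z w * normal_pdf (X w) s y)%:E)%E.
Proof.
move=> s0 mB mz z0 mX.
pose F (wy : T * measurableTypeR R) : \bar R :=
  ((\1_B wy.2 : R) * (z wy.1 * normal_pdf (X wy.1) s wy.2))%:E.
have mF : measurable_fun setT F.
  apply/measurable_EFinP; apply: measurable_funM.
    by apply: measurableT_comp => //; exact: measurable_indic.
  apply: measurable_funM; first exact: measurableT_comp.
  exact: measurable_normal_pdf2.
have F0 wy : (0 <= F wy)%E by rewrite lee_fin !mulr_ge0 ?normal_pdf_ge0.
transitivity (\int[P]_w \int[mu]_y F (w, y))%E.
  apply: eq_integral => w _; rewrite EFinM fineK; last first.
    by apply: fin_num_measure.
  rewrite /normal_prob integral_mkcond -ge0_integralZl//; last 3 first.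
  - apply: (iffLR (measurable_restrictT _ _)) => //.
    by apply/measurable_EFinP/measurable_funTS; exact: measurable_normal_pdf.
  - by move=> y _; rewrite patchE; case: ifPn => // _; rewrite lee_fin normal_pdf_ge0.
  - by rewrite lee_fin.
  apply: eq_integral => y _; rewrite patchE /F/= indicE.
  by case: ifPn => _; rewrite ?mul1r// mul0r mule0.
rewrite (fubini_tonelli (m1 := P) (m2 := mu) F mF F0) [RHS]integral_mkcond.
apply: eq_integral => y _; rewrite patchE /F/= indicE; case: ifPn => _.
  by apply: eq_integral => w _; rewrite mul1r.
by rewrite integral0_eq// => w _; rewrite mul0r.
Qed.

Lemma measurable_normal_prob_mean d (T : measurableType d) (X : T -> R) (s : R) (B : set R) :
  s != 0 -> measurable B -> measurable_fun setT X ->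
  measurable_fun setT (fun w => fine (normal_prob (X w) s B)).
Proof.
move=> s0 mB mX.
pose F (wy : T * measurableTypeR R) : \bar R :=
  ((\1_B wy.2 : R) * normal_pdf (X wy.1) s wy.2)%:E.
have mF : measurable_fun setT F.
  apply/measurable_EFinP; apply: measurable_funM.
    by apply: measurableT_comp => //; exact: measurable_indic.
  exact: measurable_normal_pdf2.
have F0 wy : (0 <= F wy)%E by rewrite lee_fin !mulr_ge0 ?normal_pdf_ge0.
have := measurable_fun_fubini_tonelli_F (m2 := mu) _ mF F0.
move=> h; apply: (measurableT_comp (f := fine)) => //.
apply: eq_measurable_fun h => w _; rewrite /fubini_F /normal_prob [RHS]integral_mkcond.
apply: eq_integral => y _; rewrite patchE /F/= indicE.
by case: ifPn => _; rewrite ?mul1r// mul0r.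
Qed.

(** With e = 1/(n + 1), the threshold is shifted by e and the standard deviation is only e^2, so
    that Chebyshev's bound e^4/e^2 tends to 0 for every x <= c. Without the shift the limit at x = c
    would be 1/2. *)
Lemma normal_tail_cvg (x c : R) :
  (fun n => fine (normal_prob x (n.+1%:R^-1 ^+ 2) `]c + n.+1%:R^-1, +oo[%classic)) @ \oo
    --> (\1_`]c, +oo[%classic x : R).
Proof.
have e0 n : 0 < n.+1%:R^-1 :> R by rewrite invr_gt0.
have s0 n : n.+1%:R^-1 ^+ 2 != 0 :> R by rewrite gt_eqF// exprn_gt0.
have ecvg : (fun n => n.+1%:R^-1 : R) @ \oo --> (0 : R) by exact: cvg_harmonic.
have Ele n (A : set R) (r : R) : 0 < r -> measurable A -> (forall y, A y -> r <= `|y - x|) ->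
   fine (normal_prob x (n.+1%:R^-1 ^+ 2) A) <= (n.+1%:R^-1 ^+ 2) ^+ 2 / r ^+ 2.
  move=> r0 mA Ar; rewrite -lee_fin fineK; last by apply: fin_num_measure.
  exact: (normal_prob_tail (s0 n) r0 mA Ar).
rewrite indicE; have [xc|cx] := leP x c.
  rewrite memNset; last by rewrite /= in_itv/= andbT ltNge xc.
  apply: (@squeeze_cvgr _ _ _ _ (cst 0) (fun n => n.+1%:R^-1 : R)) => //; last exact: cvg_cst.
  apply: nearW => n; rewrite fine_ge0//=.
  apply: (@le_trans _ _ ((n.+1%:R^-1 ^+ 2) ^+ 2 / n.+1%:R^-1 ^+ 2)).
    apply: Ele => // y /=; rewrite in_itv/= andbT => cy.
    have en := e0 n; move: (n.+1%:R^-1) en cy => e en cy. by rewrite ger0_norm; lra.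
  rewrite [X in X / _]expr2 mulfK// expr2; apply: ler_piMl; first exact: ltW.
  by rewrite invf_le1 ?ltr0n// ler1n.
rewrite mem_set; last by rewrite /= in_itv/= andbT.
pose r := (x - c) / 2; have r0 : 0 < r by rewrite divr_gt0// subr_gt0.
(* After this shift of the index e is at most r, and the half-line up to c + e stays at distance at
   least r from x = c + 2 r. *)
rewrite -(cvg_shiftn (Num.bound r^-1)).
have Eqs n : 1 - n.+1%:R^-1 * (r ^+ 2)^-1 <=
    fine (normal_prob x ((n + Num.bound r^-1)%N.+1%:R^-1 ^+ 2)
      `]c + (n + Num.bound r^-1)%N.+1%:R^-1, +oo[%classic) <= 1.
  set k := (n + _)%N; rewrite -!lee_fin fineK; last by apply: fin_num_measure.
  rewrite probability_le1// andbT.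
  have kr : k.+1%:R^-1 <= r.
    rewrite -[r]invrK lef_pV2 ?posrE ?invr_gt0//.
    apply: (le_trans (ltW (archi_boundP _))); first by rewrite invr_ge0 ltW.
    by rewrite ler_nat /k -addSn leq_addl.
  have := Ele k `]-oo, c + k.+1%:R^-1]%classic r r0 (measurable_itv _).
  move=> /(_ _)/wrap[]; first move=> y /=; first rewrite in_itv/= => yc.
    move: kr yc; rewrite /r; move: (k.+1%:R^-1) => e kr yc.
    by rewrite distrC ger0_norm; lra.
  move=> h; rewrite -setCitvl probability_setC// -[X in (_ - X)%E]fineK; last by apply: fin_num_measure.
  rewrite -EFinB lee_fin lerD2l lerN2; apply: (le_trans h).
  rewrite ler_wpM2r ?invr_ge0 ?sqr_ge0//.
  apply: (@le_trans _ _ k.+1%:R^-1); last first.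
    by rewrite lef_pV2 ?posrE// ler_nat ltnS leq_addr.
  have k1 : k.+1%:R^-1 <= 1 :> R by rewrite invf_le1 ?ltr0n// ler1n.
  rewrite -exprM; apply: (@le_trans _ _ (k.+1%:R^-1 ^+ 1)); last by rewrite expr1.
  by apply: ler_wiXn2l => //; exact: ltW.
apply: (@squeeze_cvgr _ _ _ _ (fun n => 1 - n.+1%:R^-1 * (r ^+ 2)^-1) (cst 1)).
- exact: nearW.
- rewrite -[X in _ --> X]subr0; apply: cvgB; first exact: cvg_cst.
  by rewrite -[X in _ --> X](mul0r (r ^+ 2)^-1); apply: cvgMl.
- exact: cvg_cst.
Qed.

(** Laws smoothed by a small Gaussian noise are determined by the cosine integrals. Letting the
    noise vanish identifies the weights of the half-lines []c, +oo[], which form a generating family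
    stable under intersection. *)
Lemma fourier_uniqueness (z1 X1 : T1 -> R) (z2 X2 : T2 -> R) (M : R) :
  measurable_fun setT z1 -> (forall w, 0 <= z1 w <= M) -> measurable_fun setT X1 ->
  measurable_fun setT z2 -> (forall w, 0 <= z2 w <= M) -> measurable_fun setT X2 ->
  (forall t a, \int[P1]_w (z1 w * cos (t + a * X1 w))%:E =
               \int[P2]_w (z2 w * cos (t + a * X2 w))%:E)%E ->
  forall A : set R, measurable A ->
    (\int[P1]_w (z1 w * \1_A (X1 w))%:E = \int[P2]_w (z2 w * \1_A (X2 w))%:E)%E.
Proof.
move=> mz1 z1M mX1 mz2 z2M mX2 h.
have z10 w : 0 <= z1 w by have /andP[] := z1M w.
have z20 w : 0 <= z2 w by have /andP[] := z2M w.
have tail c : (\int[P1]_w (z1 w * \1_`]c, +oo[%classic (X1 w))%:E =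
               \int[P2]_w (z2 w * \1_`]c, +oo[%classic (X2 w))%:E)%E.
  pose B n : set R := `]c + n.+1%:R^-1, +oo[%classic.
  have cv d (T : measurableType d) (P : probability T R) (z X : T -> R) :
      measurable_fun setT z -> (forall w, 0 <= z w <= M) -> measurable_fun setT X ->
    (fun n => \int[P]_w (z w * fine (normal_prob (X w) (n.+1%:R^-1 ^+ 2) (B n)))%:E)%E @ \oo -->
    (\int[P]_w (z w * \1_`]c, +oo[%classic (X w))%:E)%E.
    move=> mz zM mX; have z0 w : 0 <= z w by have /andP[] := zM w.
    apply: (@bounded_cvg_integral _ _ _ P _ _ M) => //.
    - move=> n; apply: measurable_funM => //.
      have s0 : n.+1%:R^-1 ^+ 2 != 0 :> R by rewrite gt_eqF// exprn_gt0// invr_gt0.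
      exact: (measurable_normal_prob_mean s0 (measurable_itv _) mX).
    - move=> n w; rewrite ger0_norm; last by rewrite mulr_ge0 ?fine_ge0.
      rewrite -[leRHS]mulr1 ler_pM ?fine_ge0//; first by have /andP[] := zM w.
      rewrite -lee_fin fineK; last by apply: fin_num_measure; exact: measurable_itv.
      by apply: probability_le1; exact: measurable_itv.
    - by move=> w; apply: cvgM; [exact: cvg_cst|exact: normal_tail_cvg].
  have e n : (\int[P1]_w (z1 w * fine (normal_prob (X1 w) (n.+1%:R^-1 ^+ 2) (B n)))%:E =
              \int[P2]_w (z2 w * fine (normal_prob (X2 w) (n.+1%:R^-1 ^+ 2) (B n)))%:E)%E.
    have s0 : n.+1%:R^-1 ^+ 2 != 0 :> R by rewrite gt_eqF// exprn_gt0// invr_gt0.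
    have mBn : measurable (B n) by exact: measurable_itv.
    rewrite (weighted_tail_fubini P1 s0 mBn mz1 z10 mX1) (weighted_tail_fubini P2 s0 mBn mz2 z20 mX2).
    apply: eq_integral => y _.
    rewrite (weighted_gauss_kernel _ _ s0 mz1 z1M mX1) (weighted_gauss_kernel _ _ s0 mz2 z2M mX2).
    by apply: eq_integral => u _; rewrite h.
  have c1 := cv _ _ P1 _ _ mz1 z1M mX1; rewrite (eq_cvg _ _ e) in c1.
  exact: (cvg_unique _ c1 (cv _ _ P2 _ _ mz2 z2M mX2)).
move=> A mA; rewrite -!weighted_lawE//.
apply: (@measure_unique _ R (measurableTypeR R) (@RGenOInfty.G R) (fun n => `](- n%:R), +oo[%classic)
  _ _ _ _ (weighted_law_measure P1 mz1 z10 mX1) (weighted_law_measure P2 mz2 z20 mX2)) => //.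
- exact: RGenOInfty.measurableE.
- move=> _ _ [a ->] [b ->]; exists (Num.max a b).
  by apply/seteqP; split => x /=; rewrite !in_itv/= !andbT gt_max => /andP //= [].
- by move=> n; exists (- n%:R).
- apply/seteqP; split => // x _; exists (Num.bound `|x|) => //=; rewrite in_itv/= andbT ltrNl.
  by rewrite -(normrN x); apply: le_lt_trans (archi_boundP (normr_ge0 _)); rewrite ler_norm.
- move=> _ [c ->]; rewrite /= !weighted_lawE; [exact: tail|exact: measurable_itv|exact: measurable_itv].
- move=> k; rewrite /= weighted_lawE//.
  apply: integrable_lty => //; apply: (@integrable_bounded _ _ _ P1 _ M).
    by apply: measurable_funM => //; apply: measurableT_comp.
  move=> w; rewrite ger0_norm ?mulr_ge0// -[leRHS]mulr1 ler_pM//.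
    by have /andP[] := z1M w.
Qed.

End fourier_uniqueness.

(** * Identification of the law of a random vector *)

Section bounded_Rintegral.
Context d (T : measurableType d) {R : realType} (P : probability T R).

Lemma integral_bounded_EFin (f : T -> R) (M : R) : measurable_fun setT f ->
  (forall w, `|f w| <= M) -> (\int[P]_w (f w)%:E = (\int[P]_w f w)%R%:E)%E.
Proof.
move=> mf fM; rewrite /Rintegral fineK//.
by apply: integrable_fin_num => //; exact: (integrable_bounded _ mf fM).
Qed.

End bounded_Rintegral.

Section partial_boxes.
Context d (T : measurableType d) {R : realType} (P : probability T R).
Variables (N : nat) (X : 'I_N -> T -> R).
Hypothesis mX : forall i, measurable_fun setT (X i).

(* Coordinates below [k] are tested by boxes, those above by characters. *)
Definition partial_box (k : nat) (A : 'I_N -> set R) : set T :=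
  [set w | forall i : 'I_N, (i < k)%N -> A i (X i w)].

Definition partial_phase (k : nat) (a : 'I_N -> R) (t : R) (w : T) : R :=
  t + \sum_(i < N | (k <= i)%N) a i * X i w.

Definition partial_integral (k : nat) (A : 'I_N -> set R) (a : 'I_N -> R) (t : R) : R :=
  (\int[P]_w (\1_(partial_box k A) w * cos (partial_phase k a t w)))%R.

Lemma measurable_partial_box k A : (forall i, measurable (A i)) ->
  measurable (partial_box k A).
Proof.
move=> mA; rewrite (_ : partial_box k A =
    [set w | forall i : 'I_N, (if (i < k)%N then A i else setT) (X i w)]).
  apply: (@measurable_box _ _ _ _ (fun=> R) X (fun i => if (i < k)%N then A i else setT)) => // i.
  by case: ifP.
apply/seteqP; split => w /= h i; have := h i; first by case: ifP => // _; exact.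
by move=> + ik; rewrite ik.
Qed.

Lemma measurable_partial_phase k a t : measurable_fun setT (partial_phase k a t).
Proof.
apply: measurable_funD => //.
have -> : (fun w => \sum_(i < N | (k <= i)%N) a i * X i w) =
    (fun w => \sum_(i < N) (if (k <= i)%N then a i * X i w else 0)).
  by apply/funext => w; rewrite big_mkcond.
by apply: measurable_sum => i; case: (leqP k i) => _ //; exact: measurable_funM.
Qed.

Lemma measurable_cos_comp (f : T -> R) : measurable_fun setT f ->
  measurable_fun setT (fun w => cos (f w)).
Proof.
by move=> mf; apply: measurableT_comp => //; apply: continuous_measurable_fun; exact: continuous_cos.
Qed.

Lemma partial_phase_step (i0 : 'I_N) a t w :
  partial_phase i0 a t w = a i0 * X i0 w + partial_phase i0.+1 a t w.
Proof.
rewrite /partial_phase (bigD1 i0)//= addrCA; congr (_ + (_ + _)).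
apply: eq_bigl => i; rewrite [in RHS]ltn_neqAle andbC eq_sym.
by congr (_ && _).
Qed.

Lemma partial_phase_ext k a b t w : (forall i : 'I_N, (k <= i)%N -> a i = b i) ->
  partial_phase k a t w = partial_phase k b t w.
Proof. by move=> ab; congr (_ + _); apply: eq_bigr => i ki; rewrite ab. Qed.

Lemma partial_phase_shift k a t s w : partial_phase k a (t + s) w = t + partial_phase k a s w.
Proof. by rewrite /partial_phase addrA. Qed.

Lemma partial_phase0 k t w : partial_phase k (fun=> 0) t w = t.
Proof. by rewrite /partial_phase big1 ?addr0// => i _; rewrite mul0r. Qed.

Section step.
Variables (i0 : 'I_N) (A : 'I_N -> set R) (a : 'I_N -> R) (t : R).
Hypothesis mA : forall i, measurable (A i).
Let psi w : R := \1_(partial_box i0 A) w.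
Let xi w : R := partial_phase i0.+1 a t w.
Let mpsi : measurable_fun setT psi.
Proof. by apply: measurable_indic; exact: measurable_partial_box. Qed.
Let psi01 w : 0 <= psi w <= 1.
Proof. by rewrite /psi indicE; case: (_ \in _); rewrite ?lexx ?ler01. Qed.
Let mxi : measurable_fun setT xi. Proof. exact: measurable_partial_phase. Qed.
Let ib (f : T -> R) : measurable_fun setT f -> (forall w, `|f w| <= 1) ->
  P.-integrable setT (EFin \o (fun w => psi w * f w)).
Proof.
move=> mf f1; apply: (@integrable_bounded _ _ _ P _ 1); first exact: measurable_funM.
move=> w; rewrite normrM -[leRHS]mulr1 ler_pM//.
by have /andP[p0 p1] := psi01 w; rewrite ger0_norm.
Qed.
Let cosb x : `|cos x : R| <= 1. Proof. by rewrite ler_norml cos_geN1 cos_le1. Qed.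

(* Adding 1 to the cosine makes the weight nonnegative, as [fourier_uniqueness]
   requires. *)
Definition step_weight (w : T) : R := psi w * (1 + cos (xi w)).

Lemma measurable_step_weight : measurable_fun setT step_weight.
Proof.
by apply: measurable_funM => //; apply: measurable_funD => //; exact: measurable_cos_comp.
Qed.

Lemma step_weight_bound w : 0 <= step_weight w <= 2.
Proof.
have /andP[p0 p1] := psi01 w; have h1 := cos_geN1 (xi w); have h2 := cos_le1 (xi w).
rewrite /step_weight; apply/andP; split; nra.
Qed.

(** The product of the cosines of xi and s + b X is half the sum of the cosines of xi + (s + b X)
    and xi - (s + b X). Thus the Fourier transform of coordinate [i0] under the weight involves only
    partial integrals in which [i0] is still tested by a character. *)
Lemma step_weight_cos s b :
  (\int[P]_w (step_weight w * cos (s + b * X i0 w)))%R =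
  partial_integral i0 A (fun i => (i == i0)%:R * b) s +
  2^-1 * partial_integral i0 A (fun i => if i == i0 then b else a i) (s + t) +
  2^-1 * partial_integral i0 A (fun i => if i == i0 then - b else a i) (t - s).
Proof.
have e1 w : partial_phase i0 (fun i => (i == i0)%:R * b) s w = s + b * X i0 w.
  rewrite partial_phase_step eqxx mul1r addrC; congr (_ + _).
  rewrite -[RHS](partial_phase0 i0.+1 s w); apply: partial_phase_ext => i i0i.
  by rewrite -val_eqE/= gtn_eqF// mul0r.
have ex c s' w : partial_phase i0 (fun i => if i == i0 then c else a i) s' w =
    c * X i0 w + partial_phase i0.+1 a s' w.
  rewrite partial_phase_step eqxx; congr (_ + _); apply: partial_phase_ext => i i0i.
  by rewrite -val_eqE/= gtn_eqF.
have e2 w : partial_phase i0 (fun i => if i == i0 then b else a i) (s + t) w =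
    xi w + (s + b * X i0 w).
  by rewrite ex partial_phase_shift /xi; ring.
have e3 w : partial_phase i0 (fun i => if i == i0 then - b else a i) (t - s) w =
    xi w - (s + b * X i0 w).
  by rewrite ex addrC (addrC t) partial_phase_shift /xi; ring.
have mb : measurable_fun setT (fun w => s + b * X i0 w).
  by apply: measurable_funD => //; exact: measurable_funM.
have i1 : P.-integrable setT (EFin \o (fun w => psi w * cos (s + b * X i0 w))).
  by apply: ib => //; exact: measurable_cos_comp.
have i2 : P.-integrable setT (EFin \o (fun w => psi w * cos (xi w + (s + b * X i0 w)))).
  by apply: ib => //; apply: measurable_cos_comp; exact: measurable_funD.
have i3 : P.-integrable setT (EFin \o (fun w => psi w * cos (xi w - (s + b * X i0 w)))).
  by apply: ib => //; apply: measurable_cos_comp; exact: measurable_funB.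
have iz (f : T -> R) c : P.-integrable setT (EFin \o f) -> P.-integrable setT (EFin \o (fun w => c * f w)).
  by move=> h; have := integrableZl measurableT c h.
have E1 : partial_integral i0 A (fun i => (i == i0)%:R * b) s =
    (\int[P]_w (psi w * cos (s + b * X i0 w)))%R.
  by apply: eq_Rintegral => w _; rewrite e1.
have E2 : partial_integral i0 A (fun i => if i == i0 then b else a i) (s + t) =
    (\int[P]_w (psi w * cos (xi w + (s + b * X i0 w))))%R.
  by apply: eq_Rintegral => w _; rewrite e2.
have E3 : partial_integral i0 A (fun i => if i == i0 then - b else a i) (t - s) =
    (\int[P]_w (psi w * cos (xi w - (s + b * X i0 w))))%R.
  by apply: eq_Rintegral => w _; rewrite e3.
rewrite E1 E2 E3.
rewrite -!RintegralZl// -RintegralD//; [|exact: iz].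
rewrite -RintegralD//; [|by have := integrableD measurableT i1 (iz _ 2^-1 i2)|exact: iz].
by apply: eq_Rintegral => w _; rewrite /step_weight cosD cosB -/(psi w); field.
Qed.

Lemma psi_cos s b :
  (\int[P]_w (psi w * cos (s + b * X i0 w)))%R =
  partial_integral i0 A (fun i => (i == i0)%:R * b) s.
Proof.
apply: eq_Rintegral => w _; congr (_ * cos _).
rewrite partial_phase_step eqxx mul1r addrC; congr (_ + _).
rewrite -[LHS](partial_phase0 i0.+1 s w); apply: partial_phase_ext => i i0i.
by rewrite -val_eqE/= gtn_eqF// mul0r.
Qed.

(** Coordinate [i0] moves from the characters to the boxes. The subtracted term, itself an integral
    against a nonnegative weight, removes the 1 added to the cosine. *)
Lemma step_indic :
  partial_integral i0.+1 A a t =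
  (\int[P]_w (step_weight w * \1_(A i0) (X i0 w)))%R -
  (\int[P]_w (psi w * \1_(A i0) (X i0 w)))%R.
Proof.
have mi : measurable_fun setT (fun w => \1_(A i0) (X i0 w) : R).
  by apply: measurableT_comp => //; exact: measurable_indic.
have i01 w : `|\1_(A i0) (X i0 w) : R| <= 1.
  by rewrite indicE; case: (_ \in _); rewrite ?normr1 ?normr0 ?ler01.
rewrite -RintegralB//; last 2 first.
- rewrite (_ : _ \o _ = EFin \o (fun w => psi w * ((1 + cos (xi w)) * \1_(A i0) (X i0 w)))).
    apply: (@integrable_bounded _ _ _ P _ 2).
      apply: measurable_funM => //; apply: measurable_funM => //.
      by apply: measurable_funD => //; exact: measurable_cos_comp.
    move=> w; rewrite mulrA normrM -[leRHS]mulr1 ler_pM//.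
    by have /andP[p0 p1] := step_weight_bound w; rewrite ger0_norm.
  by apply/funext => w /=; rewrite mulrA.
- exact: ib.
apply: eq_Rintegral => w _.
rewrite (_ : \1_(partial_box i0.+1 A) w = psi w * \1_(A i0) (X i0 w) :> R).
  by rewrite /step_weight -/(xi w); ring.
rewrite /psi !indicE -natrM mulnb; congr (_%:R); congr nat_of_bool.
apply/idP/idP => [/set_mem h|/andP[/set_mem h1 /set_mem h2]].
  apply/andP; split; apply/mem_set; last exact: h.
  by move=> i ii0; apply: h; rewrite ltnS ltnW.
apply/mem_set => i; rewrite ltnS leq_eqVlt => /orP[/eqP ii0|]; last exact: h1.
by rewrite (_ : i = i0)//; exact: val_inj.
Qed.

End step.
End partial_boxes.

(** Induction on the number of coordinates tested by boxes: 0 is the hypothesis, and each step is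
    one-dimensional uniqueness for a single coordinate. The claim is the case of all [N]
    coordinates. *)
Lemma eq_law_boxes {R : realType} d1 (T1 : measurableType d1) (P1 : probability T1 R)
  d2 (T2 : measurableType d2) (P2 : probability T2 R) (N : nat)
  (X1 : 'I_N -> T1 -> R) (X2 : 'I_N -> T2 -> R) :
  (forall i, measurable_fun setT (X1 i)) -> (forall i, measurable_fun setT (X2 i)) ->
  (forall a t, \int[P1]_w (cos (t + \sum_(i < N) a i * X1 i w))%:E =
               \int[P2]_w (cos (t + \sum_(i < N) a i * X2 i w))%:E)%E ->
  forall A : 'I_N -> set R, (forall i, measurable (A i)) ->
    P1 [set w | forall i, A i (X1 i w)] = P2 [set w | forall i, A i (X2 i w)].
Proof.
move=> mX1 mX2 h.
have ind k : (k <= N)%N -> forall A, (forall i, measurable (A i)) -> forall a t,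
    partial_integral P1 X1 k A a t = partial_integral P2 X2 k A a t.
  elim: k => [|k IHk] kN A mA a t.
    rewrite /partial_integral /Rintegral; congr fine.
    transitivity (\int[P1]_w (cos (t + \sum_(i < N) a i * X1 i w))%:E)%E.
      apply: eq_integral => w _; congr EFin.
      rewrite indicE mem_set ?mul1r//.
    rewrite h; apply: eq_integral => w _; congr EFin.
    by rewrite indicE mem_set ?mul1r.
  have {}IHk := IHk (ltnW kN); pose i0 := Ordinal kN.
  rewrite -[k]/(val i0) (step_indic P1 mX1 i0 a t mA) (step_indic P2 mX2 i0 a t mA).
  have m1i i (w : R) : `|\1_(A i) w : R| <= 1.
    by rewrite indicE; case: (_ \in _); rewrite ?normr1 ?normr0 ?ler01.
  have cosb x : `|cos x : R| <= 1 by rewrite ler_norml cos_geN1 cos_le1.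
  have toE d (T : measurableType d) (P : probability T R) (z g : T -> R) (M : R) :
      measurable_fun setT z -> (forall w, 0 <= z w <= M) ->
      measurable_fun setT g -> (forall w, `|g w| <= 1) ->
      (\int[P]_w (z w * g w)%:E = (\int[P]_w (z w * g w))%R%:E)%E.
    move=> mz zM mg g1; apply: (@integral_bounded_EFin _ _ _ P _ M); first exact: measurable_funM.
    move=> w; rewrite normrM -[leRHS]mulr1 ler_pM//.
    by have /andP[z0 z1] := zM w; rewrite ger0_norm.
  have maff d (T : measurableType d) (Y : T -> R) s b : measurable_fun setT Y ->
      measurable_fun setT (fun w => cos (s + b * Y w)).
    by move=> mY; apply: measurable_cos_comp; apply: measurable_funD => //; exact: measurable_funM.
  have mind d (T : measurableType d) (Y : T -> R) : measurable_fun setT Y ->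
      measurable_fun setT (fun w => \1_(A i0) (Y w) : R).
    by move=> mY; apply: measurableT_comp => //; exact: measurable_indic.
  have uniq (z1 : T1 -> R) (z2 : T2 -> R) (M : R) :
     measurable_fun setT z1 -> (forall w, 0 <= z1 w <= M) ->
     measurable_fun setT z2 -> (forall w, 0 <= z2 w <= M) ->
     (forall s b, (\int[P1]_w (z1 w * cos (s + b * X1 i0 w)))%R =
                  (\int[P2]_w (z2 w * cos (s + b * X2 i0 w)))%R) ->
     (\int[P1]_w (z1 w * \1_(A i0) (X1 i0 w)))%R = (\int[P2]_w (z2 w * \1_(A i0) (X2 i0 w)))%R.
    move=> mz1 z1M mz2 z2M e.
    have := @fourier_uniqueness R _ T1 P1 _ T2 P2 z1 (X1 i0) z2 (X2 i0) M mz1 z1M (mX1 i0)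
      mz2 z2M (mX2 i0) _ (A i0) (mA i0).
    rewrite (toE _ _ _ _ _ M)//; last exact: mind.
    rewrite (toE _ _ _ _ _ M)//; last exact: mind.
    move=> /(_ _)/wrap[]; last by move=> [].
    move=> s b; rewrite (toE _ _ _ _ _ M)//; last exact: maff.
    by rewrite (toE _ _ _ _ _ M)// ?e//; exact: maff.
  congr (_ - _).
  - apply: (uniq _ _ 2).
    + exact: measurable_step_weight.
    + exact: step_weight_bound.
    + exact: measurable_step_weight.
    + exact: step_weight_bound.
    + by move=> s b; rewrite !step_weight_cos// !IHk.
  - have ib d (T : measurableType d) (B : set T) w : 0 <= (\1_B w : R) <= 1.
      by rewrite indicE; case: (_ \in _); rewrite ?lexx ?ler01.
    apply: (uniq _ _ 1) => //.
    + by apply: measurable_indic; exact: measurable_partial_box.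
    + by apply: measurable_indic; exact: measurable_partial_box.
    + by move=> s b; rewrite !psi_cos !IHk.
move=> A mA.
have fin d (T : measurableType d) (P : probability T R) (X : 'I_N -> T -> R) :
    (forall i, measurable_fun setT (X i)) ->
    P [set w | forall i, A i (X i w)] = (partial_integral P X N A (fun=> 0) 0)%:E.
  move=> mX; have mB := measurable_partial_box mX N mA.
  rewrite -(@integral_bounded_EFin _ _ _ P _ 1).
  - transitivity (\int[P]_w (\1_(partial_box X N A) w)%:E)%E.
      rewrite integral_indic// setIT; congr (P _).
      by apply/seteqP; split => w /= H i; have := H i => //; exact.
    by apply: eq_integral => w _; rewrite partial_phase0 cos0 mulr1.
  - apply: measurable_funM; first exact: measurable_indic.
    by apply: measurable_cos_comp; exact: measurable_partial_phase.
  - move=> w; rewrite normrM -[leRHS]mulr1 ler_pM//.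
      by rewrite indicE; case: (_ \in _); rewrite ?normr1 ?normr0 ?ler01.
    by rewrite ler_norml cos_geN1 cos_le1.
by rewrite (fin _ _ P1)// (fin _ _ P2)// ind.
Qed.

(** A Lipschitz function is the infimum over rational points q of f q + K sum_i |x_i - q_i|, so its
    sublevel sets are countable unions of measurable sets. *)
Lemma lipschitz_measurable {R : realType} d (T : measurableType d) (I : finType)
    (X : I -> T -> R) (f : (I -> R) -> R) (K : R) :
  (forall i, measurable_fun setT (X i)) ->
  (forall x y, `|f x - f y| <= K * \sum_i `|x i - y i|) ->
  measurable_fun setT (fun w => f (fun i => X i w)).
Proof.
move=> mX fK.
have K0 : 0 <= Num.max K 0 by rewrite le_max lexx orbT.
have {}fK x y : `|f x - f y| <= Num.max K 0 * \sum_i `|x i - y i|.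
  apply: (le_trans (fK x y)); rewrite ler_wpM2r ?le_max ?lexx//.
  by apply: sumr_ge0 => i _.
move: (Num.max K 0) K0 fK => {}K K0 fK.
apply: (measurability (@RGenInftyO.G R) (@RGenInftyO.measurableE R)) => _ [_ [c ->] <-].
rewrite setTI.
have -> : (fun w => f (fun i => X i w)) @^-1` `]-oo, c[ =
  \bigcup_(q : {ffun I -> rat}) [set w | f (fun i => ratr (q i)) +
     K * \sum_i `|X i w - ratr (q i)| < c].
  apply/seteqP; split => w /=; last first.
    case=> q _ /= h; rewrite in_itv/=; apply: le_lt_trans h.
    by rewrite -lerBlDl; apply: le_trans (ler_norm _) (fK _ _).
  rewrite in_itv/= => fc.
  (* An approximation within e costs at most 2 K #|I| e, less than the gap between f and c; the
     added ones keep the denominator positive. *)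
  pose e := (c - f (fun i => X i w)) / (2 * (K + 1) * (#|I|%:R + 1)).
  have den : 0 < 2 * (K + 1) * (#|I|%:R + 1) :> R.
    by rewrite !mulr_gt0// ltr_wpDl.
  have e0 : 0 < e by rewrite divr_gt0// subr_gt0.
  have hq i : exists q : rat, `|X i w - ratr q| <= e.
    have [|q] := @rat_in_itvoo R (X i w - e) (X i w + e); first lra.
    rewrite in_itv/= => /andP[h1 h2]; exists q.
    by rewrite ler_norml; apply/andP; split; lra.
  have /choice[q hq'] := hq.
  exists [ffun i => q i] => //=.
  have -> : (fun i => ratr ([ffun i => q i] i)) = (fun i => ratr (q i)) :> (I -> R).
    by apply/funext => i; rewrite ffunE.
  under eq_bigr do rewrite ffunE.
  have hs : \sum_i `|X i w - ratr (q i)| <= #|I|%:R * e.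
    apply: (@le_trans _ _ (\sum_(i : I) e)); first exact: ler_sum.
    by rewrite sumr_const mulr_natl.
  have := fK (fun i => X i w) (fun i => ratr (q i)).
  move=> /(le_trans _) - /(_ (f (fun i => ratr (q i)) - f (fun i => X i w))).
  rewrite distrC ler_norm => /(_ isT) h.
  have hK : K * \sum_i `|X i w - ratr (q i)| <= K * (#|I|%:R * e) by rewrite ler_wpM2l.
  have he : c - f (fun i => X i w) = e * (2 * (K + 1) * (#|I|%:R + 1)).
    by rewrite /e divfK// gt_eqF.
  have n0 : 0 <= #|I|%:R :> R by [].
  have : K * (#|I|%:R * e) * 2 < e * (2 * (K + 1) * (#|I|%:R + 1)).
    rewrite (_ : e * _ = K * (#|I|%:R * e) * 2 + e * 2 * (#|I|%:R + K + 1)); last by ring.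
    by rewrite ltrDl; apply: mulr_gt0; [apply: mulr_gt0|rewrite ltr_wpDl// addr_ge0].
  by move: h hK he; lra.
apply: countable_bigcupT_measurable => [|q]; first exact: countableP.
apply: measurable_set_ltr => //.
apply: measurable_funD => //; apply: measurable_funM => //.
apply: measurable_sum => i; apply: measurableT_comp => //.
exact: measurable_funB.
Qed.

Section equal_laws.
Context {R : realType} d1 (T1 : measurableType d1) (P1 : probability T1 R)
  d2 (T2 : measurableType d2) (P2 : probability T2 R) (I : finType)
  (X1 : I -> T1 -> R) (X2 : I -> T2 -> R).
Hypothesis mX1 : forall i, measurable_fun setT (X1 i).
Hypothesis mX2 : forall i, measurable_fun setT (X2 i).
Hypothesis boxX : forall A : I -> set R, (forall i, measurable (A i)) ->
    P1 [set w | forall i, A i (X1 i w)] = P2 [set w | forall i, A i (X2 i w)].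

Let boxes : set (set (I -> R)) :=
  [set B | exists2 A : I -> set R, (forall i, measurable (A i)) &
    B = [set x | forall i, A i (x i)]].

(** The functions on [I] with the sigma-algebra generated by the boxes, a family stable under
    intersection: on it the joint laws are measures determined by their values on boxes. *)
Let U := g_sigma_algebraType boxes.

Let mtuple d (T : measurableType d) (X : I -> T -> R) :
  (forall i, measurable_fun setT (X i)) -> measurable_fun setT (fun w => (X ^~ w : U)).
Proof.
move=> mX; apply: (@measurability _ _ _ U _ _ boxes) => // _ [_ [A mA ->] <-].
rewrite setTI; exact: (@measurable_box _ _ _ _ (fun=> R) X A).
Qed.

Let mproj i : measurable_fun setT (fun x : U => (x : I -> R) i).
Proof.
move=> _ B mB; rewrite setTI; apply: sub_sigma_algebra.
exists (fun j => if j == i then B else setT); first by move=> j; case: ifP.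
apply/seteqP; split => x /= h; first by move=> j; case: eqP => // ->.
by have := h i; rewrite eqxx.
Qed.

Lemma eq_law_integral (f : (I -> R) -> R) (K : R) (g : R -> \bar R) :
  (forall x y, `|f x - f y| <= K * \sum_i `|x i - y i|) ->
  measurable_fun setT g ->
  (\int[P1]_w g (f (X1 ^~ w)) = \int[P2]_w g (f (X2 ^~ w)))%E.
Proof.
move=> fK mg.
have mgf : measurable_fun setT (fun x : U => g (f x)).
  by apply: measurableT_comp => //; exact: (lipschitz_measurable mproj fK).
pose nu1 : {measure set U -> \bar R} :=
  measure_function_pushforward__canonical__measure_function_Measure P1 (mtuple mX1).
pose nu2 : {measure set U -> \bar R} :=
  measure_function_pushforward__canonical__measure_function_Measure P2 (mtuple mX2).
have law : forall A : set U, measurable A -> nu1 A = nu2 A.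
  apply: (@measure_unique _ R U boxes (fun=> setT) _ _ _ _ nu1 nu2) => //.
  - move=> _ _ [A mA ->] [B mB ->]; exists (fun i => A i `&` B i).
      by move=> i; exact: measurableI.
    apply/seteqP; split => x /=; first by move=> [hA hB] i; split; [exact: hA|exact: hB].
    by move=> h; split => i; have [] := h i.
  - move=> _; exists (fun=> setT) => //.
    by apply/seteqP; split.
  - by rewrite bigcup_const//; exists 0%N.
  - by move=> _ [A mA ->]; exact: boxX.
  - by move=> k; rewrite /= /pushforward preimage_setT probability_setT ltry.
rewrite (@integral_law _ _ _ U R P1 nu2 (fun w => X1 ^~ w) (fun x => g (f x)))//; last exact: mtuple.
by rewrite (@integral_law _ _ _ U R P2 nu2 (fun w => X2 ^~ w) (fun x => g (f x)))//; exact: mtuple.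
Qed.

End equal_laws.

(** * Concentration of Gaussian vectors *)

(** With signs e_k, the left-hand side is sum_j c_j x_j for c_j = sum_k v_k e_k A_kj. Then c x <=
    c^2 + x^2/4, where x^2/4 is the Gaussian transport cost, and sum_j c_j^2 restores the
    covariances up to signs. *)
Lemma sum_abs_linear_le {R : realFieldType} (N : nat) (S A : 'I_N -> 'I_N -> R) (v x : 'I_N -> R) :
  (forall k, 0 <= v k) -> (forall k l, S k l = \sum_j A k j * A l j) ->
  \sum_k v k * `|\sum_j A k j * x j| <=
  \sum_k \sum_l v k * v l * `|S k l| + \sum_j x j ^+ 2 / 4.
Proof.
move=> v0 hA.
pose e k : R := if 0 <= \sum_j A k j * x j then 1 else -1.
have e1 k : `|e k| = 1 by rewrite /e; case: ifP; rewrite ?normrN1 ?normr1.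
pose c j := \sum_k v k * e k * A k j.
have -> : \sum_k v k * `|\sum_j A k j * x j| = \sum_j c j * x j.
  transitivity (\sum_k \sum_j v k * e k * A k j * x j).
    apply: eq_bigr => k _.
    rewrite (_ : `|_| = e k * \sum_j A k j * x j).
      by rewrite mulrA mulr_sumr; apply: eq_bigr => j _; rewrite !mulrA.
    rewrite /e; case: ifP => h; first by rewrite mul1r ger0_norm.
    by rewrite mulN1r ler0_norm// ltW// ltNge h.
  by rewrite exchange_big; apply: eq_bigr => j _; rewrite mulr_suml.
apply: (@le_trans _ _ (\sum_j (c j ^+ 2 + x j ^+ 2 / 4))).
  apply: ler_sum => j _; rewrite -subr_ge0.
  rewrite (_ : _ - _ = (c j - x j / 2) ^+ 2) ?sqr_ge0//.
  by field.
rewrite big_split/= lerD2r.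
have -> : \sum_j c j ^+ 2 = \sum_k \sum_l v k * v l * (e k * e l * S k l).
  transitivity (\sum_j \sum_k \sum_l v k * v l * (e k * e l) * (A k j * A l j)).
    apply: eq_bigr => j _; rewrite expr2 mulr_suml; apply: eq_bigr => k _.
    by rewrite mulr_sumr; apply: eq_bigr => l _; ring.
  rewrite exchange_big; apply: eq_bigr => k _.
  rewrite exchange_big; apply: eq_bigr => l _.
  by rewrite hA !mulr_sumr; apply: eq_bigr => j _; rewrite !mulrA.
apply: ler_sum => k _; apply: ler_sum => l _; rewrite ler_wpM2l ?mulr_ge0//.
by apply: (le_trans (ler_norm _)); rewrite !normrM !e1 !mul1r.
Qed.

Section gaussian_concentration.
Context {R : realType} disp (T : measurableType disp) (P : probability T R).
Variables (d N : nat) (X : 'I_d -> 'I_N -> T -> R) (S : 'I_N -> 'I_N -> R).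
Hypothesis gX : forall i (c : 'I_N -> R), is_gaussian P (fun w => \sum_(k < N) c k * X i k w).
Hypothesis EX : forall i k, ('E_P[X i k] = 0)%E.
Hypothesis covX : forall i k l, (\int[P]_w (X i k w * X i l w)%:E = (S k l)%:E)%E.
Hypothesis indX : forall A : 'I_d -> 'I_N -> set R, (forall i k, measurable (A i k)) ->
  P [set w | forall i k, A i k (X i k w)] =
  (\prod_(i < d) P [set w | forall k, A i k (X i k w)])%E.

Let mX i k : measurable_fun setT (X i k).
Proof. by have [] := gaussian_vector_coord (gX i) k. Qed.

(** All components share the covariance [S], so one matrix serves for all of them. Positivity is
    read off from some component; with d = 0 the claim is vacuous. *)
Let factor : exists A : 'I_N -> 'I_N -> R, forall (i : 'I_d) k l,
  S k l = \sum_(j < N) A k j * A l j.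
Proof.
have [i|nd] := pselect (exists i : 'I_d, True); last first.
  by exists (fun _ _ => 0) => i; exfalso; apply: nd; exists i.
case: i => i _; have [||A hA] := @psd_factorization R N S.
- move=> k l; apply: EFin_inj; rewrite -(covX i k l) -(covX i l k).
  by apply: eq_integral => w _; rewrite mulrC.
- exact: (gaussian_vector_psd (gX i) (covX i)).
- by exists A.
Qed.

Theorem gaussian_concentration (f : ('I_d * 'I_N -> R) -> R) (v : 'I_N -> R) :
  (forall k, 0 <= v k) ->
  (forall x y, `|f x - f y| <= \sum_(i < d) \sum_(k < N) v k * `|x (i, k) - y (i, k)|) ->
  (\int[P]_w (expR (f (fun ik => X ik.1 ik.2 w)))%:E *
   \int[P]_w (expR (- f (fun ik => X ik.1 ik.2 w)))%:E <=
   (expR (d%:R * \sum_(k < N) \sum_(l < N) v k * v l * `|S k l|))%:E)%E.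
Proof.
move=> v0 fv; have [A hA] := factor.
pose V := \sum_(k < N) \sum_(l < N) v k * v l * `|S k l|.
have [d0 [W0 [Q0 [g [mg plg boxg cosg]]]]] := prekopa_power N (@gauss_has_prekopa R).
have [d1 [W [Q [p [mp plp boxp _]]]]] := prekopa_power d plg.
pose Y k w0 := \sum_(j < N) A k j * g j w0.
have mY k : measurable_fun setT (Y k).
  by apply: measurable_sum => j; apply: measurable_funM => //; exact: mg.
pose Z (ik : 'I_d * 'I_N) w := Y ik.2 (p ik.1 w).
have mZ ik : measurable_fun setT (Z ik) by exact: measurableT_comp.
(* The characteristic functions of both vectors at a are exp (- a S a / 2): on the Gaussian side by
   its covariance, on the other by independence of the standard coordinates and S = A A^T. *)
have one i (B : 'I_N -> set R) : (forall k, measurable (B k)) ->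
    P [set w | forall k, B k (X i k w)] = Q0 [set w | forall k, B k (Y k w)].
  apply: eq_law_boxes => // a t.
  rewrite (gaussian_vector_cos (gX i) (EX i) (covX i)).
  pose b j := \sum_(k < N) a k * A k j.
  have -> : (\int[Q0]_w (cos (t + \sum_(k < N) a k * Y k w))%:E =
             \int[Q0]_w (cos (t + \sum_(j < N) b j * g j w))%:E)%E.
    apply: eq_integral => w _; congr (cos (_ + _))%:E.
    transitivity (\sum_(k < N) \sum_(j < N) a k * A k j * g j w).
      by apply: eq_bigr => k _; rewrite mulr_sumr; apply: eq_bigr => j _; rewrite mulrA.
    by rewrite exchange_big; apply: eq_bigr => j _; rewrite mulr_suml.
  rewrite (cosg (fun j z => b j * z) (fun j => expR (- (b j ^+ 2 / 2)))).
  - congr (_ * _)%:E; rewrite -expR_sum; congr expR; rewrite sumrN; congr (- _).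
    rewrite -mulr_suml; congr (_ / _).
    transitivity (\sum_j \sum_k \sum_l a k * a l * (A k j * A l j)).
      rewrite [RHS]exchange_big; apply: eq_bigr => k _; rewrite [RHS]exchange_big; apply: eq_bigr => l _.
      by rewrite (hA i) mulr_sumr.
    apply: eq_bigr => j _; rewrite expr2 mulr_suml; apply: eq_bigr => k _.
    by rewrite mulr_sumr; apply: eq_bigr => l _; ring.
  - by move=> j; exact: measurable_funM.
  - move=> j s; rewrite (normal_cos 0 (@oner_neq0 _)) mulr0 addr0 expr1n mul1r//.
(* Independence of the components on both sides extends the equality of laws from one component to
   all. *)
have box (B : 'I_d * 'I_N -> set R) : (forall ik, measurable (B ik)) ->
    P [set w | forall ik, B ik (X ik.1 ik.2 w)] = Q [set w | forall ik, B ik (Z ik w)].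
  move=> mB.
  have := boxp (fun i => [set w0 | forall k, B (i, k) (Y k w0)]) _.
  rewrite (_ : [set w | forall i, [set w0 | forall k, B (i, k) (Y k w0)] (p i w)] =
               [set w | forall ik, B ik (Z ik w)]); last first.
    by apply/seteqP; split => w /= h; [case=> i k; exact: h|move=> i k; exact: (h (i, k))].
  move=> ->; last first.
    by move=> i; exact: (@measurable_box _ _ _ _ (fun=> R) Y (fun k => B (i, k))).
  rewrite (_ : [set w | forall ik, B ik (X ik.1 ik.2 w)] =
    [set w | forall i k, B (i, k) (X i k w)]); last first.
    by apply/seteqP; split => w /= h; [move=> i k; exact: (h (i, k))|case=> i k; exact: h].
  rewrite (indX (A := fun i k => B (i, k)))//.
  by apply: eq_bigr => i _; rewrite (one i (fun k => B (i, k))).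
have fK x y : `|f x - f y| <= (\sum_k v k) * \sum_ik `|x ik - y ik|.
  apply: (le_trans (fv x y)).
  have -> : \sum_ik `|x ik - y ik| = \sum_(i < d) \sum_(k < N) `|x (i, k) - y (i, k)|.
    by rewrite pair_big/=; apply: eq_bigr => -[].
  rewrite mulr_sumr; apply: ler_sum => i _; rewrite mulr_sumr; apply: ler_sum => k _.
  by rewrite ler_wpM2r// (bigD1 k)//= lerDl sumr_ge0.
have mexp : measurable_fun setT (fun x : R => (expR x)%:E) by exact/measurable_EFinP.
have mexpN : measurable_fun setT (fun x : R => (expR (- x))%:E).
  by apply/measurable_EFinP; apply: measurableT_comp.
have mXX ik : measurable_fun setT (X ik.1 ik.2) by [].
rewrite (@eq_law_integral _ _ _ P _ _ Q _ (fun ik => X ik.1 ik.2) Z mXX mZ box f _ _ fK mexp).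
rewrite (@eq_law_integral _ _ _ P _ _ Q _ (fun ik => X ik.1 ik.2) Z mXX mZ box f _ _ fK mexpN).
have mfZ : measurable_fun setT (fun w => f (Z ^~ w)) by exact: (lipschitz_measurable mZ fK).
(* Property (tau) for exp (f - d V) and exp (- f): its hypothesis is f w - f w' <= d V + cost,
   obtained component by component. *)
have := plp (fun w => (expR (- (d%:R * V)))%:E * (expR (f (Z ^~ w)))%:E)%E
  (fun w => (expR (- f (Z ^~ w)))%:E).
rewrite ge0_integralZl//; [|by apply/measurable_EFinP; exact: measurableT_comp].
move=> /(_ _ _ _ _ _)/wrap[].
- apply: emeasurable_funM => //; apply/measurable_EFinP; exact: measurableT_comp.
- apply/measurable_EFinP; apply: measurableT_comp => //; exact: measurableT_comp.
- by move=> w; rewrite -EFinM lee_fin mulr_ge0 ?expR_ge0.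
- by move=> w; rewrite lee_fin expR_ge0.
- move=> w w'; rewrite -!EFinM lee_fin -!expRD ler_expR.
  rewrite -addrA addrC -lerBrDr opprK.
  apply: (le_trans (ler_norm _)); apply: (le_trans (fv _ _)).
  rewrite (_ : d%:R * V = \sum_(i < d) V); last by rewrite sumr_const card_ord mulr_natl.
  rewrite -big_split/=.
  apply: ler_sum => i _.
  pose x j := g j (p i w) - g j (p i w').
  rewrite addrC; apply: le_trans (sum_abs_linear_le x v0 (hA i)).
  apply: ler_sum => k _; rewrite /Z /Y/= -sumrB ler_wpM2l//.
  by rewrite (eq_bigr (fun j => A k j * x j))// => j _; rewrite /x mulrBr.
- by rewrite -muleA expRN muleC lee_pdivrMr ?expR_gt0// mul1e.
Qed.

End gaussian_concentration.

(** * Increments of fractional Brownian motion *)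

Section powR_increments.
Context {R : realType}.
Implicit Types (p t x y u : R).

Lemma powR_convex p t x y : 1 <= p -> 0 <= t <= 1 -> 0 <= x -> 0 <= y ->
  (t * x + (1 - t) * y) `^ p <= t * x `^ p + (1 - t) * y `^ p.
Proof.
move=> p1 /andP[t0 t1] x0 y0.
have := convex_powR p1 (Itv01 t0 t1) (x := x) (y := y).
by rewrite !inE/= !in_itv/= !andbT => /(_ x0 y0); rewrite !convRE.
Qed.

(** Convexity of the power 1/p at x^p and y^p, raised to the power p. *)
Lemma powR_concave p t x y : 0 < p -> p <= 1 -> 0 <= t <= 1 -> 0 <= x -> 0 <= y ->
  t * x `^ p + (1 - t) * y `^ p <= (t * x + (1 - t) * y) `^ p.
Proof.
move=> p0 p1 t01 x0 y0; have /andP[t0 t1] := t01.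
have ip : 1 <= p^-1 by rewrite invf_ge1.
have := powR_convex ip t01 (powR_ge0 x p) (powR_ge0 y p).
rewrite -!powRrM !mulfV ?gt_eqF// !powRr1// => h.
have c0 : 0 <= t * x `^ p + (1 - t) * y `^ p.
  by rewrite addr_ge0 ?mulr_ge0 ?powR_ge0 ?subr_ge0.
have := ge0_ler_powR (ltW p0) _ _ h.
rewrite !nnegrE powR_ge0 -powRrM mulVf ?gt_eqF// powRr1//; apply => //.
by rewrite addr_ge0 ?mulr_ge0 ?subr_ge0.
Qed.

(** The inner points y and x + u are convex combinations of the outer points x and y + u with
    exchanged weights. Adding the two convexity (or concavity) inequalities compares the increments
    over [x, x + u] and [y, y + u]. *)
Let mid x y u (xy : x <= y) (u0 : 0 <= u) : exists t, [/\ 0 <= t <= 1,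
  y = t * x + (1 - t) * (y + u) & x + u = (1 - t) * x + (1 - (1 - t)) * (y + u)].
Proof.
have : 0 <= y + u - x by lra.
rewrite le_eqVlt => /orP[/eqP e|d0].
  by exists 0; split; [rewrite lexx ler01|lra|lra].
exists (u / (y + u - x)); split.
- by rewrite divr_ge0 ?(ltW d0)//= ler_pdivrMr// mul1r; lra.
- by field; rewrite gt_eqF.
- by field; rewrite gt_eqF.
Qed.

Lemma powR_increment_convex p x y u : 1 <= p -> 0 <= x -> x <= y -> 0 <= u ->
  (x + u) `^ p - x `^ p <= (y + u) `^ p - y `^ p.
Proof.
move=> p1 x0 xy u0; have [t [t01 ey ex]] := mid xy u0.
have y0 : 0 <= y by lra.
have yu0 : 0 <= y + u by lra.
have h1 := powR_convex p1 t01 x0 yu0.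
have t01' : 0 <= 1 - t <= 1 by lra.
have h2 := powR_convex p1 t01' x0 yu0.
rewrite -ey in h1; rewrite -ex in h2; lra.
Qed.

Lemma powR_increment_concave p x y u : 0 < p -> p <= 1 -> 0 <= x -> x <= y -> 0 <= u ->
  (y + u) `^ p - y `^ p <= (x + u) `^ p - x `^ p.
Proof.
move=> p0 p1 x0 xy u0; have [t [t01 ey ex]] := mid xy u0.
have y0 : 0 <= y by lra.
have yu0 : 0 <= y + u by lra.
have h1 := powR_concave p0 p1 t01 x0 yu0.
have t01' : 0 <= 1 - t <= 1 by lra.
have h2 := powR_concave p0 p1 t01' x0 yu0.
rewrite -ey in h1; rewrite -ex in h2; lra.
Qed.

(** Write n = (n + 1) q with q <= 1; then 1 - q^p <= 1 - q^2 <= 2 (1 - q), and 1 - q = 1/(n + 1). *)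
Lemma powR_unit_increment p (n : nat) : 1 <= p -> p <= 2 ->
  n.+1%:R `^ p - n%:R `^ p <= 2 * n.+1%:R `^ (p - 1) :> R.
Proof.
move=> p1 p2; have n0 : 0 < n.+1%:R :> R by [].
have p0 : 0 < p by lra.
pose q : R := n%:R / n.+1%:R.
have q0 : 0 <= q by rewrite divr_ge0.
have q1 : q <= 1 by rewrite ler_pdivrMr// mul1r ler_nat.
have eq : n%:R = n.+1%:R * q by rewrite /q mulrC divfK// gt_eqF.
have eq1 : 1 - q = n.+1%:R^-1.
  by rewrite /q -natr1; field; rewrite natr1 gt_eqF.
have h : 1 - q `^ p <= 2 * n.+1%:R^-1.
  have q2 : q ^+ 2 <= q `^ p.
    rewrite -powR_mulrn//; have [->|qn0] := eqVneq q 0.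
      by rewrite !powR0// ?gt_eqF.
    by apply: ger_powR => //; rewrite lt_def qn0 q0.
  have : 1 - q ^+ 2 <= 2 * (1 - q) by nra.
  rewrite -eq1; move: q2; lra.
rewrite [X in _ - X `^ _]eq powRM// -[X in X - _]mulr1 -mulrBr -(mulr_powRB1 (ltW n0) p0).
have NQ0 : 0 <= n.+1%:R * n.+1%:R `^ (p - 1) by rewrite mulr_ge0 ?powR_ge0.
apply: (le_trans (ler_wpM2l NQ0 h)).
rewrite mulrCA [_ / _]mulrAC mulfV ?gt_eqF// mul1r//.
Qed.

(** For p = 2H, the covariance of B_t - B_s and B_t' - B_s'. *)
Definition block_cov (p s t s' t' : R) : R :=
  2^-1 * (`|t - s'| `^ p + `|t' - s| `^ p - `|t - t'| `^ p - `|s - s'| `^ p).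

Lemma block_covC p s t s' t' : block_cov p s t s' t' = block_cov p s' t' s t.
Proof.
rewrite /block_cov (distrC t t') (distrC s s'); ring.
Qed.

Lemma block_cov_diag (p l s th th' : R) : 0 < p -> 0 <= th <= l -> 0 <= th' <= l ->
  `|block_cov p s (s + th) s (s + th')| <= l `^ p.
Proof.
move=> p0 /andP[a0 al] /andP[b0 bl]; rewrite /block_cov.
have l0 : 0 <= l by lra.
rewrite subrr normr0 (powR0 (lt0r_neq0 p0)) subr0.
rewrite (_ : s + th - s = th); last by ring.
rewrite (_ : s + th' - s = th'); last by ring.
rewrite (_ : s + th - (s + th') = th - th'); last by ring.
rewrite (ger0_norm a0) (ger0_norm b0).
have mono u : 0 <= u -> u <= l -> u `^ p <= l `^ p.
  by move=> u0 ul; apply: (ge0_ler_powR (ltW p0)); rewrite ?nnegrE.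
have ha := mono _ a0 al; have hb := mono _ b0 bl.
have hab : `|th - th'| `^ p <= l `^ p.
  by apply: mono => //; rewrite ler_norml; apply/andP; split; lra.
have := powR_ge0 th p; have := powR_ge0 th' p; have := powR_ge0 `|th - th'| p.
rewrite ler_norml => *; apply/andP; split; lra.
Qed.

(* The sign of the second difference of u^p is constant, so that its absolute
   values telescope. *)
Lemma block_cov_row (p l th th' : R) (j n : nat) : 0 < p -> p <= 2 ->
  0 <= th <= l -> 0 <= th' <= l -> (j < n)%N ->
  \sum_(j.+1 <= k < n) `|block_cov p (j%:R * l) (j%:R * l + th) (k%:R * l) (k%:R * l + th')|
   <= l `^ p * n%:R `^ (Num.max p 1 - 1).
Proof.
move=> p0 p2 /andP[a0 al] /andP[b0 bl] jn.
have l0 : 0 <= l by lra.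
pose D (x : R) := (x + th) `^ p - x `^ p.
(* The covariance for blocks j and k is half of D (x + th') - D x with x = (k - j) l - th. As 0 <=
   th' <= l and D is monotone, it lies between 0 and half of [u k.+1 - u k]. *)
pose u (k : nat) := D ((k - j)%N%:R * l - th).
have x0 k : (j < k)%N -> 0 <= (k - j)%N%:R * l - th.
  move=> jk; have : 1 <= (k - j)%N%:R :> R by rewrite ler1n subn_gt0.
  by move: ((k - j)%N%:R) => r r1; nra.
have covE k : (j < k)%N ->
    block_cov p (j%:R * l) (j%:R * l + th) (k%:R * l) (k%:R * l + th') =
    2^-1 * (D ((k - j)%N%:R * l - th + th') - D ((k - j)%N%:R * l - th)).
  move=> jk; rewrite /block_cov /D.
  have kj : k%:R = j%:R + (k - j)%N%:R :> R by rewrite -natrD subnKC// ltnW.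
  rewrite kj; have := x0 k jk; move: ((k - j)%N%:R) (j%:R) => r i r0.
  rewrite (_ : i * l + th - (i + r) * l = - (r * l - th)); last by ring.
  rewrite (_ : (i + r) * l + th' - i * l = r * l - th + th' + th); last by ring.
  rewrite (_ : i * l + th - ((i + r) * l + th') = - (r * l - th + th')); last by ring.
  rewrite (_ : i * l - (i + r) * l = - (r * l - th + th)); last by ring.
  rewrite !normrN !ger0_norm; [ring|lra..].
have uS k : (j < k)%N -> u k.+1 = D ((k - j)%N%:R * l - th + l).
  move=> jk; rewrite /u subSn; last exact: ltnW.
  by rewrite -natr1; congr D; ring.
have D0 x : 0 <= x -> 0 <= D x.
  move=> h; rewrite subr_ge0; apply: (ge0_ler_powR (ltW p0)); rewrite ?nnegrE; lra.
have n1 : 1 <= n%:R :> R by rewrite ler1n; exact: leq_ltn_trans jn.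
have lp0 := powR_ge0 l p.
have uj1 : u j.+1 <= l `^ p.
  rewrite /u subSnn mul1r /D subrK lerBlDr lerDl; exact: powR_ge0.
have [p1|p1] := leP 1 p.
-
  have le1 : \sum_(j.+1 <= k < n) `|block_cov p (j%:R * l) (j%:R * l + th) (k%:R * l) (k%:R * l + th')|
      <= \sum_(j.+1 <= k < n) (2^-1 * (u k.+1 - u k)).
    apply: ler_sum_nat => k /andP[jk _]; rewrite covE// uS//.
    have h1 := powR_increment_convex p1 (x0 k jk) (_ : _ <= (k - j)%N%:R * l - th + th') a0.
    have h2 : (k - j)%N%:R * l - th + th' <= (k - j)%N%:R * l - th + l by rewrite lerD2l.
    have h3 : 0 <= (k - j)%N%:R * l - th + th' by rewrite addr_ge0// x0.
    have h4 := powR_increment_convex p1 h3 h2 a0.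
    rewrite ger0_norm; last by rewrite mulr_ge0// subr_ge0 h1// lerDl.
    by rewrite ler_wpM2l// lerD2r.
  apply: (le_trans le1); rewrite -mulr_sumr telescope_sumr//.
  have uj0 : 0 <= u j.+1 by apply: D0; exact: x0.
  (* Here D increases, so the last term of the telescoping sum dominates; the 2 is cancelled by the
     1/2 in the covariance. *)
  have : u n <= 2 * (l `^ p * n%:R `^ (p - 1)); last by lra.
  rewrite /u /D subrK.
  have : (n - j = (n - j.+1).+1)%N by rewrite -subSn.
  set r := (n - j.+1)%N => ->.
  have hr : r.+1%:R * l - l = r%:R * l by rewrite -natr1; ring.
  apply: (@le_trans _ _ ((r.+1%:R * l) `^ p - (r%:R * l) `^ p)).
    rewrite lerD2l lerN2; apply: (ge0_ler_powR (ltW p0)); rewrite ?nnegrE ?mulr_ge0//.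
      by rewrite -natr1; have : 0 <= r%:R * l; [exact: mulr_ge0|lra].
    by rewrite -hr lerD2l lerN2.
  rewrite !powRM// -mulrBl mulrC mulrCA ler_wpM2l//.
  apply: (le_trans (powR_unit_increment r p1 p2)); rewrite ler_wpM2l//.
  apply: ge0_ler_powR; rewrite ?nnegrE ?subr_ge0//.
  by rewrite ler_nat /r ltn_subrL/= (leq_ltn_trans _ jn).
(* Here D decreases: the covariances are nonpositive and the first term [u j.+1], at most l^p,
   bounds the sum whatever n is. *)
- rewrite subrr powRr0 mulr1.
  have le1 : \sum_(j.+1 <= k < n) `|block_cov p (j%:R * l) (j%:R * l + th) (k%:R * l) (k%:R * l + th')|
      <= \sum_(j.+1 <= k < n) (- 2^-1 * (u k.+1 - u k)).
    apply: ler_sum_nat => k /andP[jk _]; rewrite covE// uS//.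
    have h1 := powR_increment_concave p0 (ltW p1) (x0 k jk) (_ : _ <= (k - j)%N%:R * l - th + th') a0.
    have h2 : (k - j)%N%:R * l - th + th' <= (k - j)%N%:R * l - th + l by rewrite lerD2l.
    have h3 : 0 <= (k - j)%N%:R * l - th + th' by rewrite addr_ge0// x0.
    have h4 := powR_increment_concave p0 (ltW p1) h3 h2 a0.
    rewrite ler0_norm; last by rewrite mulr_ge0_le0// subr_le0 h1// lerDl.
    by rewrite mulNr lerN2 ler_wpM2l// lerD2r.
  apply: (le_trans le1); rewrite -mulr_sumr telescope_sumr//.
  have un0 : 0 <= u n by apply: D0; exact: x0.
  by lra.
Qed.

(** The diagonal and the two triangles each contribute at most n times the bound for a row, hence
    the 3. Symmetry exchanges the triangles together with the offsets [th] and [th']. *)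
Lemma block_cov_sum (p l th th' : R) (n : nat) : 0 < p -> p <= 2 ->
  0 <= th <= l -> 0 <= th' <= l ->
  \sum_(j < n) \sum_(k < n)
    `|block_cov p (j%:R * l) (j%:R * l + th) (k%:R * l) (k%:R * l + th')|
   <= 3 * l `^ p * n%:R `^ (Num.max p 1).
Proof.
move=> p0 p2 hth hth'.
have [->|n0] := posnP n; first by rewrite big_ord0 !mulr_ge0 ?powR_ge0.
pose G th th' (j k : nat) :=
  `|block_cov p (j%:R * l) (j%:R * l + th) (k%:R * l) (k%:R * l + th')|.
have GC t1 t2 j k : G t1 t2 j k = G t2 t1 k j by rewrite /G block_covC.
have n1 : 1 <= n%:R :> R by rewrite ler1n.
pose C := l `^ p * n%:R `^ (Num.max p 1 - 1).
have split3 : \sum_(j < n) \sum_(k < n) G th th' j k =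
  \sum_(j < n) (G th th' j j + \sum_(k < n | (j < k)%N) G th th' j k) +
  \sum_(k < n) \sum_(j < n | (k < j)%N) G th' th k j.
  rewrite [X in _ + X](_ : _ = \sum_(j < n) \sum_(k < n | (k < j)%N) G th th' j k).
    rewrite -big_split; apply: eq_bigr => j _ /=.
    rewrite (bigD1 j)//= -addrA; congr (_ + _).
    rewrite (bigID (fun k : 'I_n => (j < k)%N))/=; congr (_ + _); apply: eq_bigl => k.
      by rewrite neq_ltn; case: (ltngtP k j).
    by rewrite -leqNgt neq_ltn; case: (ltngtP k j).
  rewrite (exchange_big_dep xpredT)//=; apply: eq_bigr => j _; apply: eq_bigr => k _.
  by rewrite GC.
have row t1 t2 (j : 'I_n) : 0 <= t1 <= l -> 0 <= t2 <= l ->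
    \sum_(k < n | (j < k)%N) G t1 t2 j k <= C.
  move=> h1 h2.
  have -> : \sum_(k < n | (j < k)%N) G t1 t2 j k = \sum_(j.+1 <= k < n) G t1 t2 j k.
    by rewrite (@big_geq_mkord R 0 +%R j.+1 n xpredT).
  exact: (block_cov_row p0 p2 h1 h2 (ltn_ord j)).
have CE : l `^ p * n%:R `^ (Num.max p 1) = n%:R * C.
  rewrite /C mulrCA mulr_powRB1//.
  by rewrite lt_max ltr01 orbT.
have diag (j : 'I_n) : G th th' j j <= C.
  apply: (le_trans (block_cov_diag _ p0 hth hth')).
  rewrite /C ler_peMr ?powR_ge0// -[leLHS](powRr0 n%:R).
  by apply: ler_powR => //; rewrite subr_ge0 le_max lexx orbT.
rewrite split3 -mulrA CE.
have -> : 3 * (n%:R * C) = \sum_(j < n) (C + C) + \sum_(k < n) C.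
  by rewrite !sumr_const card_ord mulrnDl -(mulr_natl C n); ring.
apply: lerD; apply: ler_sum => j _; last exact: row.
by apply: lerD; [exact: diag|exact: row].
Qed.

End powR_increments.

Section fbm_increments.
Context {R : realType} disp (Omega : measurableType disp) (P : probability Omega R) (H : R).

Variable X : R -> Omega -> R.
Hypothesis fX : is_fbm1 P H X.

Let gP : is_gaussian_process P X. Proof. by case: fX. Qed.

Let comb1 c t : 0 <= t -> is_gaussian P (fun w => c * X t w).
Proof.
move=> t0; have := gP (n := 1) (t := fun=> t) (fun=> c) (fun=> t0).
by congr (is_gaussian _ _); apply/funext => w; rewrite big_ord1.
Qed.

Lemma fbm_gaussian t : 0 <= t -> is_gaussian P (X t).
Proof.
move=> t0; have := comb1 1 t0; congr (is_gaussian _ _).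
by apply/funext => w; rewrite mul1r.
Qed.

Lemma fbm_measurable t : 0 <= t -> measurable_fun setT (X t).
Proof. by move=> t0; have [] := fbm_gaussian t0. Qed.

Let int1 t : 0 <= t -> P.-integrable setT (EFin \o X t).
Proof.
move=> t0; apply: (@gaussian_vector_integrable _ _ _ P 1 (fun=> X t) _ ord0) => c.
have := comb1 (c ord0) t0; congr (is_gaussian _ _).
by apply/funext => w; rewrite big_ord1.
Qed.

Let int2 s t : 0 <= s -> 0 <= t -> P.-integrable setT (EFin \o (fun w => X s w * X t w)).
Proof.
move=> s0 t0.
pose tt (k : 'I_2) := if k == ord0 then s else t.
apply: (@gaussian_vector_prod_integrable _ _ _ P 2 (fun k => X (tt k)) _ ord0 ord_max) => c.
by apply: gP => k; rewrite /tt; case: ifP.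
Qed.

Let fbm_cov s t : 0 <= s -> 0 <= t ->
  (\int[P]_w (X s w * X t w)%:E =
   (2^-1 * (t `^ (2 * H) + s `^ (2 * H) - `|t - s| `^ (2 * H)))%:E)%E.
Proof.
move=> s0 t0; have [_ _ EX cov] := fX.
rewrite -(cov s t s0 t0) unlock (EX s s0) (EX t t0) /= unlock.
apply: eq_integral => w _ /=.
by rewrite [RHS](_ : _ = ((X s w - 0) * (X t w - 0))%:E)// !subr0.
Qed.

(** The covariance formula gives [X 0] second moment 0; there 0 to the power 2H is 0 because H is
    positive, the power 0 being 1. *)
Lemma fbm_start : 0 < H -> {ae P, forall w, X 0 w = 0}.
Proof.
move=> H0; have H20 : 2 * H != 0 by rewrite mulf_neq0// gt_eqF.
have m0 : measurable_fun setT (fun w => (X 0 w * X 0 w)%:E).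
  by apply/measurable_EFinP/measurable_funM; exact: fbm_measurable.
have : (\int[P]_w `|(X 0 w * X 0 w)%:E| = 0)%E.
  transitivity (\int[P]_w (X 0 w * X 0 w)%:E)%E.
    by apply: eq_integral => w _; rewrite gee0_abs// lee_fin -expr2 sqr_ge0.
  by rewrite fbm_cov// subrr normr0 powR0// !(addr0, subr0) mulr0.
move=> /(ae_eq_integral_abs P measurableT m0); apply: filterS => w /(_ I) []/eqP.
by rewrite mulf_eq0 orbb => /eqP.
Qed.

Lemma fbm_increment_mean s t : 0 <= s -> 0 <= t ->
  ('E_P[fun w => (X t w - X s w)%R] = 0)%E.
Proof.
move=> s0 t0; have [_ _ EX _] := fX; rewrite unlock.
transitivity (\int[P]_w ((X t w)%:E - (X s w)%:E))%E; first exact: eq_integral.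
rewrite integralB//; [|exact: int1|exact: int1].
have := EX s s0; have := EX t t0; rewrite unlock => -> ->.
by rewrite sube0.
Qed.

Lemma fbm_increment_cov s t s' t' : 0 <= s -> 0 <= t -> 0 <= s' -> 0 <= t' ->
  (\int[P]_w ((X t w - X s w) * (X t' w - X s' w))%:E =
   (block_cov (2 * H) s t s' t')%:E)%E.
Proof.
move=> s0 t0 s'0 t'0.
transitivity (\int[P]_w (((X t w * X t' w)%:E - (X t w * X s' w)%:E) -
   ((X s w * X t' w)%:E - (X s w * X s' w)%:E)))%E.
  by apply: eq_integral => w _; rewrite -!EFinB; congr EFin; ring.
rewrite integralB//; last 2 first.
- by apply: integrableB => //; exact: int2.
- by apply: integrableB => //; exact: int2.
rewrite integralB//; [|exact: int2|exact: int2].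
rewrite integralB//; [|exact: int2|exact: int2].
rewrite !fbm_cov// -!EFinB; congr EFin; rewrite /block_cov.
rewrite (distrC s' t) (distrC t' t) (distrC s' s); ring.
Qed.

Lemma fbm_increment_gaussian (N : nat) (s t : 'I_N -> R) (c : 'I_N -> R) :
  (forall k, 0 <= s k) -> (forall k, 0 <= t k) ->
  is_gaussian P (fun w => \sum_(k < N) c k * (X (t k) w - X (s k) w)).
Proof.
move=> s0 t0.
have := gP (n := (N + N)%N) (t := fun k => match fintype.split k with inl i => t i | inr i => s i end)
  (fun k => match fintype.split k with inl i => c i | inr i => - c i end) _.
move=> /(_ _)/wrap[]; first by move=> k; case: fintype.split.
congr (is_gaussian _ _); apply/funext => w.
rewrite big_split_ord/= -big_split/=; apply: eq_bigr => k _.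
rewrite !(unsplitK (inl k)) !(unsplitK (inr k)).
ring.
Qed.

End fbm_increments.

Lemma process_sigma_increments {R : realType} disp (Omega : measurableType disp)
    (X : R -> Omega -> R) (K : finType) (s t : K -> R) (A : K -> set R) :
  (forall k, 0 <= s k) -> (forall k, 0 <= t k) -> (forall k, measurable (A k)) ->
  process_sigma X [set w | forall k, A k (X (t k) w - X (s k) w)].
Proof.
move=> s0 t0 mA.
pose G : set (set Omega) := [set A | exists (t : R) (U : set R),
         [/\ 0 <= t, measurable U & A = X t @^-1` U]].
pose U := g_sigma_algebraType G.
have mX r : 0 <= r -> measurable_fun setT (X r : U -> R).
  move=> r0 _ B mB; rewrite setTI; apply: sub_sigma_algebra.
  by exists r, B.
apply: (@measurable_box _ U K _ (fun=> R) (fun k w => X (t k) w - X (s k) w) A) => // k.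
by apply: measurable_funB; exact: mX.
Qed.

Definition block_increment {R : realType} (T : Type) (d n M : nat) (B : R -> T -> 'cV[R]_d)
    (l : R) (th : 'I_M -> R) (w : T) (i : 'I_d) (j : 'I_n) (m : 'I_M) : R :=
  B (j%:R * l + th m) w i 0 - B (j%:R * l) w i 0.

Section fbm_concentration.
Context {R : realType} disp (Omega : measurableType disp) (P : probability Omega R) (d : nat) (H : R).
Variable B : R -> Omega -> 'cV[R]_d.
Hypotheses (H0 : 0 < H) (H1 : H < 1).
Hypothesis fB : is_fbm P H B.

(** Pairs (block, offset) are enumerated to form one Gaussian vector. As the weights depend only on
    the offset, the variance term splits into products [v m * v m'] times a sum over pairs of
    blocks, which is bounded uniformly in the two offsets. *)
Theorem fbm_concentration (l : R) (n M : nat) (th v : 'I_M -> R)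
    (f : ('I_d -> 'I_n -> 'I_M -> R) -> R) :
  0 < l -> (forall m, 0 <= th m <= l) -> (forall m, 0 <= v m) ->
  (forall x y, `|f x - f y| <=
     \sum_(i < d) \sum_(j < n) \sum_(m < M) v m * `|x i j m - y i j m|) ->
  (\int[P]_w (expR (f (block_increment B l th w)))%:E *
   \int[P]_w (expR (- f (block_increment B l th w)))%:E <=
   (expR (d%:R * ((\sum_m v m) ^+ 2 * (3 * l `^ (2 * H) * n%:R `^ Num.max (2 * H) 1))))%:E)%E.
Proof.
move=> l0 thl v0 fv; set xi := block_increment B l th.
pose K := ('I_n * 'I_M)%type.
pose jm (k : 'I_#|{: K}|) : K := enum_val k.
pose s (k : 'I_#|{: K}|) : R := (jm k).1%:R * l.
pose t (k : 'I_#|{: K}|) : R := (jm k).1%:R * l + th (jm k).2.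
have s0 k : 0 <= s k by rewrite mulr_ge0// ltW.
have t0 k : 0 <= t k by apply: addr_ge0; [exact: s0|have /andP[] := thl (jm k).2].
pose X (i : 'I_d) k w : R := B (t k) w i 0 - B (s k) w i 0.
pose S k k' := block_cov (2 * H) (s k) (t k) (s k') (t k').
have [fb1 indB] := fB.
have gX i (c : 'I_#|{: K}| -> R) : is_gaussian P (fun w => \sum_k c k * X i k w).
  exact: (fbm_increment_gaussian (fb1 i) c s0 t0).
have EX i k : ('E_P[X i k] = 0)%E by exact: (fbm_increment_mean (fb1 i) (s0 k) (t0 k)).
have covX i k k' : (\int[P]_w (X i k w * X i k' w)%:E = (S k k')%:E)%E.
  exact: (fbm_increment_cov (fb1 i)).
have indX (A : 'I_d -> 'I_#|{: K}| -> set R) : (forall i k, measurable (A i k)) ->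
    P [set w | forall i k, A i k (X i k w)] =
    (\prod_(i < d) P [set w | forall k, A i k (X i k w)])%E.
  move=> mA.
  have := indB [set: 'I_d]%SET (fun i => [set w | forall k, A i k (X i k w)]).
  move=> /(_ _)/wrap[].
    move=> i _; exact: (@process_sigma_increments R _ Omega (fun t w => B t w i 0) _ s t (A i) s0 t0 (mA i)).
  rewrite (_ : \bigcap_(i in _) _ = [set w | forall i k, A i k (X i k w)]).
    by move=> ->; apply: eq_bigl => i; rewrite inE.
  apply/seteqP; split => w /= h i; first by apply: h; rewrite /= inE.
  by move=> _; exact: h.
pose back (y : 'I_d * 'I_#|{: K}| -> R) i (j : 'I_n) (m : 'I_M) := y (i, enum_rank (j, m)).
have sumK (F : K -> R) : \sum_k F (jm k) = \sum_(j < n) \sum_(m < M) F (j, m).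
  by rewrite -(big_enum_val (A := {: K})) pair_big/=; apply: eq_big => -[].
have := @gaussian_concentration R _ Omega P d _ X S gX EX covX indX (fun y => f (back y))
  (fun k => v (jm k).2) (fun k => v0 _).
move=> /(_ _)/wrap[].
  move=> x y; apply: (le_trans (fv _ _)); apply: ler_sum => i _.
  rewrite -(sumK (fun jm => v jm.2 * `|back x i jm.1 jm.2 - back y i jm.1 jm.2|)).
  apply: ler_sum => k _; rewrite /back -surjective_pairing /jm enum_valK//.
have xiE w : xi w = back (fun ik => X ik.1 ik.2 w).
  apply/funext => i; apply/funext => j; apply/funext => m.
  by rewrite /xi /block_increment /back /X /s /t /jm/= enum_rankK.
rewrite (eq_integral (fun w => (expR (f (xi w)))%:E)); last by move=> w _; rewrite xiE.
rewrite [X in (_ * X <= _)%E -> _](eq_integral (fun w => (expR (- f (xi w)))%:E)); last first.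
  by move=> w _; rewrite xiE.
move=> h; apply: (le_trans h); rewrite lee_fin ler_expR ler_wpM2l//.
pose G (a b : K) := v a.2 * v b.2 *
  `|block_cov (2 * H) (a.1%:R * l) (a.1%:R * l + th a.2) (b.1%:R * l) (b.1%:R * l + th b.2)|.
have -> : \sum_(k < #|{: K}|) \sum_(l0 < #|{: K}|) v (jm k).2 * v (jm l0).2 * `|S k l0| =
  \sum_(m < M) \sum_(m' < M) v m * v m' * \sum_(j < n) \sum_(j' < n)
   `|block_cov (2 * H) (j%:R * l) (j%:R * l + th m) (j'%:R * l) (j'%:R * l + th m')|.
  rewrite (sumK (fun a => \sum_(l0 < #|{: K}|) G a (jm l0))) exchange_big.
  apply: eq_bigr => m _.
  under eq_bigr do rewrite (sumK (fun b => G (_, m) b)) exchange_big.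
  rewrite exchange_big; apply: eq_bigr => m' _.
  rewrite mulr_sumr; apply: eq_bigr => j _; rewrite mulr_sumr; apply: eq_bigr => j' _.
  by [].
have H2 : 0 < 2 * H by rewrite mulr_gt0.
have H22 : 2 * H <= 2 by rewrite ler_piMr// ltW.
rewrite expr2 -mulrA mulr_suml; apply: ler_sum => m _.
rewrite -mulrA mulr_suml mulr_sumr; apply: ler_sum => m' _.
rewrite -mulrA ler_wpM2l// ler_wpM2l//.
by rewrite mulrA; exact: block_cov_sum.
Qed.

End fbm_concentration.

(** * The Euler scheme *)

Section euclidean_norm.
Context {R : realType} {d : nat}.
Implicit Types (u v w : 'cV[R]_d).

Lemma dotpC u v : dotp u v = dotp v u.
Proof. by apply: eq_bigr => i _; rewrite mulrC. Qed.

Lemma dotpDl u v w : dotp (u + v) w = dotp u w + dotp v w.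
Proof. by rewrite -big_split; apply: eq_bigr => i _; rewrite mxE mulrDl. Qed.

Lemma dotpZl (c : R) u v : dotp (c *: u) v = c * dotp u v.
Proof. by rewrite /dotp mulr_sumr; apply: eq_bigr => i _; rewrite mxE mulrA. Qed.

Lemma dotpDr u v w : dotp w (u + v) = dotp w u + dotp w v.
Proof. by rewrite dotpC dotpDl !(dotpC w). Qed.

Lemma dotpZr (c : R) u v : dotp v (c *: u) = c * dotp v u.
Proof. by rewrite dotpC dotpZl dotpC. Qed.

Lemma dotp_ge0 u : 0 <= dotp u u.
Proof. by apply: sumr_ge0 => i _; rewrite -expr2 sqr_ge0. Qed.

Lemma enorm_ge0 u : 0 <= enorm u. Proof. exact: sqrtr_ge0. Qed.

Lemma sqr_enorm u : enorm u ^+ 2 = dotp u u.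
Proof. by rewrite sqr_sqrtr// dotp_ge0. Qed.

Lemma normr_coord_le_enorm u i : `|u i 0| <= enorm u.
Proof.
rewrite -(@ler_pXn2r _ 2%N) ?nnegrE ?enorm_ge0// norm_sqr sqr_enorm.
by rewrite /dotp (bigD1 i)//= -expr2 lerDl sumr_ge0// => j _; rewrite -expr2 sqr_ge0.
Qed.

Lemma enorm_eq0 u : enorm u = 0 -> u = 0.
Proof.
move=> u0; apply/matrixP => i j; rewrite ord1 mxE; apply/eqP.
by rewrite -normr_le0 -u0 normr_coord_le_enorm.
Qed.

Lemma enorm0 : enorm (0 : 'cV[R]_d) = 0.
Proof. by rewrite /enorm /dotp big1 ?sqrtr0// => i _; rewrite mxE mul0r. Qed.

Lemma enormZ (c : R) u : enorm (c *: u) = `|c| * enorm u.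
Proof.
by rewrite /enorm dotpZl dotpZr mulrA -expr2 sqrtrM ?sqr_ge0// sqrtr_sqr.
Qed.

Lemma enormN u : enorm (- u) = enorm u.
Proof. by rewrite -scaleN1r enormZ normrN1 mul1r. Qed.

Lemma dotp_le_enorm u v : dotp u v <= enorm u * enorm v.
Proof.
have [u0|un0] := eqVneq (enorm u) 0.
  by rewrite (enorm_eq0 u0) enorm0 mul0r /dotp big1// => i _; rewrite mxE mul0r.
have [v0|vn0] := eqVneq (enorm v) 0.
  by rewrite (enorm_eq0 v0) enorm0 mulr0 /dotp big1// => i _; rewrite mxE mulr0.
have uv0 : 0 < enorm u * enorm v by rewrite mulr_gt0// lt_def ?un0 ?vn0 enorm_ge0.
have := dotp_ge0 (enorm v *: u + (- enorm u) *: v).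
rewrite !(dotpDl, dotpDr, dotpZl, dotpZr) -!sqr_enorm (dotpC v u).
move=> h0; have : 0 <= 2 * (enorm u * enorm v) * (enorm u * enorm v - dotp u v).
  by apply: le_trans h0 _; rewrite le_eqVlt; apply/orP; left; apply/eqP; ring.
by rewrite pmulr_rge0 ?subr_ge0//; apply: mulr_gt0.
Qed.

Lemma enormD u v : enorm (u + v) <= enorm u + enorm v.
Proof.
rewrite -(@ler_pXn2r _ 2%N) ?nnegrE ?addr_ge0 ?enorm_ge0// sqr_enorm.
rewrite dotpDl !dotpDr -!sqr_enorm (dotpC v u).
by have := dotp_le_enorm u v; rewrite sqrrD mulr2n; lra.
Qed.

Lemma enormB u v : enorm (u - v) <= enorm u + enorm v.
Proof. by rewrite -(enormN v); exact: enormD. Qed.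

Lemma enorm_sum (I : Type) (r : seq I) (f : I -> 'cV[R]_d) :
  enorm (\sum_(i <- r) f i) <= \sum_(i <- r) enorm (f i).
Proof.
elim/big_ind2 : _ => [|u c v c' uc vc|//]; first by rewrite enorm0.
by apply: (le_trans (enormD _ _)); exact: lerD.
Qed.

Lemma enorm_le_sum u : enorm u <= \sum_i `|u i 0|.
Proof.
have s0 : 0 <= \sum_i `|u i 0| by exact: sumr_ge0.
rewrite -(@ler_pXn2r _ 2%N) ?nnegrE ?enorm_ge0// sqr_enorm expr2 mulr_suml.
apply: ler_sum => i _; rewrite -expr2 -norm_sqr expr2 ler_wpM2l//.
by rewrite (bigD1 i)//= lerDl sumr_ge0.
Qed.

Lemma enorm_mulmx (A : 'M[R]_d) u :
  enorm (A *m u) <= (\sum_i \sum_j `|A i j|) * \sum_j `|u j 0|.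
Proof.
apply: (le_trans (enorm_le_sum _)); rewrite mulr_suml; apply: ler_sum => i _.
rewrite mxE; apply: (le_trans (ler_norm_sum _ _ _)); rewrite mulr_suml.
apply: ler_sum => j _; rewrite normrM ler_wpM2l//.
by rewrite (bigD1 j)//= lerDl sumr_ge0.
Qed.

End euclidean_norm.

Section euler_scheme.
Context {R : realType} {d : nat}.
Variables (b : 'cV[R]_d -> 'cV[R]_d) (sigma : 'M[R]_d) (h : R) (M : nat).
Implicit Types (y : 'cV[R]_d) (xi : nat -> nat -> 'cV[R]_d).

(* [euler_block] carries the noise-free part Y - sigma xi inside a block, on
   which the noise xi is restarted from 0. *)
Fixpoint euler_block y (z : nat -> 'cV[R]_d) (m : nat) : 'cV[R]_d :=
  if m is m'.+1 then
    euler_block y z m' + h *: b (euler_block y z m' + sigma *m z m')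
  else y.

Fixpoint euler_start y xi (j : nat) : 'cV[R]_d :=
  if j is j'.+1 then
    euler_block (euler_start y xi j') (xi j') M + sigma *m xi j' M
  else y.

Definition euler_grid y xi (j m : nat) : 'cV[R]_d :=
  euler_block (euler_start y xi j) (xi j) m + sigma *m xi j m.

Variables (alpha L : R).
Hypotheses (alpha_gt0 : 0 < alpha) (L_gt0 : 0 < L).
Hypothesis b_contr : forall y z : 'cV[R]_d,
  dotp (b y - b z) (y - z) <= - alpha * enorm (y - z) ^+ 2.
Hypothesis b_lip : forall y z : 'cV[R]_d, enorm (b y - b z) <= L * enorm (y - z).
Hypotheses (h_ge0 : 0 <= h) (h_le1 : alpha * h <= 1) (h_le2 : L ^+ 2 * h <= alpha).

Let rho := 1 - alpha * h / 2.

Let rho_ge0 : 0 <= rho.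
Proof. by have := h_le1; rewrite /rho; lra. Qed.

Let rho_le1 : rho <= 1.
Proof. by rewrite /rho; have : 0 <= alpha * h by [exact: mulr_ge0 (ltW alpha_gt0) h_ge0]; lra. Qed.

Lemma euler_step_contraction y z :
  enorm (y - z + h *: (b y - b z)) <= rho * enorm (y - z).
Proof.
have := b_contr y z; have := b_lip y z.
move: (y - z) (b y - b z) => u v h2 h1.
rewrite -(@ler_pXn2r _ 2%N) ?nnegrE ?mulr_ge0 ?enorm_ge0// sqr_enorm.
rewrite !(dotpDl, dotpDr, dotpZl, dotpZr) -!sqr_enorm (dotpC u v).
have e0 := enorm_ge0 u; have f0 := enorm_ge0 v.
have h3 : enorm v ^+ 2 <= L ^+ 2 * enorm u ^+ 2.
  by rewrite -exprMn ler_pXn2r ?nnegrE ?mulr_ge0 ?(ltW L_gt0).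
move: (enorm u) (enorm v) (dotp _ _) e0 f0 h1 h3 {h2} => e f D e0 f0 h1 h3.
have h4 : h * (h * f ^+ 2) <= h * (alpha * e ^+ 2).
  rewrite ler_wpM2l//; apply: (@le_trans _ _ (h * (L ^+ 2 * e ^+ 2))); first exact: ler_wpM2l.
  by rewrite mulrA ler_wpM2r ?sqr_ge0// mulrC.
have h5 : h * D <= h * (- alpha * e ^+ 2) by rewrite ler_wpM2l.
have h6 : 0 <= (alpha * h * e) ^+ 2 by exact: sqr_ge0.
rewrite /rho exprMn; nra.
Qed.

(** A step splits into a contraction, with the same noise on both sides, and a change of noise
    inside b, which costs h L. The decay is kept for the starting point only; for the noise terms
    rho <= 1 suffices. *)
Lemma euler_block_stable y y' (z z' : nat -> 'cV[R]_d) m :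
  enorm (euler_block y z m - euler_block y' z' m) <=
  rho ^+ m * enorm (y - y') + h * L * \sum_(i < m) enorm (sigma *m (z i - z' i)).
Proof.
elim: m => [|m IHm] /=; first by rewrite big_ord0 mulr0 addr0 expr0 mul1r.
set V := euler_block y z m; set V' := euler_block y' z' m.
have -> : V + h *: b (V + sigma *m z m) - (V' + h *: b (V' + sigma *m z' m)) =
  ((V + sigma *m z m) - (V' + sigma *m z m)
     + h *: (b (V + sigma *m z m) - b (V' + sigma *m z m)))
  + h *: (b (V' + sigma *m z m) - b (V' + sigma *m z' m)).
  apply/matrixP => i j; rewrite !mxE; ring.
apply: (le_trans (enormD _ _)).
have h1 := euler_step_contraction (V + sigma *m z m) (V' + sigma *m z m).
have e1 : V + sigma *m z m - (V' + sigma *m z m) = V - V'.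
  by rewrite opprD addrACA subrr addr0.
have h2 : enorm (h *: (b (V' + sigma *m z m) - b (V' + sigma *m z' m))) <=
    h * L * enorm (sigma *m (z m - z' m)).
  rewrite enormZ ger0_norm// -mulrA ler_wpM2l//; apply: (le_trans (b_lip _ _)).
  by rewrite opprD addrACA subrr add0r mulmxBr.
apply: (le_trans (lerD h1 h2)); rewrite e1 big_ord_recr/= mulrDr addrA lerD2r exprS -mulrA.
apply: (le_trans (ler_wpM2l rho_ge0 IHm)); rewrite mulrDr lerD2l.
rewrite ler_piMl//; apply: mulr_ge0; first by rewrite mulr_ge0// ltW.
by apply: sumr_ge0 => i _; exact: enorm_ge0.
Qed.

(** Bernoulli's inequality: a whole block contracts by at least the factor 1/(1 + alpha l/2),
    whatever the number of steps. *)
Let bernoulli : rho ^+ M * (1 + alpha * (h * M%:R) / 2) <= 1.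
Proof.
elim: M => [|k IHk]; first by rewrite expr0 mul1r !mulr0 mul0r addr0.
apply: le_trans IHk; rewrite exprSr -mulrA ler_wpM2l ?exprn_ge0//.
rewrite /rho -natr1; have k0 : 0 <= k%:R :> R by [].
have : 0 <= (alpha * h) ^+ 2 * (k%:R + 1) by rewrite mulr_ge0 ?sqr_ge0 ?addr_ge0.
nra.
Qed.

Variables (l : R).
Hypothesis (l_gt0 : 0 < l) (hM : h * M%:R = l).
(** Sum of the geometric series of ratio 1/(1 + alpha l/2), the contraction factor of a block. *)
Let kappa := 1 + 2 / (alpha * l).

(** The differences D_j of the starting points satisfy D_(j+1) <= rho^M D_j + E_j and D_0 = 0.
    Summing this over j, instead of unrolling it, gives (1 - rho^M) sum D <= sum E. *)
Lemma euler_start_sum_stable y xi xi' (n : nat) :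
  \sum_(j < n) enorm (euler_start y xi j - euler_start y xi' j) <=
  kappa * \sum_(j < n)
    (h * L * \sum_(i < M) enorm (sigma *m (xi j i - xi' j i)) + enorm (sigma *m (xi j M - xi' j M))).
Proof.
set D := fun j => enorm (euler_start y xi j - euler_start y xi' j).
set E := fun j => h * L * \sum_(i < M) enorm (sigma *m (xi j i - xi' j i)) +
   enorm (sigma *m (xi j M - xi' j M)).
have E0 j : 0 <= E j.
  rewrite /E addr_ge0 ?enorm_ge0// mulr_ge0 ?sumr_ge0// ?mulr_ge0 ?(ltW L_gt0)//.
  by move=> i _; exact: enorm_ge0.
have DS j : D j.+1 <= rho ^+ M * D j + E j.
  rewrite /D /E /= opprD addrACA -mulmxBr.
  apply: (le_trans (enormD _ _)); rewrite addrA lerD2r; exact: euler_block_stable.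
have D0 : D 0%N = 0 by rewrite /D /= subrr enorm0.
have Dge j : 0 <= D j by exact: enorm_ge0.
have al : 0 < alpha * l by rewrite mulr_gt0.
have r0 : 0 <= rho ^+ M by exact: exprn_ge0.
have rk : 1 <= kappa * (1 - rho ^+ M).
  have := bernoulli; rewrite hM /kappa; set q := alpha * l; set r := rho ^+ M.
  move=> hb; have q0 : 0 < q by [].
  rewrite -subr_ge0 (_ : _ - 1 = (2 / q) * (1 - r * (1 + q / 2))); last by field; rewrite gt_eqF.
  by rewrite mulr_ge0 ?divr_ge0 ?(ltW q0)// subr_ge0.
have k0 : 0 < kappa by rewrite /kappa addr_gt0// divr_gt0.
have key : (1 - rho ^+ M) * \sum_(j < n) D j <= \sum_(j < n) E j.
  have : \sum_(j < n) D j.+1 <= \sum_(j < n) (rho ^+ M * D j + E j) by exact: ler_sum.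
  rewrite big_split/= -mulr_sumr => hs.
  have : \sum_(j < n) D j <= \sum_(j < n) D j.+1.
    case: (n) => [|k]; first by rewrite !big_ord0.
    rewrite big_ord_recl [leRHS]big_ord_recr/= D0 add0r lerDl; exact: Dge.
  rewrite mulrBl mul1r; lra.
have S0 : 0 <= \sum_(j < n) D j by exact: sumr_ge0.
apply: (@le_trans _ _ (kappa * (1 - rho ^+ M) * \sum_(j < n) D j)); first by rewrite ler_peMl.
by rewrite -mulrA ler_wpM2l// ltW.
Qed.

(** In the weight of a noise value, kappa h L comes from the starting points of later blocks, h L
    from the same block, kappa at m + 1 = M from the shift of the next starting point, and [w m]
    from the noise added to the grid value itself. The noises agree at offset 0, so only indices
    [m.+1] occur. *)
Lemma euler_grid_stable y xi xi' (n : nat) (w : 'I_M -> R) :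
  (forall m, 0 <= w m) -> (forall j, xi j 0%N = xi' j 0%N) ->
  \sum_(j < n) \sum_(m < M) w m * enorm (euler_grid y xi j m.+1 - euler_grid y xi' j m.+1) <=
  \sum_(j < n) \sum_(m < M)
    ((\sum_k w k) * ((kappa + 1) * (h * L) + kappa * (m.+1 == M)%:R) + w m) *
     enorm (sigma *m (xi j m.+1 - xi' j m.+1)).
Proof.
move=> w0 xi0; set W := \sum_k w k.
have W0 : 0 <= W by exact: sumr_ge0.
have hL : 0 <= h * L by rewrite mulr_ge0// ltW.
pose e j m := enorm (sigma *m (xi j m - xi' j m)).
have e0 j m : 0 <= e j m by exact: enorm_ge0.
have e00 j : e j 0%N = 0 by rewrite /e xi0 subrr mulmx0 enorm0.
pose S j := \sum_(m < M) e j m.+1.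
have Sge j k : (k <= M)%N -> \sum_(i < k) e j i <= S j.
  case: k => [|k] kM; first by rewrite big_ord0 sumr_ge0.
  rewrite big_ord_recl e00 add0r /S.
  rewrite (big_ord_widen M (fun i => e j i.+1))//; last exact: ltnW.
  by rewrite big_mkcond/=; apply: ler_sum => i _; case: ifP.
pose D j := enorm (euler_start y xi j - euler_start y xi' j).
have D0 j : 0 <= D j by exact: enorm_ge0.
have grid j (m : 'I_M) : enorm (euler_grid y xi j m.+1 - euler_grid y xi' j m.+1) <=
    D j + h * L * S j + e j m.+1.
  rewrite /euler_grid opprD addrACA -mulmxBr; apply: (le_trans (enormD _ _)).
  rewrite lerD2r; apply: (le_trans (euler_block_stable _ _ _ _ _)).
  apply: lerD; first by apply: ler_piMl; [exact: D0|exact: exprn_ile1].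
  by rewrite ler_wpM2l// Sge.
apply: (@le_trans _ _ (\sum_(j < n) (W * D j + (W * (h * L * S j) + \sum_(m < M) w m * e j m.+1)))).
  apply: ler_sum => j _; rewrite addrA -mulrDr /W mulr_suml -big_split/=.
  by apply: ler_sum => m _; rewrite -mulrDr ler_wpM2l// grid.
rewrite big_split/= -mulr_sumr.
have EM : \sum_(j < n) D j <= kappa * \sum_(j < n) (h * L * S j + e j M).
  apply: (le_trans (euler_start_sum_stable y xi xi' n)).
  rewrite ler_wpM2l ?addr_ge0 ?divr_ge0 ?mulr_ge0 ?(ltW alpha_gt0) ?(ltW l_gt0)//.
  by apply: ler_sum => j _; rewrite lerD2r ler_wpM2l// Sge.
apply: (le_trans (lerD (ler_wpM2l W0 EM) (lexx _))).
rewrite mulrA mulr_sumr -big_split/=; apply: ler_sum => j _.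
rewrite le_eqVlt; apply/orP; left; apply/eqP.
have -> : e j M = \sum_(m < M) (m.+1 == M)%:R * e j m.+1.
  have : (0 < M)%N.
    by rewrite lt0n; apply/eqP => M0; move: hM; rewrite M0 mulr0 => l0; move: l_gt0; rewrite -l0 ltxx.
  case: M => // k _; rewrite big_ord_recr/= eqxx mul1r big1 ?add0r// => i _.
  by rewrite eqSS ltn_eqF ?mul0r.
rewrite /S !mulr_sumr -!big_split/= mulr_sumr -!big_split/=.
by apply: eq_bigr => m _; rewrite -/(e j m.+1); ring.
Qed.

End euler_scheme.

(* The index [m.+1] of the result carries the entry [m] of [x]; the value at
   [m = 0], where block noises vanish, is [0]. *)
Definition path_of_block {R : realType} (d n M : nat) (x : 'I_d -> 'I_n -> 'I_M -> R) (j m : nat) : 'cV[R]_d :=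
  if m is m'.+1 then
    if insub j is Some j' then
      if insub m' is Some m'' then \col_i x i j' m'' else 0
    else 0
  else 0.

Lemma path_of_blockE {R : realType} (d n M : nat) (x : 'I_d -> 'I_n -> 'I_M -> R) (j : 'I_n) (m : 'I_M) :
  path_of_block x j m.+1 = \col_i x i j m.
Proof. by rewrite /path_of_block !valK. Qed.

(** * Concentration for the Euler scheme *)

Section euler_concentration.
Context {R : realType} {d : nat}.
Variables (b : 'cV[R]_d -> 'cV[R]_d) (sigma : 'M[R]_d).
Variables (alpha L : R).
Hypotheses (alpha_gt0 : 0 < alpha) (L_gt0 : 0 < L).
Hypothesis b_contr : forall y z : 'cV[R]_d,
  dotp (b y - b z) (y - z) <= - alpha * enorm (y - z) ^+ 2.
Hypothesis b_lip : forall y z : 'cV[R]_d, enorm (b y - b z) <= L * enorm (y - z).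
Variables (H : R).
Hypotheses (H0 : 0 < H) (H1 : H < 1).
Variables (l : R).
Hypothesis (l_gt0 : 0 < l).

(** The sum of the entries of [sigma] in absolute value bounds its norm, 2 + 2/(alpha l) is kappa +
    1, l L + 1 comes from the total weight of a block, and the last factor from the block
    covariances. *)
Definition euler_constant : R :=
  d%:R * ((\sum_i \sum_j `|sigma i j|) * (2 + 2 / (alpha * l)) * (l * L + 1)) ^+ 2
    * (3 * l `^ (2 * H)).

Lemma euler_constant_ge0 : 0 <= euler_constant.
Proof.
rewrite /euler_constant; apply: mulr_ge0; last by rewrite mulr_ge0// powR_ge0.
by apply: mulr_ge0 => //; exact: sqr_ge0.
Qed.

Context disp (Omega : measurableType disp) (P : probability Omega R).
Variable B : R -> Omega -> 'cV[R]_d.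
Hypothesis fB : is_fbm P H B.

Definition block_noise (M : nat) (w : Omega) (j m : nat) : 'cV[R]_d :=
  B (j%:R * l + m%:R * (l / M%:R)) w - B (j%:R * l) w.

Theorem euler_concentration (n M : nat) (y : 'cV[R]_d) (w : 'I_M -> R) (K : R)
    (Phi : (nat -> nat -> 'cV[R]_d) -> R) :
  (0 < M)%N -> alpha * (l / M%:R) <= 1 -> L ^+ 2 * (l / M%:R) <= alpha ->
  0 <= K -> (forall m, 0 <= w m) ->
  (forall u v, `|Phi u - Phi v| <=
     K * \sum_(j < n) \sum_(m < M) w m * enorm (u j m.+1 - v j m.+1)) ->
  let F om := Phi (euler_grid b sigma (l / M%:R) M y (block_noise M om)) in
  measurable_fun setT F /\
  ((\int[P]_om (expR (F om))%:E * \int[P]_om (expR (- F om))%:E <=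
    (expR (euler_constant * (K * \sum_m w m) ^+ 2 * n%:R `^ Num.max (2 * H) 1))%:E)%E : Prop).
Proof.
move=> M0 h1 h2 K0 w0 PhiK F.
set h := l / M%:R; have h0 : 0 <= h by rewrite divr_ge0// ltW.
have hM : h * M%:R = l by rewrite /h divfK// pnatr_eq0 -lt0n.
pose kappa := 1 + 2 / (alpha * l).
have kappa0 : 0 <= kappa.
  by rewrite addr_ge0// divr_ge0// mulr_ge0// ltW.
pose W := \sum_m w m.
have W0 : 0 <= W by exact: sumr_ge0.
pose s := \sum_i \sum_j `|sigma i j|.
have s0 : 0 <= s by apply: sumr_ge0 => i _; exact: sumr_ge0.
pose v0 (m : 'I_M) := W * ((kappa + 1) * (h * L) + kappa * (m.+1 == M)%:R) + w m.
have hL0 : 0 <= h * L by rewrite mulr_ge0// ltW.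
have v00 m : 0 <= v0 m.
  by rewrite /v0 addr_ge0// mulr_ge0// addr_ge0// mulr_ge0// addr_ge0.
pose grid xi := euler_grid b sigma h M y xi.
have stab xi xi' : (forall j, xi j 0%N = xi' j 0%N) ->
    `|Phi (grid xi) - Phi (grid xi')| <=
    K * \sum_(j < n) \sum_(m < M) v0 m * enorm (sigma *m (xi j m.+1 - xi' j m.+1)).
  move=> xi0; apply: (le_trans (PhiK _ _)); rewrite ler_wpM2l//.
  exact: (euler_grid_stable sigma alpha_gt0 L_gt0 b_contr b_lip h0 h1 h2 l_gt0 hM y n w0 xi0).
pose f (x : 'I_d -> 'I_n -> 'I_M -> R) := Phi (grid (path_of_block x)).
pose th (m : 'I_M) := m.+1%:R * h.
have thl m : 0 <= th m <= l.
  by rewrite mulr_ge0//= /th -hM mulrC ler_wpM2l// ler_nat.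
pose v (m : 'I_M) := K * s * v0 m.
have vge0 m : 0 <= v m by rewrite /v !mulr_ge0.
have fv x x' : `|f x - f x'| <=
    \sum_(i < d) \sum_(j < n) \sum_(m < M) v m * `|x i j m - x' i j m|.
  apply: (le_trans (stab _ _ _)) => //.
  rewrite [leRHS]exchange_big mulr_sumr; apply: ler_sum => j _.
  rewrite [leRHS]exchange_big mulr_sumr; apply: ler_sum => m _.
  rewrite -mulr_sumr /v -!mulrA ler_wpM2l// mulrCA ler_wpM2l//.
  apply: (le_trans (enorm_mulmx _ _)); rewrite -/s ler_wpM2l//.
  by apply: ler_sum => i _; rewrite !path_of_blockE !mxE.
(* The stability estimate with right-hand side 0: [Phi] sees only blocks j < n and offsets up to M,
   where both noises coincide. *)
have FE om : F om = f (block_increment B l th om).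
  apply/eqP; rewrite -subr_eq0 -normr_le0; apply: (le_trans (stab _ _ _)).
    by move=> j; rewrite /block_noise mul0r addr0 subrr.
  rewrite big1 ?mulr0// => j _; rewrite big1// => m _.
  rewrite path_of_blockE (_ : block_noise _ _ _ _ = \col_i block_increment B l th om i j m).
    by rewrite subrr mulmx0 enorm0 mulr0.
  by apply/matrixP => i k; rewrite ord1 !mxE.
split.
  rewrite (_ : F = fun om => f (fun i j m => block_increment B l th om (i, j, m).1.1 (i, j, m).1.2 (i, j, m).2));
    last exact/funext.
  apply: (@lipschitz_measurable _ _ _ ('I_d * 'I_n * 'I_M)%type
    (fun k om => block_increment B l th om k.1.1 k.1.2 k.2)
    (fun x => f (fun i j m => x (i, j, m))) (\sum_m v m)) => [[[i j] m]|x x'].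
    have jl0 : 0 <= j%:R * l by rewrite mulr_ge0// ltW.
    apply: measurable_funB; apply: (fbm_measurable (fB.1 i)) => //.
    by rewrite addr_ge0//; have /andP[] := thl m.
  apply: (le_trans (fv _ _)).
  rewrite pair_bigA pair_bigA/= mulr_sumr.
  apply: ler_sum => -[[i j] m] _ /=; rewrite ler_wpM2r//.
  by rewrite (bigD1 m)//= lerDl sumr_ge0.
have := fbm_concentration H0 H1 fB l_gt0 thl vge0 fv.
rewrite (eq_integral (fun om => (expR (F om))%:E)); last by move=> om _; rewrite FE.
rewrite [X in (_ * X <= _)%E -> _](eq_integral (fun om => (expR (- F om))%:E)); last first.
  by move=> om _; rewrite FE.
move=> hle; apply: (le_trans hle); rewrite lee_fin ler_expR le_eqVlt; apply/orP; left; apply/eqP.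
(* The M weights h L add up to l L and the indicator of m + 1 = M to 1, so the total is W ((kappa +
   1) l L + kappa) + W up to the factor K s. *)
have -> : \sum_m v m = K * s * (W * ((kappa + 1) * (l * L + 1))).
  rewrite -mulr_sumr; congr (_ * _); rewrite /v0 big_split/= -mulr_sumr -/W.
  rewrite big_split/= sumr_const card_ord -mulr_sumr.
  have -> : \sum_(m < M) (m.+1 == M)%:R = 1 :> R.
    case: (M) M0 => // k _; rewrite big_ord_recr/= eqxx big1 ?add0r// => i _.
    by rewrite eqSS ltn_eqF.
  rewrite -mulr_natr -mulrA -[h * L * _]mulrA (mulrC L) [h * _]mulrA hM.
  ring.
rewrite /euler_constant -/s -/W (_ : 2 + 2 / (alpha * l) = kappa + 1); last by rewrite /kappa; ring.
ring.
Qed.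

End euler_concentration.

(** * Pathwise convergence of the Euler scheme *)

Section heine.
Context {R : realType}.

Lemma within_continuous_dist (f : R -> R) (A : set R) (x e : R) :
  {within A, continuous f} -> A x -> 0 < e ->
  exists2 r, 0 < r & forall y, A y -> `|x - y| < r -> `|f x - f y| < e.
Proof.
move=> /subspace_continuousP/(_ x) cf Ax e0; have := cf Ax.
move=> /cvgrPdist_lt/(_ _ e0); rewrite near_withinE => -[r /= r0 hr].
by exists r => // y Ay xy; apply: hr.
Qed.

(** Compactness in its near-covering form: if r is a modulus at x for e/2, then r/2 works for all
    points within r/2 of x. *)
Lemma heine (f : R -> R) (a b e : R) : {within `[a, b], continuous f} -> 0 < e ->
  exists2 r, 0 < r & forall x y, x \in `[a, b] -> y \in `[a, b] ->
    `|x - y| < r -> `|f x - f y| < e.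
Proof.
move=> cf e0; have := @segment_compact R a b; rewrite compact_near_coveringP.
move=> /(_ R (0^'+) (fun r x => x \in `[a, b] -> forall y, y \in `[a, b] ->
    `|x - y| < r -> `|f x - f y| < e) _).
case=> [x xab|r /= r0 hr].
  have [r r0 hr] := within_continuous_dist cf xab (ltac:(by rewrite divr_gt0) : 0 < e / 2).
  exists (ball x (r / 2), [set s | s < r / 2]); first split => /=.
  - by apply: nbhsx_ballx; rewrite divr_gt0.
  - exact: (nbhs_right_lt (ltac:(by rewrite divr_gt0) : 0 < r / 2)).
  move=> [x' s] /= [xx' sr] x'ab y yab x'y.
  have h1 : `|f x - f x'| < e / 2.
    by apply: hr => //; apply: lt_trans xx' _; lra.
  have h2 : `|f x - f y| < e / 2.
    apply: hr => //; rewrite -[x - y](subrKA x'); apply: le_lt_trans (ler_normD _ _) _.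
    by move: xx'; rewrite /ball/= => xx'; lra.
  rewrite -[f x' - f y](subrKA (f x)); apply: le_lt_trans (ler_normD _ _) _.
  by rewrite distrC; lra.
have r20 : 0 < r / 2 by rewrite divr_gt0.
exists (r / 2) => // x y xab yab xy.
apply: (hr (r / 2)) => //=.
by rewrite sub0r normrN gtr0_norm//; lra.
Qed.

Lemma heine_finite (I : finType) (f : I -> R -> R) (a b e : R) :
  (forall i, {within `[a, b], continuous (f i)}) -> 0 < e ->
  exists2 r, 0 < r & forall i x y, x \in `[a, b] -> y \in `[a, b] ->
    `|x - y| < r -> `|f i x - f i y| < e.
Proof.
move=> cf e0.
have /choice[r hr] : forall i, exists r, 0 < r /\ forall x y, x \in `[a, b] -> y \in `[a, b] ->
    `|x - y| < r -> `|f i x - f i y| < e.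
  by move=> i; have [r r0 hr] := heine (cf i) e0; exists r.
exists (\big[Num.min/1]_i r i).
  by elim/big_ind : _ => // [u v u0 v0|i _]; [rewrite lt_min u0|have [] := hr i].
move=> i x y xI yI xy; have [_] := hr i; apply => //.
by apply: lt_le_trans xy _; rewrite (bigD1 i)//= ge_min lexx.
Qed.

End heine.

Section euler_convergence.
Context {R : realType} {d : nat}.
Variables (b : 'cV[R]_d -> 'cV[R]_d) (sigma : 'M[R]_d).
Hypothesis b_cont : continuous b.
Variables (alpha L : R).
Hypotheses (alpha_gt0 : 0 < alpha) (L_gt0 : 0 < L).
Hypothesis b_contr : forall y z : 'cV[R]_d,
  dotp (b y - b z) (y - z) <= - alpha * enorm (y - z) ^+ 2.
Hypothesis b_lip : forall y z : 'cV[R]_d, enorm (b y - b z) <= L * enorm (y - z).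
Variables (l : R).
Hypothesis (l_gt0 : 0 < l).
Variables (x : 'cV[R]_d) (B Y : R -> 'cV[R]_d).
Hypothesis cY : {within `[0, +oo[, continuous Y}.
Hypothesis eqY : forall t, 0 <= t ->
  Y t = x + \col_i \int[lebesgue_measure]_(s in `[0, t]) (b (Y s) i 0) + sigma *m B t.
Hypothesis B00 : B 0 = 0.
Local Notation mu := (@lebesgue_measure R).

Lemma within_continuous_coord (Z : R -> 'cV[R]_d) (A : set R) i :
  {within A, continuous Z} -> {within A, continuous (fun t => Z t i 0)}.
Proof.
move=> cZ t; apply: (@continuous_comp _ _ _ (Z : subspace A -> _) (fun v : 'cV[R]_d => v i 0)).
  exact: cZ.
exact: coord_continuous.
Qed.

Let beta i t := b (Y t) i 0.

Let cbeta i T : {within `[0, T], continuous (beta i)}.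
Proof.
have sub : `[0, T] `<=` `[(0 : R), +oo[.
  by move=> t /=; rewrite !in_itv/= => /andP[-> _].
apply: (continuous_subspaceW sub); apply: within_continuous_coord => t.
apply: (@continuous_comp _ _ _ (Y : subspace _ -> _) b); first exact: cY.
exact: b_cont.
Qed.

Let ibeta i T : mu.-integrable `[0, T] (EFin \o beta i).
Proof. by apply: continuous_compact_integrable; [exact: segment_compact|exact: cbeta]. Qed.

(** Local error of one Euler step: the drift integral over []t, t + h]] is compared with h b(Y_t)
    through the modulus of continuity of s -> b(Y_s). *)
Lemma solution_increment (T eta delta t h : R) (i : 'I_d) :
  (forall s u, s \in `[0, T] -> u \in `[0, T] -> `|s - u| < delta ->
     `|beta i s - beta i u| < eta) ->
  0 <= t -> 0 <= h -> h < delta -> t + h <= T ->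
  `|(Y (t + h) - Y t - sigma *m (B (t + h) - B t) - h *: b (Y t)) i 0| <= h * eta.
Proof.
move=> mod t0 h0 hd tT.
have th0 : 0 <= t + h by rewrite addr_ge0.
have -> : (Y (t + h) - Y t - sigma *m (B (t + h) - B t) - h *: b (Y t)) i 0 =
  \int[mu]_(s in `[0, t + h]) beta i s - \int[mu]_(s in `[0, t]) beta i s - h * beta i t.
  rewrite -[beta i t]/(b (Y t) i 0); move: (b (Y t)) => c.
  rewrite (eqY th0) (eqY t0) mulmxBr.
  by move: (sigma *m B (t + h)) (sigma *m B t) => u v; rewrite !mxE /beta; ring.
rewrite Rintegral_itvB//; last by rewrite bnd_simp lerDl.
have ib : mu.-integrable `]t, (t + h)] (EFin \o beta i).
  apply: integrableS (ibeta i (t + h)) => //.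
  by move=> s /=; rewrite !in_itv/= => /andP[ts ->]; rewrite andbT (le_trans t0)// ltW.
have mh : mu `]t, (t + h)] = h%:E.
  rewrite lebesgue_measure_itv/= lte_fin ltrDl; case: ltP => h1.
    by rewrite -EFinB addrAC subrr add0r.
  by congr EFin; apply/eqP; rewrite eq_le h0 h1.
have ic c : mu.-integrable `]t, (t + h)] (EFin \o cst c).
  apply/integrableP; split; first exact/measurable_EFinP.
  by rewrite /= integral_cst//= [X in (_ * X)%E]mh ltry.
have Ic c : (\int[mu]_(s in `]t, (t + h)]) cst c s)%R = h * c.
  rewrite Rintegral_cst//; transitivity (c * fine (h%:E)); last by rewrite mulrC.
  by rewrite -mh.
have ibc : mu.-integrable `]t, (t + h)] (EFin \o (fun s => beta i s - beta i t)).
  rewrite (_ : _ \o _ = (fun s => (EFin \o beta i) s - (EFin \o cst (beta i t)) s)%E)//.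
  by apply: integrableB => //; exact: ic.
rewrite -(Ic (beta i t)) -RintegralB//.
apply: (le_trans (le_normr_Rintegral _ _)) => //.
rewrite -(Ic eta); apply: le_Rintegral => //.
- exact: (integrable_norm ibc).
- move=> s /=; rewrite in_itv/= => /andP[ts st]; apply/ltW/mod.
  + by rewrite in_itv/= (le_trans t0 (ltW ts)) (le_trans st tT).
  + by rewrite in_itv/= t0 (le_trans _ tT)// lerDl.
  + by rewrite gtr0_norm ?subr_gt0//; move: hd st; lra.
Qed.

Let noise (M j m : nat) : 'cV[R]_d :=
  B (j%:R * l + m%:R * (l / M%:R)) - B (j%:R * l).

(** A step does not expand the error and adds at most d h eta to it. The global error over the n M
    steps is thus at most d n M h eta = d T eta, without any Gronwall factor. *)
Lemma euler_converges (n : nat) (e : R) : 0 < e ->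
  exists2 h0 : R, 0 < h0 & forall M, (0 < M)%N -> l / M%:R < h0 ->
    forall j m, (j < n)%N -> (m <= M)%N ->
    enorm (euler_grid b sigma (l / M%:R) M x (noise M) j m -
           Y (j%:R * l + m%:R * (l / M%:R))) <= e.
Proof.
move=> e0; pose T := n%:R * l.
have T0 : 0 <= T by rewrite mulr_ge0// ltW.
(* Chosen so that d T eta <= e; the 1 keeps the denominator positive when d T = 0. *)
pose eta := e / (d%:R * T + 1).
have den : 0 < d%:R * T + 1 by rewrite ltr_wpDl// mulr_ge0.
have eta0 : 0 < eta by rewrite divr_gt0.
have [delta delta0 mod] := heine_finite (fun i => cbeta (i := i) (T := T)) eta0.
(* The step must respect the modulus of continuity and the two conditions alpha h <= 1 and L^2 h <=
   alpha of the contraction estimate. *)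
exists (Num.min delta (Num.min (alpha^-1) (alpha / L ^+ 2))).
  by rewrite !lt_min delta0 invr_gt0 alpha_gt0 divr_gt0 ?exprn_gt0.
move=> M M0; rewrite !lt_min => /andP[hdelta /andP[ha hL]].
set h := l / M%:R in hdelta ha hL *.
have h0 : 0 <= h by rewrite divr_ge0// ltW.
have h1 : alpha * h <= 1 by rewrite -ler_pdivlMl// mulr1 ltW.
have h2 : L ^+ 2 * h <= alpha by rewrite -ler_pdivlMl ?exprn_gt0// mulrC ltW.
have hM : M%:R * h = l by rewrite /h mulrC divfK// pnatr_eq0 -lt0n.
pose tm j m : R := j%:R * l + m%:R * h.
have tm0 j m : 0 <= tm j m by rewrite addr_ge0// mulr_ge0// ltW.
have tmS j m : tm j m.+1 = tm j m + h by rewrite /tm -natr1; ring.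
have tmT j m : (j < n)%N -> (m <= M)%N -> tm j m <= T.
  move=> jn mM; apply: (@le_trans _ _ (j.+1%:R * l)).
    by rewrite /tm -natr1 mulrDl mul1r lerD2l -hM ler_wpM2r// ler_nat.
  by rewrite ler_wpM2r ?(ltW l_gt0)// ler_nat.
pose V j m := euler_block b sigma h (euler_start b sigma h M x (noise M) j) (noise M j) m.
have dh0 : 0 <= d%:R * (h * eta) by rewrite mulr_ge0// mulr_ge0// ltW.
have step j m : (j < n)%N -> (m < M)%N ->
    enorm (V j m.+1 + sigma *m noise M j m.+1 - Y (tm j m.+1)) <=
    enorm (V j m + sigma *m noise M j m - Y (tm j m)) + d%:R * (h * eta).
  move=> jn mM.
  set r := Y (tm j m + h) - Y (tm j m) - sigma *m (B (tm j m + h) - B (tm j m)) - h *: b (Y (tm j m)).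
  have -> : V j m.+1 + sigma *m noise M j m.+1 - Y (tm j m.+1) =
    (V j m + sigma *m noise M j m - Y (tm j m) +
      h *: (b (V j m + sigma *m noise M j m) - b (Y (tm j m)))) - r.
    rewrite /V/= -/(V j m) /r tmS.
    have -> : sigma *m (B (tm j m + h) - B (tm j m)) = sigma *m noise M j m.+1 - sigma *m noise M j m.
      by rewrite -mulmxBr /noise -!/(tm _ _) -/h -/(tm j m.+1) -/(tm j m) tmS opprB addrA subrK.
    apply/matrixP => i k; rewrite !mxE; ring.
  apply: (le_trans (enormB _ _)); apply: lerD.
    apply: (le_trans (euler_step_contraction L_gt0 b_contr b_lip h0 h1 h2 _ _)).
    apply: ler_piMl; first exact: enorm_ge0.
    by have : 0 <= alpha * h by [exact: mulr_ge0 (ltW alpha_gt0) h0]; lra.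
  apply: (le_trans (enorm_le_sum _)).
  apply: (@le_trans _ _ (\sum_(i < d) h * eta)); last by rewrite sumr_const card_ord mulr_natl.
  apply: ler_sum => i _; apply: (@solution_increment T eta delta) => //.
    exact: mod.
  by rewrite -tmS tmT.
have blk j m : (j < n)%N -> (m <= M)%N ->
    enorm (V j m + sigma *m noise M j m - Y (tm j m)) <=
    enorm (euler_start b sigma h M x (noise M) j - Y (j%:R * l)) + m%:R * (d%:R * (h * eta)).
  move=> jn; elim: m => [_|m IHm mM].
    by rewrite /tm /noise !mul0r !addr0 subrr mulmx0 addr0.
  apply: (le_trans (step j m jn mM)); rewrite -natr1 mulrDl mul1r addrA lerD2r.
  exact: IHm (ltnW mM).
have start j : (j <= n)%N ->
    enorm (euler_start b sigma h M x (noise M) j - Y (j%:R * l)) <= j%:R * (M%:R * (d%:R * (h * eta))).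
  elim: j => [_|j IHj jn].
    rewrite !mul0r /= (eqY (lexx 0)) B00 mulmx0 addr0.
    rewrite (_ : \col_i _ = 0) ?addr0 ?subrr ?enorm0//.
    by apply/matrixP => i k; rewrite !mxE set_itv1 Rintegral_set1.
  have := blk j M jn (leqnn M); rewrite /V/=.
  rewrite (_ : tm j M = j.+1%:R * l); last by rewrite /tm hM -natr1; ring.
  move=> hb; apply: (le_trans hb); rewrite -natr1 mulrDl mul1r lerD2r.
  exact: IHj (ltnW jn).
move=> j m jn mM; apply: (le_trans (blk j m jn mM)).
apply: (le_trans (lerD (start j (ltnW jn)) (lexx _))).
apply: (@le_trans _ _ (j.+1%:R * (M%:R * (d%:R * (h * eta))))).
  by rewrite -natr1 mulrDl mul1r lerD2l ler_wpM2r// ler_nat.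
apply: (@le_trans _ _ (n%:R * (M%:R * (d%:R * (h * eta))))).
  by rewrite ler_wpM2r ?ler_nat//; exact: mulr_ge0.
rewrite (_ : _ * _ = d%:R * T * eta); last by rewrite /T -hM; ring.
by rewrite /eta mulrA ler_pdivrMr// mulrC ler_wpM2l ?(ltW e0)// lerDl.
Qed.

End euler_convergence.

(** * Passage to the limit *)

Section fatou_product.
Context {R : realType} disp (T : measurableType disp) (P : probability T R).

Lemma integral_expR_gt0 (F : T -> R) : measurable_fun setT F ->
  (0 < \int[P]_w (expR (F w))%:E)%E.
Proof.
move=> mF; rewrite lt0e integral_ge0 ?andbT; last by move=> w _; rewrite lee_fin expR_ge0.
apply/eqP => h0.
have m1 : measurable_fun setT (fun w => (expR (F w))%:E).
  by apply/measurable_EFinP; apply: measurableT_comp.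
have : (\int[P]_w `|(expR (F w))%:E| = 0)%E.
  by rewrite -h0; apply: eq_integral => w _; rewrite gee0_abs// lee_fin expR_ge0.
move=> /(ae_eq_integral_abs P measurableT m1)[N [mN PN0 hN]].
have NT : [set: T] `<=` N.
  apply: subset_trans hN => w _ /=; move=> /(_ I) [] h.
  by have := expR_gt0 (F w); rewrite h ltxx.
have : (P setT <= P N)%E by apply: le_measure; rewrite ?inE.
by rewrite PN0 probability_setT leNgt lte_fin ltr01.
Qed.

Lemma fatou_ae (f_ : nat -> T -> \bar R) (f : T -> \bar R) :
  (forall n, measurable_fun setT (f_ n)) -> measurable_fun setT f ->
  (forall n w, 0 <= f_ n w)%E -> (forall w, 0 <= f w)%E ->
  {ae P, forall w, f_ ^~ w @ \oo --> f w} ->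
  (\int[P]_w f w <= limn_einf (fun n => \int[P]_w f_ n w))%E.
Proof.
move=> mf_ mf f_0 f0 [N [mN PN0 hN]].
have mNC : measurable (~` N) by exact: measurableC.
have cutN g : measurable_fun setT g -> (forall w, 0 <= g w)%E ->
    (\int[P]_w g w = \int[P]_(w in ~` N) g w)%E.
  by move=> mg g0; rewrite (@ge0_negligible_integral _ _ _ P setT N)// setTD.
rewrite cutN// (_ : (fun n => _) = (fun n => \int[P]_(w in ~` N) f_ n w)%E); last first.
  by apply/funext => n; exact: cutN.
apply: le_trans (@fatou _ _ _ P (~` N) mNC f_ _ _) => //; last by move=> n; exact: measurable_funTS.
rewrite le_eqVlt; apply/orP; left; apply/eqP; apply: eq_integral => w.
rewrite inE => Nw; have cvw : f_ ^~ w @ \oo --> f w by apply: contrapT => h; exact/Nw/hN.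
by have [-> _] := cvg_limn_einf_sup cvw.
Qed.

(** The product of the tail infima is at most a n times b n, and it converges because positivity of
    both limits excludes the indeterminate product of 0 and infinity. *)
Lemma limn_einf_mul_le (a b : nat -> \bar R) (A B C : \bar R) :
  (forall n, 0 <= a n)%E -> (forall n, 0 <= b n)%E -> (0 < A)%E -> (0 < B)%E ->
  (A <= limn_einf a)%E -> (B <= limn_einf b)%E -> (forall n, a n * b n <= C)%E ->
  (A * B <= C)%E.
Proof.
move=> a0 b0 A0 B0 Aa Bb abC.
have la : (0 < limn_einf a)%E by exact: lt_le_trans Aa.
have lb : (0 < limn_einf b)%E by exact: lt_le_trans Bb.
apply: (@le_trans _ _ (limn_einf a * limn_einf b)%E).
  by apply: lee_pmul => //; exact: ltW.
move: la lb; rewrite !limn_einf_lim => la lb.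
have ca := @is_cvg_einfs R a; have cb := @is_cvg_einfs R b.
have e0 (u : nat -> \bar R) n : (forall n, 0 <= u n)%E -> (0 <= einfs u n)%E.
  by move=> u0; apply: le_ereal_inf_tmp => _ [k _ <-].
have eu (u : nat -> \bar R) n : (einfs u n <= u n)%E.
  by apply: ereal_inf_lbound; exists n => /=.
have cab : (fun n => einfs a n * einfs b n)%E @ \oo --> (limn (einfs a) * limn (einfs b))%E.
  apply: cvgeM => //; rewrite mule_defE (gt_eqF la) (gt_eqF lb) //.
rewrite -(cvg_lim (@ereal_hausdorff R) cab); apply: lime_le; first by apply/cvg_ex; eexists; exact: cab.
apply: nearW => n; apply: le_trans (abC n); apply: lee_pmul; [exact: e0|exact: e0|exact: eu|exact: eu].
Qed.

Lemma fatou_product (F_ : nat -> T -> R) (F : T -> R) (C : \bar R) :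
  (forall n, measurable_fun setT (F_ n)) -> measurable_fun setT F ->
  {ae P, forall w, F_ ^~ w @ \oo --> F w} ->
  (forall n, \int[P]_w (expR (F_ n w))%:E * \int[P]_w (expR (- F_ n w))%:E <= C)%E ->
  (\int[P]_w (expR (F w))%:E * \int[P]_w (expR (- F w))%:E <= C)%E.
Proof.
move=> mF_ mF cvF hC.
have me (g : T -> R) : measurable_fun setT g -> measurable_fun setT (fun w => (expR (g w))%:E).
  by move=> mg; apply/measurable_EFinP; exact: measurableT_comp.
have mN (g : T -> R) : measurable_fun setT g -> measurable_fun setT (fun w => - g w).
  by move=> mg; exact: measurableT_comp.
apply: (limn_einf_mul_le _ _ _ _ _ _ hC).
- by move=> n; apply: integral_ge0 => w _; rewrite lee_fin expR_ge0.
- by move=> n; apply: integral_ge0 => w _; rewrite lee_fin expR_ge0.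
- exact: integral_expR_gt0.
- apply: integral_expR_gt0; exact: mN.
- apply: fatou_ae => [n|||w|].
  + exact: me.
  + exact: me.
  + by move=> n w; rewrite lee_fin expR_ge0.
  + by rewrite lee_fin expR_ge0.
  + move: cvF; apply: filterS => w cw.
    apply: cvg_EFin; first exact: nearW.
    exact: (continuous_cvg _ (@continuous_expR R (F w)) cw).
- apply: fatou_ae => [n|||w|].
  + by apply: me; exact: mN.
  + by apply: me; exact: mN.
  + by move=> n w; rewrite lee_fin expR_ge0.
  + by rewrite lee_fin expR_ge0.
  + move: cvF; apply: filterS => w cw.
    apply: cvg_EFin; first exact: nearW.
    by apply: (continuous_cvg _ (@continuous_expR R (- F w))); apply: cvgN.
Qed.

(* Jensen's inequality for [expR], from [1 + x <= expR x]. *)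
Lemma centered_of_product (F : T -> R) (C : R) :
  measurable_fun setT F ->
  (\int[P]_w (expR (F w))%:E * \int[P]_w (expR (- F w))%:E <= (expR C)%:E)%E ->
  P.-integrable setT (EFin \o F) /\
  (\int[P]_w (expR (F w - fine (\int[P]_w (F w)%:E)))%:E <= (expR C)%:E)%E.
Proof.
move=> mF.
have me (g : T -> R) : measurable_fun setT g -> measurable_fun setT (fun w => (expR (g w))%:E).
  by move=> mg; apply/measurable_EFinP; exact: measurableT_comp.
have mN (g : T -> R) : measurable_fun setT g -> measurable_fun setT (fun w => - g w).
  by move=> mg; exact: measurableT_comp.
have := integral_expR_gt0 mF; have := integral_expR_gt0 (mN _ mF).
(* Both integrals are positive and their product is finite, so neither is infinite. *)
case Ea : (\int[P]_w (expR (F w))%:E)%E => [a| |]//; case Eb : (\int[P]_w (expR (- F w))%:E)%E => [b| |]//;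
  rewrite ?lte_fin => b0 a0; rewrite ?gt0_muley ?gt0_mulye ?lte_fin// ?leye_eq//.
rewrite -EFinM lee_fin => abC.
have ie g : (\int[P]_w (expR (g w))%:E \is a fin_num)%E -> measurable_fun setT g ->
    P.-integrable setT (EFin \o (fun w => expR (g w))).
  move=> fg mg; apply/integrableP; split; first exact: me.
  rewrite (eq_integral (fun w => (expR (g w))%:E)); first by rewrite ltey_eq fg.
  by move=> w _; rewrite /= ger0_norm// expR_ge0.
have iF1 := ie F; rewrite Ea in iF1; have {}iF1 := iF1 isT mF.
have iF2 := ie (fun w => - F w); rewrite Eb in iF2; have {}iF2 := iF2 isT (mN _ mF).
have iF : P.-integrable setT (EFin \o F).
  apply: (le_integrable measurableT _ _ (integrableD measurableT iF1 iF2)).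
    exact/measurable_EFinP.
  move=> w _ /=; rewrite lee_fin [leRHS]ger0_norm ?addr_ge0 ?expR_ge0// ler_norml.
  have := expR_ge1Dx (F w); have := expR_ge1Dx (- F w).
  by have := expR_gt0 (F w); have := expR_gt0 (- F w); lra.
split => //; set m := fine _.
have Em : (\int[P]_w (F w)%:E = m%:E)%E by rewrite /m fineK//; exact: integrable_fin_num.
(* Integrating 1 + (m - F) <= exp (m - F), whose left-hand side has mean 1. Consequently E exp (F -
   m) = a exp (- m) <= a b. *)
have bm : 1 <= b * expR m.
  have i1 : P.-integrable setT (EFin \o cst (1 : R)) by exact: finite_measure_integrable_cst.
  have im : P.-integrable setT (EFin \o cst m) by exact: finite_measure_integrable_cst.
  have iI : P.-integrable setT (fun w => (EFin \o cst (1%R : R)) w + ((EFin \o cst m) w - (EFin \o F) w))%E.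
    by apply: integrableD => //; exact: integrableB.
  rewrite -lee_fin EFinM -Eb muleC -ge0_integralZl//; last exact/me/mN.
  have -> : (1%:E = \int[P]_w (1 + (m%:E - (F w)%:E)))%E.
    rewrite (@integralD _ _ _ P setT measurableT (EFin \o cst 1) (fun w => m%:E - (F w)%:E)%E i1); last first.
      exact: (integrableB measurableT im iF).
    rewrite (@integralB _ _ _ P setT measurableT (EFin \o cst m) (EFin \o F) im iF) Em.
    have ic (c : R) : (\int[P]_w (EFin \o cst c) w = c%:E)%E.
      exact: integral_prob_cst.
    by rewrite !ic subee// adde0.
  apply: (le_integral measurableT).
  - exact iI.
  - exact: (integrableZl measurableT (expR m) iF2).
  - move=> w _; rewrite -EFinM -EFinB -EFinD lee_fin -expRD; exact: expR_ge1Dx.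
rewrite (eq_integral (fun w => (expR (- m))%:E * (expR (F w))%:E)%E); last first.
  by move=> w _; rewrite -EFinM -expRD addrC.
rewrite ge0_integralZl//; last exact: me.
rewrite Ea -EFinM lee_fin; apply: le_trans abC; rewrite expRN mulrC ler_pdivrMr ?expR_gt0// -mulrA.
by rewrite ler_peMr// ltW.
Qed.

End fatou_product.

Lemma sum_triple {R : realType} (d n M : nat) (f : 'I_d -> 'I_n -> 'I_M -> R) :
  \sum_(k : 'I_d * 'I_n * 'I_M) f k.1.1 k.1.2 k.2 =
  \sum_(j < n) \sum_(m < M) \sum_(i < d) f i j m.
Proof.
rewrite -(pair_bigA _ (fun ij m => f ij.1 ij.2 m))/= -(pair_bigA _ (fun i j => \sum_m f i j m))/=.
by rewrite exchange_big; apply: eq_bigr => j _; rewrite exchange_big.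
Qed.

(** * Functionals obtained as limits of functionals of sampled paths *)

Section grid_limit.
Context {R : realType} {d : nat}.
Variables (b : 'cV[R]_d -> 'cV[R]_d) (sigma : 'M[R]_d).
Hypothesis b_cont : continuous b.
Variables (alpha L : R).
Hypotheses (alpha_gt0 : 0 < alpha) (L_gt0 : 0 < L).
Hypothesis b_contr : forall y z : 'cV[R]_d,
  dotp (b y - b z) (y - z) <= - alpha * enorm (y - z) ^+ 2.
Hypothesis b_lip : forall y z : 'cV[R]_d, enorm (b y - b z) <= L * enorm (y - z).
Variables (H : R).
Hypotheses (H0 : 0 < H) (H1 : H < 1).
Variables (l : R).
Hypothesis (l_gt0 : 0 < l).
Context disp (Omega : measurableType disp) (P : probability Omega R).
Variables (B Y : R -> Omega -> 'cV[R]_d) (x : 'cV[R]_d).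
Hypothesis fB : is_fbm P H B.
Hypothesis solY : is_solution P b sigma x B Y.

Definition sampled_path (M : nat) (w : Omega) (j m : nat) : 'cV[R]_d :=
  Y (j%:R * l + m%:R * (l / M%:R)) w.

Lemma euler_converges_ae (n : nat) : {ae P, forall w, forall e, 0 < e ->
  \forall M \near \oo, forall j m, (j < n)%N -> (m <= M.+1)%N ->
    enorm (euler_grid b sigma (l / M.+1%:R) M.+1 x (block_noise l B M.+1 w) j m -
           sampled_path M.+1 w j m) <= e}.
Proof.
have [_ cY eqY] := solY; have [fB1 _] := fB.
have B0 : {ae P, forall w, forall i, B 0 w i 0 = 0}.
  by apply: filter_forall => i; exact: (fbm_start (fB1 i) H0).
apply: filterS2 B0 eqY => w B0w eqw e e0.
have Bw : B 0 w = 0 by apply/matrixP => i k; rewrite ord1 mxE B0w.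
have [h0 h00 hh] := @euler_converges R d b sigma b_cont alpha L alpha_gt0 L_gt0 b_contr b_lip
  l l_gt0 x (B ^~ w) (Y ^~ w) (cY w) eqw Bw n e e0.
have hl0 : 0 < h0 / l by rewrite divr_gt0.
have := near_infty_natSinv_lt (PosNum hl0); apply: filterS => M /= hM.
by apply: hh => //; rewrite mulrC -ltr_pdivlMr.
Qed.

Section grid_functional.
(** Common form of the two observation schemes: [F] is the limit of functionals [Phi M] of the
    values sampled with M steps per block, Lipschitz for weights whose total over a block is at most
    [W], uniformly in M. *)
Variables (n : nat) (K W : R) (wt : forall M, 'I_M -> R) (Phi : nat -> (nat -> nat -> 'cV[R]_d) -> R)
  (F : Omega -> R).
Hypotheses (K0 : 0 <= K) (wt0 : forall M m, 0 <= wt (M := M) m)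
  (wtW : forall M, \sum_m wt (M := M) m <= W).
Hypothesis PhiK : forall M u v, (0 < M)%N -> `|Phi M u - Phi M v| <=
     K * \sum_(j < n) \sum_(m < M) wt m * enorm (u j m.+1 - v j m.+1).
Hypothesis PhiF : forall w, (fun M => Phi M.+1 (sampled_path M.+1 w)) @ \oo --> F w.

Let mG M : measurable_fun setT (fun w => Phi M.+1 (sampled_path M.+1 w)).
Proof.
have [mY _ _] := solY.
pose X (k : 'I_d * 'I_n * 'I_M.+1) w := sampled_path M.+1 w k.1.2 k.2.+1 k.1.1 0.
pose f (y : 'I_d * 'I_n * 'I_M.+1 -> R) := Phi M.+1 (path_of_block (fun i j m => y (i, j, m))).
rewrite (_ : (fun w => _) = fun w => f (X ^~ w)); last first.
  apply/funext => w; apply/eqP; rewrite -subr_eq0 -normr_le0.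
  apply: (le_trans (PhiK _ _ _)) => //.
  rewrite big1 ?mulr0// => j _; rewrite big1// => m _.
  rewrite path_of_blockE (_ : \col_i _ = sampled_path M.+1 w j m.+1) ?subrr ?enorm0 ?mulr0//.
  by apply/matrixP => i k; rewrite ord1 mxE.
apply: (@lipschitz_measurable _ _ _ _ X f (K * W)) => [[[i j] m]|y y'].
  by apply: mY; rewrite addr_ge0// mulr_ge0 ?divr_ge0// ltW.
apply: (le_trans (PhiK _ _ _)) => //; rewrite -mulrA ler_wpM2l//.
rewrite (eq_bigr (fun k => `|y (k.1.1, k.1.2, k.2) - y' (k.1.1, k.1.2, k.2)|)); last by move=> [[i j] m].
rewrite (sum_triple (fun i j m => `|y (i, j, m) - y' (i, j, m)|)).
rewrite mulr_sumr; apply: ler_sum => j _; rewrite mulr_sumr; apply: ler_sum => m _.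
apply: ler_pM => //; first exact: enorm_ge0.
  by apply: le_trans (wtW M.+1); rewrite (bigD1 m)//= lerDl sumr_ge0.
apply: (le_trans (enorm_le_sum _)); apply: ler_sum => i _.
by rewrite !path_of_blockE !mxE.
Qed.

(** [Phi] on the Euler grid differs from [Phi] on the sampled path by at most K W n times the
    largest grid error, which vanishes almost surely. Measurability of [F] comes from the sampled
    paths, for which the convergence holds everywhere. *)
Theorem grid_concentration :
  measurable_fun setT F /\
  (\int[P]_w (expR (F w))%:E * \int[P]_w (expR (- F w))%:E <=
    (expR (euler_constant sigma alpha L H l * (K * W) ^+ 2 * n%:R `^ Num.max (2 * H) 1))%:E)%E.
Proof.
have mF : measurable_fun setT F by apply: (measurable_fun_cvg mG) => w _; exact: PhiF.
split => //.
pose F_ M w := Phi M.+1 (euler_grid b sigma (l / M.+1%:R) M.+1 x (block_noise l B M.+1 w)).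
have W0 : 0 <= W by apply: le_trans (wtW 0); exact: sumr_ge0.
have cv : {ae P, forall w, F_ ^~ w @ \oo --> F w}.
  have := euler_converges_ae n; apply: filterS => w hw.
  rewrite -[F w]addr0 (_ : F_ ^~ w = (fun M => Phi M.+1 (sampled_path M.+1 w)) \+
    (fun M => F_ M w - Phi M.+1 (sampled_path M.+1 w))); last first.
    by apply/funext => M /=; rewrite addrC subrK.
  apply: cvgD; first exact: PhiF.
  apply/cvgrPdist_le => e e0.
  have den : 0 < K * W * n%:R + 1 by rewrite ltr_wpDl// !mulr_ge0.
  have := hw (e / (K * W * n%:R + 1)) (divr_gt0 e0 den).
  apply: filterS => M hM; rewrite sub0r normrN.
  apply: (le_trans (PhiK _ _ _)) => //.
  apply: (@le_trans _ _ (K * (n%:R * (W * (e / (K * W * n%:R + 1)))))).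
    rewrite ler_wpM2l//.
    apply: (@le_trans _ _ (\sum_(j < n) W * (e / (K * W * n%:R + 1)))); last first.
      by rewrite sumr_const card_ord mulr_natl.
    apply: ler_sum => j _.
    apply: (@le_trans _ _ (\sum_(m < M.+1) wt m * (e / (K * W * n%:R + 1)))); last first.
      by rewrite -mulr_suml ler_wpM2r// divr_ge0// ltW.
    by apply: ler_sum => m _; rewrite ler_wpM2l// hM.
  rewrite [leLHS](_ : _ = e * (K * W * n%:R) / (K * W * n%:R + 1)); last by move: (_^-1) => D; ring.
  by rewrite ler_pdivrMr// ler_wpM2l ?(ltW e0)// lerDl.
(* The Euler estimate holds only for small steps, so Fatou's lemma is applied to the sequence
   shifted by N. *)
have [N [hN1 hN2]] : exists N, (forall M, (N <= M)%N -> alpha * (l / M.+1%:R) <= 1) /\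
    (forall M, (N <= M)%N -> L ^+ 2 * (l / M.+1%:R) <= alpha).
  have p1 : 0 < (alpha * l)^-1 by rewrite invr_gt0 mulr_gt0.
  have p2 : 0 < alpha / (L ^+ 2 * l) by rewrite divr_gt0// mulr_gt0// exprn_gt0.
  have [N1 _ h1] := near_infty_natSinv_lt (PosNum p1).
  have [N2 _ h2] := near_infty_natSinv_lt (PosNum p2).
  exists (maxn N1 N2); split=> M; rewrite geq_max => /andP[M1 M2].
    have /ltW := h1 M M1; rewrite /= => h; rewrite mulrA -[leRHS](@mulfV _ (alpha * l)) ?gt_eqF ?mulr_gt0//.
    by rewrite ler_wpM2l// mulr_ge0// ltW.
  have /ltW := h2 M M2; rewrite /= ler_pdivlMr ?mulr_gt0 ?exprn_gt0//.
  by move=> h; apply: le_trans h; rewrite mulrA mulrC.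
have conc M : (N <= M)%N -> measurable_fun setT (F_ M) /\
  (\int[P]_w (expR (F_ M w))%:E * \int[P]_w (expR (- F_ M w))%:E <=
    (expR (euler_constant sigma alpha L H l * (K * W) ^+ 2 * n%:R `^ Num.max (2 * H) 1))%:E)%E.
  move=> NM.
  have [mFM hle] := @euler_concentration R d b sigma alpha L alpha_gt0 L_gt0 b_contr b_lip H H0 H1
    l l_gt0 _ Omega P B fB n M.+1 x _ K (Phi M.+1) isT (hN1 _ NM) (hN2 _ NM) K0 (@wt0 M.+1)
    (fun u v => @PhiK M.+1 u v isT).
  split => //; apply: (le_trans hle); rewrite lee_fin ler_expR ler_wpM2r ?powR_ge0//.
  rewrite ler_wpM2l//.
    exact: euler_constant_ge0.
  rewrite ler_pXn2r ?nnegrE ?mulr_ge0//; first exact: ler_wpM2l.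
  exact: sumr_ge0.
apply: (@fatou_product _ _ _ P (fun M => F_ (M + N)%N)) => //.
- by move=> M; have [] := conc (M + N)%N (leq_addl _ _).
- move: cv; apply: filterS => w cw.
  by rewrite (cvg_shiftn N (F_ ^~ w)).
- by move=> M; have [] := conc (M + N)%N (leq_addl _ _).
Qed.

End grid_functional.
End grid_limit.

(** * Lipschitz norms and discrete observations *)

Section lipschitz_norm.
Context {R : realType} (E : Type) (A : set E) (dE : E -> E -> R) (F : E -> R).
Hypotheses (dE0 : forall x y, 0 <= dE x y) (lipF : is_lipschitz A dE F).

Let ratios := [set r | exists x y : E,
    [/\ A x, A y, x <> y & r = `|F x - F y| / dE x y]].

Let ratios_ub : has_ubound ratios.
Proof.
have [K hK] := lipF; exists (Num.max K 0) => _ [x [y [Ax Ay _ ->]]].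
have [d0|d0] := eqVneq (dE x y) 0; first by rewrite d0 invr0 mulr0 le_max lexx orbT.
rewrite ler_pdivrMr; last by rewrite lt0r d0 dE0.
by apply: (le_trans (hK x y Ax Ay)); rewrite ler_wpM2r// le_max lexx.
Qed.

Lemma lip_norm_ge0 : 0 <= lip_norm A dE F.
Proof.
rewrite /lip_norm -/ratios.
have [r0|/set0P[r rr]] := eqVneq ratios set0; first by rewrite r0 sup0.
apply: (@le_trans _ _ r); last exact: ub_le_sup.
by case: rr => x [y [_ _ _ ->]]; rewrite divr_ge0.
Qed.

(** Two distinct points at distance 0 contribute the ratio 0 to the supremum, as division by 0 gives
    0; for them the Lipschitz property itself gives F x = F y. *)
Lemma lip_norm_le x y : A x -> A y -> `|F x - F y| <= lip_norm A dE F * dE x y.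
Proof.
move=> Ax Ay; have [->|xy] := pselect (x = y).
  by rewrite subrr normr0 mulr_ge0// lip_norm_ge0.
have [K hK] := lipF; have [d0|d0] := eqVneq (dE x y) 0.
  by have := hK x y Ax Ay; rewrite d0 !mulr0.
rewrite -ler_pdivrMr; last by rewrite lt0r d0 dE0.
by apply: ub_le_sup => //; exists x, y.
Qed.

End lipschitz_norm.

Lemma scaled_concentration {R : realType} disp (T : measurableType disp) (P : probability T R)
    (F : T -> R) (lambda C : R) : 0 < lambda ->
  measurable_fun setT (fun w => lambda * F w) ->
  (\int[P]_w (expR (lambda * F w))%:E * \int[P]_w (expR (- (lambda * F w)))%:E <= (expR C)%:E)%E ->
  P.-integrable setT (EFin \o F) /\
  ('E_P[fun w => expR (lambda * (F w - fine 'E_P[F]))] <= (expR C)%:E)%E.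
Proof.
move=> l0 mF hC.
have [iF hle] := centered_of_product mF hC.
have iF1 : P.-integrable setT (EFin \o F).
  have := @integrableZl _ _ _ P setT measurableT lambda^-1 _ iF.
  rewrite (_ : (fun x => _) = EFin \o F)//.
  by apply/funext => w /=; rewrite -EFinM mulrA mulVf ?gt_eqF// mul1r.
split => //; rewrite unlock; apply: le_trans hle.
rewrite le_eqVlt; apply/orP; left; apply/eqP; apply: eq_integral => w _ /=.
have -> : (\int[P]_w (lambda * F w)%:E = lambda%:E * \int[P]_w (F w)%:E)%E.
  by rewrite -integralZl.
by rewrite mulrBr fineM//; exact: integrable_fin_num.
Qed.

Section discrete_observations.
Context {R : realType} {d : nat}.
Variables (b : 'cV[R]_d -> 'cV[R]_d) (sigma : 'M[R]_d).
Hypothesis b_cont : continuous b.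
Variables (alpha L : R).
Hypotheses (alpha_gt0 : 0 < alpha) (L_gt0 : 0 < L).
Hypothesis b_contr : forall y z : 'cV[R]_d,
  dotp (b y - b z) (y - z) <= - alpha * enorm (y - z) ^+ 2.
Hypothesis b_lip : forall y z : 'cV[R]_d, enorm (b y - b z) <= L * enorm (y - z).
Variables (H : R).
Hypotheses (H0 : 0 < H) (H1 : H < 1).

(** With l = Delta, node M of block k is the observation time (k + 1) Delta for every M. The weight
    is therefore 1 on the last node of a block and 0 elsewhere, and the approximating sequence is
    constant. *)
Theorem discrete_concentration (Delta : R) : 0 < Delta ->
    exists C : R, 0 < C /\
      forall (disp : measure_display) (Omega : measurableType disp)
        (P : probability Omega R) (B Y : R -> Omega -> 'cV[R]_d)
        (x : 'cV[R]_d),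
      is_fbm P H B -> is_solution P b sigma x B Y ->
      forall (n : nat) (F : ('I_n -> 'cV[R]_d) -> R) (lambda : R),
      is_lipschitz setT (@dist_n R d n) F -> 0 < lambda ->
      let FY := fun w : Omega => F (fun k => Y (k.+1%:R * Delta) w) in
      P.-integrable setT (EFin \o FY) /\
      ('E_P[fun w => expR (lambda * (FY w - fine 'E_P[FY]))] <=
        (expR (C * lip_norm setT (@dist_n R d n) F ^+ 2 * lambda ^+ 2
               * n%:R `^ Num.max (2 * H) 1))%:E)%E.
Proof.
(* The added 1 makes the constant positive, since [euler_constant] vanishes for sigma = 0. *)
move=> D0; exists (euler_constant sigma alpha L H Delta + 1); split.
  by rewrite ltr_wpDl// euler_constant_ge0.
move=> disp Omega P B Y x fB solY n F lambda lipF lambda0 FY.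
have dn0 (u v : 'I_n -> 'cV[R]_d) : 0 <= dist_n u v by apply: sumr_ge0 => i _; exact: enorm_ge0.
set C := expR _.
pose lip := lip_norm setT (@dist_n R d n) F.
have lip0 : 0 <= lip by exact: lip_norm_ge0.
have [||M|M u v M0|w|mF hle] := @grid_concentration R d b sigma b_cont alpha L alpha_gt0 L_gt0
  b_contr b_lip H H0 H1 Delta D0 _ Omega P B Y x fB solY n (lambda * lip) 1
  (fun M m => (m.+1 == M)%:R) (fun M u => lambda * F (fun k => u k M)) (fun w => lambda * FY w).
- by rewrite mulr_ge0// ltW.
- by [].
- case: M => [|M]; first by rewrite big_ord0.
  by rewrite big_ord_recr/= eqxx big1 ?add0r// => i _; rewrite eqSS ltn_eqF.
- rewrite -mulrBr normrM gtr0_norm// -mulrA ler_wpM2l ?(ltW lambda0)//.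
  have := lip_norm_le dn0 lipF (x := fun k => u k M) (y := fun k => v k M) I I.
  move=> /le_trans; apply; rewrite -/lip ler_wpM2l//.
  apply: ler_sum => j _; case: M M0 => // M _.
  by rewrite big_ord_recr/= eqxx mul1r lerDr sumr_ge0// => m _; rewrite mulr_ge0 ?enorm_ge0.
- rewrite (_ : (fun M => _) = cst (lambda * FY w)); first exact: cvg_cst.
  apply/funext => M; congr (_ * F _); apply/funext => k; rewrite /sampled_path.
  congr (Y _ w); rewrite [M.+1%:R * _]mulrC divfK ?pnatr_eq0//.
  by rewrite -[in RHS]natr1 mulrDl mul1r.
apply: scaled_concentration => //; apply: (le_trans hle).
rewrite lee_fin ler_expR -/lip mulr1; set N := n%:R `^ _.
have q0 : 0 <= lip ^+ 2 * lambda ^+ 2 * N.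
  by apply: mulr_ge0; [apply: mulr_ge0; exact: sqr_ge0|exact: powR_ge0].
rewrite -subr_ge0 (_ : _ - _ = lip ^+ 2 * lambda ^+ 2 * N)//; ring.
Qed.

End discrete_observations.

(** * Interpolation of paths *)

Section within_continuity.
Context {R : realType} {d : nat}.
Implicit Types (A : set R) (x y : R -> 'cV[R]_d).

Lemma within_continuous_sum (I : Type) (r : seq I) (f : I -> R -> R) A :
  (forall i, {within A, continuous (f i)}) -> {within A, continuous (fun t => \sum_(i <- r) f i t)}.
Proof.
move=> cf; elim: r => [|i r IHr] t.
  rewrite (_ : (fun t => _) = cst 0); first exact: cst_continuous.
  by apply/funext => s; rewrite big_nil.
rewrite (_ : (fun t => _) = (fun t => f i t + \sum_(i <- r) f i t)).
  by apply: (@continuousD _ _ (subspace A)); [exact: cf|exact: IHr].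
by apply/funext => s; rewrite big_cons.
Qed.

Lemma within_continuous_col x A :
  (forall i, {within A, continuous (fun t => x t i 0)}) -> {within A, continuous x}.
Proof.
move=> cx t U [V Vx VU].
have : \forall s \near nbhs (t : subspace A), forall i : 'I_d, V i 0 (x s i 0).
  by apply: filter_forall => i; apply: cx; exact: Vx.
apply: filterS => s Vs; apply: VU => i j; rewrite ord1; exact: Vs.
Qed.

Lemma within_continuous_enormB x y A :
  {within A, continuous x} -> {within A, continuous y} ->
  {within A, continuous (fun t => enorm (x t - y t))}.
Proof.
move=> cx cy t; rewrite /enorm /dotp.
apply: (@continuous_comp (subspace A) _ _ (fun t => \sum_(i < d) (x t - y t) i 0 * (x t - y t) i 0) Num.sqrt);
  last exact: sqrt_continuous.
move: t; apply: within_continuous_sum => i t.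
have cc : {for t, continuous ((fun t => (x t - y t) i 0) : subspace A -> R)}.
  rewrite (_ : (fun t => _) = (fun t => x t i 0 - y t i 0)); last by apply/funext => s; rewrite !mxE.
  by apply: continuousB; exact: within_continuous_coord.
exact: continuousM.
Qed.

End within_continuity.

Section tents.
Context {R : realType}.
Implicit Types (h s t T : R) (k : nat).

(** The truncation of s to [0, 1], written with absolute values so that its continuity is
    immediate. *)
Definition clamp (s : R) : R := (1 + `|s| - `|s - 1|) / 2.

Lemma clamp_le0 s : s <= 0 -> clamp s = 0.
Proof. by move=> s0; rewrite /clamp !ler0_norm//; lra. Qed.

Lemma clamp_ge1 s : 1 <= s -> clamp s = 1.
Proof. by move=> s1; rewrite /clamp !ger0_norm//; lra. Qed.

Lemma clamp_le s s' : s <= s' -> clamp s <= clamp s'.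
Proof.
rewrite /clamp.
by case: (ger0P s); case: (ger0P s'); case: (ger0P (s - 1)); case: (ger0P (s' - 1)); lra.
Qed.

Lemma clamp_itv s : 0 <= clamp s <= 1.
Proof.
rewrite /clamp; apply/andP.
by case: (ger0P s); case: (ger0P (s - 1)); lra.
Qed.

(* [ramp s 0] is 1 instead of [clamp s]: there is no node at 0, so that the first
   tent must be 1 on the whole of [0, h]. *)
Definition ramp (s : R) (k : nat) : R := if k is 0%N then 1 else clamp (s - k%:R).

(** For k > 0, the hat function of the node (k + 1) h, which vanishes outside [k h, (k + 2) h]. *)
Definition tent (h : R) (k : nat) (t : R) : R := ramp (t / h) k - ramp (t / h) k.+1.

Lemma ramp_itv s k : 0 <= ramp s k <= 1.
Proof. by case: k => [|k]; [rewrite /= lexx ler01|exact: clamp_itv]. Qed.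

Lemma tent_itv h k t : 0 <= tent h k t <= 1.
Proof.
have /andP[r0 r1] := ramp_itv (t / h) k; have /andP[r2 r3] := ramp_itv (t / h) k.+1.
apply/andP; split; rewrite /tent; last lra.
rewrite subr_ge0; case: k {r0 r1 r2 r3} => [|k]; first by have /andP[] := ramp_itv (t / h) 1.
by apply: clamp_le; rewrite lerD2l lerN2 ler_nat.
Qed.

Lemma tent_eq0 h k t : 0 < h -> 0 <= t -> ~~ (k%:R * h <= t <= k.+2%:R * h) -> tent h k t = 0.
Proof.
move=> h0 t0; rewrite -ler_pdivlMr// -[t <= _]ler_pdivrMr// /tent; set s := t / h.
have s0 : 0 <= s by rewrite divr_ge0// ltW.
rewrite negb_and -!ltNge => /orP[sk|ks].
  case: k sk => [|k] sk; first by have := le_lt_trans s0 sk; rewrite ltxx.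
  rewrite /= !clamp_le0 ?subrr//; rewrite subr_le0 ltW//.
  by apply: (lt_le_trans sk); rewrite ler_nat.
rewrite /= (@clamp_ge1 (s - k.+1%:R)); last by move: ks; rewrite -(natr1 k.+1); lra.
case: k ks => [|k] ks; first by rewrite subrr.
rewrite /= clamp_ge1 ?subrr//; move: ks; rewrite -(natr1 k.+2) -(natr1 k.+1); lra.
Qed.

(** The tents form a partition of unity by telescoping: the first ramp is 1, and the last one
    vanishes up to the final node. *)
Lemma sum_tent h n M t : 0 < h -> (0 < n * M)%N -> t <= (n * M)%:R * h ->
  \sum_(j < n) \sum_(m < M) tent h (j * M + m) t = 1.
Proof.
move=> h0 nM0 tnM.
have tele (f : nat -> R) N : \sum_(i < N) (f i - f i.+1) = f 0%N - f N.
  elim: N => [|N IHN]; first by rewrite big_ord0 subrr.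
  by rewrite big_ord_recr/= IHN addrA subrK.
transitivity (\sum_(j < n) (ramp (t / h) (j * M) - ramp (t / h) (j.+1 * M))).
  apply: eq_bigr => j _; have := tele (fun m => ramp (t / h) (j * M + m)) M.
  rewrite /= addn0 addnC -mulSn => <-.
  by apply: eq_bigr => m _; rewrite /tent addnS.
rewrite (tele (fun j => ramp (t / h) (j * M))) mul0n /=.
case: (n * M)%N nM0 tnM => // k _ tk; rewrite /= clamp_le0 ?subr0//.
by rewrite subr_le0 ler_pdivrMr.
Qed.

Lemma continuous_tent h k : continuous (tent h k).
Proof.
have cc : continuous clamp.
  move=> s; apply: (@continuousM R R (fun s => 1 + `|s| - `|s - 1|) (cst 2^-1)); last exact: cst_continuous.
  apply: continuousB.
    apply: continuousD; [exact: cst_continuous|exact: norm_continuous].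
  apply: continuous_comp; last exact: norm_continuous.
  by apply: continuousB; [exact: id|exact: cst_continuous].
have cr j : continuous (fun t : R => ramp (t / h) j).
  case: j => [|j] t; first exact: cst_continuous.
  apply: (@continuous_comp _ _ _ (fun t : R => t / h - j.+1%:R) clamp t); last exact: cc.
  apply: continuousB; last exact: cst_continuous.
  by apply: continuousM; [exact: id|exact: cst_continuous].
by move=> t; rewrite /tent; apply: (@continuousB R R^o R (fun t => ramp (t / h) k) (fun t => ramp (t / h) k.+1)); exact: cr.
Qed.

Lemma Rintegral_tent h k T : 0 < h ->
  \int[lebesgue_measure]_(t in `[0, T]) tent h k t <= 2 * h.
Proof.
move=> h0; set I := `[k%:R * h, k.+2%:R * h].
have mI : measurable [set` I] by exact: measurable_itv.
have mh : lebesgue_measure [set` I] = (2 * h)%:E.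
  rewrite lebesgue_measure_itv/= lte_fin ltr_pM2r// ltr_nat ltnS leqnSn -EFinB -mulrBl.
  by congr ((_ * _)%:E); rewrite -(natr1 k.+1) -(natr1 k); ring.
have fI : (lebesgue_measure ([set` I] `&` `[0%R, T]) <= (2 * h)%:E)%E.
  by rewrite -mh; apply: le_measure; rewrite ?inE//; exact: measurableI.
have finI : lebesgue_measure ([set` I] `&` `[0%R, T]) \is a fin_num.
  by rewrite ge0_fin_numE// (le_lt_trans fI)// ltry.
have iT : lebesgue_measure.-integrable `[0%R, T] (EFin \o tent h k).
  apply: continuous_compact_integrable; first exact: segment_compact.
  by apply: continuous_subspaceT; exact: continuous_tent.
apply: (@le_trans _ _ (fine (lebesgue_measure ([set` I] `&` `[0%R, T])))); last first.
  by rewrite -[leRHS]/(fine (2 * h)%:E) fine_le.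
rewrite /Rintegral fine_le//; first exact: integrable_fin_num.
rewrite -integral_indic//; apply: ge0_le_integral => //.
- by move=> t _; rewrite lee_fin; have /andP[] := tent_itv h k t.
- by case/integrableP: iT.
- by apply/measurable_EFinP; apply: measurable_funTS.
- move=> t; rewrite /= in_itv/= lee_fin indicE => /andP[t0 _].
  have [tI|tI] := boolP (t \in I).
    by rewrite mem_set//; have /andP[] := tent_itv h k t.
  by rewrite (tent_eq0 h0 t0)//; move: tI; rewrite in_itv.
Qed.

End tents.

Section path_space.
Context {R : realType} {d : nat}.
Implicit Types (T : R) (x y : R -> 'cV[R]_d).

Lemma dist_T_ge0 T x y : 0 <= dist_T T x y.
Proof. by apply: Rintegral_ge0 => t _; exact: enorm_ge0. Qed.

Lemma path_onE T x t : t \in `[0, T] -> path_on T x t = x t.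
Proof. by move=> tT; rewrite /path_on /patch mem_set. Qed.

Lemma dist_T_path_on T x y : dist_T T (path_on T x) (path_on T y) = dist_T T x y.
Proof.
by apply: eq_Rintegral => t; rewrite inE => tT; rewrite !path_onE.
Qed.

Lemma Cpaths_path_on T x : {within `[0, T], continuous x} -> Cpaths T (path_on T x).
Proof.
move=> cx; split.
  apply: subspace_eq_continuous cx => t; rewrite inE => tT.
  by rewrite /from_subspace path_onE.
apply/funext => t; rewrite /path_on /patch.
by case: (t \in _).
Qed.

Lemma integrable_enormB T x y :
  {within `[0, T], continuous x} -> {within `[0, T], continuous y} ->
  lebesgue_measure.-integrable `[0, T] (EFin \o (fun t => enorm (x t - y t))).
Proof.
move=> cx cy; apply: continuous_compact_integrable; first exact: segment_compact.
exact: within_continuous_enormB.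
Qed.

Lemma Rintegral_sum_le (I : finType) T (f : I -> R -> R) (c : I -> R) :
  (forall i, {within `[0, T], continuous (f i)}) ->
  (forall i, \int[lebesgue_measure]_(t in `[0, T]) f i t <= c i) ->
  \int[lebesgue_measure]_(t in `[0, T]) (\sum_i f i t) <= \sum_i c i.
Proof.
move=> cf fc; elim: (index_enum I) => [|i r IHr].
  rewrite big_nil; under eq_Rintegral do rewrite big_nil.
  by rewrite Rintegral_cst// mul0r.
rewrite big_cons; under eq_Rintegral do rewrite big_cons.
rewrite RintegralD//; first exact: lerD.
  by apply: continuous_compact_integrable; [exact: segment_compact|exact: cf].
apply: continuous_compact_integrable; first exact: segment_compact.
exact: within_continuous_sum.
Qed.

End path_space.

Section interpolation.
Context {R : realType} {d : nat}.
Implicit Types (u v : nat -> nat -> 'cV[R]_d).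

(** Piecewise linear interpolation, where [u j m.+1] is the value at node number j M + m + 1; before
    the first node the path is constant. *)
Definition interpolation (h : R) (n M : nat) u (t : R) : 'cV[R]_d :=
  \sum_(j < n) \sum_(m < M) tent h (j * M + m) t *: u j m.+1.

Lemma interpolation_continuous h n M u (A : set R) :
  {within A, continuous (interpolation h n M u)}.
Proof.
apply: within_continuous_col => i.
rewrite (_ : (fun t => _) = (fun t => \sum_(j < n) \sum_(m < M) tent h (j * M + m) t * u j m.+1 i 0)); last first.
  apply/funext => t; rewrite /interpolation summxE; apply: eq_bigr => j _.
  by rewrite summxE; apply: eq_bigr => m _; rewrite mxE.
apply: within_continuous_sum => j; apply: within_continuous_sum => m.
apply: continuous_subspaceT => t; apply: continuousM; last exact: cst_continuous.
exact: continuous_tent.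
Qed.

Lemma dist_T_interpolation h n M u v T : 0 < h ->
  dist_T T (interpolation h n M u) (interpolation h n M v) <=
  \sum_(j < n) \sum_(m < M) 2 * h * enorm (u j m.+1 - v j m.+1).
Proof.
move=> h0.
pose g (j m : nat) t := tent h (j * M + m) t * enorm (u j m.+1 - v j m.+1).
have cg j m : {within `[0, T], continuous (g j m)}.
  apply: continuous_subspaceT => t; apply: continuousM; last exact: cst_continuous.
  exact: continuous_tent.
apply: (@le_trans _ _ (\int[lebesgue_measure]_(t in `[0, T]) (\sum_(j < n) \sum_(m < M) g j m t))).
  apply: le_Rintegral => //.
  - by apply: integrable_enormB; exact: interpolation_continuous.
  - apply: continuous_compact_integrable; first exact: segment_compact.
    by apply: within_continuous_sum => j; apply: within_continuous_sum => m; exact: cg.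
  - move=> t _; rewrite /interpolation -sumrB.
    apply: (le_trans (enorm_sum _ _)); apply: ler_sum => j _; rewrite -sumrB.
    apply: (le_trans (enorm_sum _ _)); apply: ler_sum => m _.
    rewrite -scalerBr enormZ ger0_norm//.
    by have /andP[] := tent_itv h (j * M + m) t.
apply: Rintegral_sum_le => j; first by apply: within_continuous_sum => m; exact: cg.
apply: Rintegral_sum_le => m; first exact: cg.
under eq_Rintegral do rewrite /g mulrC.
rewrite RintegralZl//.
  by rewrite mulrC ler_wpM2r ?enorm_ge0// Rintegral_tent.
apply: continuous_compact_integrable; first exact: segment_compact.
by apply: continuous_subspaceT; exact: continuous_tent.
Qed.

(** The difference at time t is a combination, with tent weights of sum 1, of the differences Y_node
    - Y_t. Only nodes closer to t than [delta] have a nonzero weight, so uniform continuity bounds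
    each coordinate of these by eta. *)
Lemma interpolation_converges (Y : R -> 'cV[R]_d) (n : nat) (l e : R) :
  0 < l -> (0 < n)%N -> {within `[0, n%:R * l], continuous Y} -> 0 < e ->
  \forall M \near \oo,
    dist_T (n%:R * l) (interpolation (l / M.+1%:R) n M.+1
      (fun j m => Y (j%:R * l + m%:R * (l / M.+1%:R)))) Y <= e.
Proof.
move=> l0 n0 cY e0; set T := n%:R * l.
have T0 : 0 < T by rewrite mulr_gt0// ltr0n.
pose eta := e / (d%:R * T + 1).
have den : 0 < d%:R * T + 1 by rewrite ltr_wpDl// mulr_ge0// ltW.
have eta0 : 0 < eta by rewrite divr_gt0.
have [delta delta0 mod] := heine_finite (fun i => within_continuous_coord cY (i := i)) eta0.
have dl0 : 0 < delta / (2 * l) by rewrite divr_gt0// mulr_gt0.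
have := near_infty_natSinv_lt (PosNum dl0); apply: filterS => M /= hM.
set h := l / M.+1%:R; set u := fun j m : nat => Y _.
have h0 : 0 < h by rewrite divr_gt0// ltr0n.
have hM1 : M.+1%:R * h = l by rewrite /h mulrC divfK// pnatr_eq0.
have h2 : 2 * h < delta by move: hM; rewrite ltr_pdivlMr ?mulr_gt0//; rewrite /h; move: (M.+1%:R^-1) => z; lra.
have TE : T = (n * M.+1)%:R * h by rewrite natrM -mulrA hM1.
apply: (@le_trans _ _ (\int[lebesgue_measure]_(t in `[0, T]) (cst (d%:R * eta) t))).
  apply: le_Rintegral => //.
  - by apply: integrable_enormB => //; exact: interpolation_continuous.
  - by apply: continuous_compact_integrable; [exact: segment_compact|exact: cst_continuous].
  move=> t /=; rewrite in_itv/= => /andP[t0 tT].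
  have w1 : \sum_(j < n) \sum_(m < M.+1) tent h (j * M.+1 + m) t = 1.
    by apply: sum_tent; rewrite -?TE// muln_gt0 n0.
  have -> : interpolation h n M.+1 u t - Y t =
      \sum_(j < n) \sum_(m < M.+1) tent h (j * M.+1 + m) t *: (u j m.+1 - Y t).
    rewrite -[Y t in LHS]scale1r -w1 scaler_suml -sumrB; apply: eq_bigr => j _.
    by rewrite scaler_suml -sumrB; apply: eq_bigr => m _; rewrite scalerBr.
  have [c cE] : exists c, c = d%:R * eta by exists (d%:R * eta).
  rewrite -cE -[c]mul1r -w1 mulr_suml.
  apply: (le_trans (enorm_sum _ _)); apply: ler_sum => j _; rewrite mulr_suml.
  apply: (le_trans (enorm_sum _ _)); apply: ler_sum => m _.
  have /andP[th0 _] := tent_itv h (j * M.+1 + m) t.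
  rewrite enormZ ger0_norm//.
  have [tI|tI] := boolP ((j * M.+1 + m)%:R * h <= t <= (j * M.+1 + m).+2%:R * h); last first.
    by rewrite tent_eq0// !mul0r.
  rewrite ler_wpM2l//; apply: (le_trans (enorm_le_sum _)).
  apply: (@le_trans _ _ (\sum_(i < d) eta)); last by rewrite cE sumr_const card_ord mulr_natl.
  apply: ler_sum => i _; rewrite !mxE; apply/ltW/mod; last 1 first.
  - rewrite (_ : j%:R * l + m.+1%:R * h = (j * M.+1 + m).+1%:R * h); last first.
      by rewrite -addnS natrD natrM -hM1; ring.
    move: tI h2 h0; rewrite -(natr1 (_ + _).+1) -(natr1 (_ + _)); move: ((_ + _)%:R) => z.
    by rewrite ltr_norml => /andP[z1 z2] z3 z4; apply/andP; split; lra.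
  - rewrite in_itv/= addr_ge0 ?mulr_ge0//; [|exact: ltW|exact: ltW].
    apply: (@le_trans _ _ (j.+1%:R * l)); last by rewrite ler_wpM2r ?(ltW l0)// ler_nat.
    by rewrite -[in leRHS]natr1 mulrDl mul1r lerD2l -hM1 ler_wpM2r ?(ltW h0)// ler_nat.
  - by rewrite in_itv/= t0.
rewrite Rintegral_cst//.
have -> : fine (lebesgue_measure `[0%R, T]) = T.
  by rewrite lebesgue_measure_itv/= lte_fin T0 -EFinB subr0.
rewrite (_ : d%:R * eta * T = e * (d%:R * T) / (d%:R * T + 1)); last first.
  by rewrite /eta; move: (_^-1) => z; ring.
by rewrite ler_pdivrMr// ler_wpM2l ?(ltW e0)// lerDl.
Qed.

End interpolation.

(** * Continuous observations *)

Section continuous_observations.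
Context {R : realType} {d : nat}.
Variables (b : 'cV[R]_d -> 'cV[R]_d) (sigma : 'M[R]_d).
Hypothesis b_cont : continuous b.
Variables (alpha L : R).
Hypotheses (alpha_gt0 : 0 < alpha) (L_gt0 : 0 < L).
Hypothesis b_contr : forall y z : 'cV[R]_d,
  dotp (b y - b z) (y - z) <= - alpha * enorm (y - z) ^+ 2.
Hypothesis b_lip : forall y z : 'cV[R]_d, enorm (b y - b z) <= L * enorm (y - z).
Variables (H : R).
Hypotheses (H0 : 0 < H) (H1 : H < 1).

(** Upper bound for [euler_constant] over block lengths l in [1, 2], whence a constant that does not
    depend on T. *)
Let C0 := d%:R * ((\sum_i \sum_j `|sigma i j|) * (2 + 2 / alpha) * (2 * L + 1)) ^+ 2
    * (3 * 2 `^ (2 * H)).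

Let euler_constant_le l : 1 <= l -> l <= 2 -> euler_constant sigma alpha L H l <= C0.
Proof.
move=> l1 l2; have l0 : 0 < l by rewrite (lt_le_trans _ l1).
have a0 := alpha_gt0; have L0 := L_gt0.
have s0 : 0 <= \sum_i \sum_j `|sigma i j| by apply: sumr_ge0 => i _; exact: sumr_ge0.
have q0 : 0 <= 2 / alpha by rewrite divr_ge0// ltW.
have q1 : 0 <= 2 / (alpha * l) by rewrite divr_ge0// ltW// mulr_gt0.
have q2 : 2 / (alpha * l) <= 2 / alpha.
  by rewrite ler_wpM2l// lef_pV2 ?posrE ?mulr_gt0// ler_peMr// ltW.
have q3 : 0 <= l * L by rewrite mulr_ge0 ?ltW.
have q4 : l * L <= 2 * L by rewrite ler_wpM2r// ltW.
rewrite /euler_constant /C0; apply: ler_pM.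
- by apply: mulr_ge0 => //; exact: sqr_ge0.
- by rewrite mulr_ge0// powR_ge0.
- rewrite ler_wpM2l// ler_pXn2r ?nnegrE//.
  + apply: ler_pM; [by apply: mulr_ge0 => //; lra|lra| |lra].
    by rewrite ler_wpM2l// lerD2l.
  + by apply: mulr_ge0; [apply: mulr_ge0 => //; lra|lra].
  + by apply: mulr_ge0; [apply: mulr_ge0 => //; lra|lra].
- rewrite ler_wpM2l//; apply: ge0_ler_powR; rewrite ?nnegrE ?mulr_ge0 ?(ltW H0)//.
  exact: ltW.
Qed.

Theorem continuous_concentration :
  exists C : R, 0 < C /\
    forall (disp : measure_display) (Omega : measurableType disp)
      (P : probability Omega R) (B Y : R -> Omega -> 'cV[R]_d)
      (x : 'cV[R]_d),
    is_fbm P H B -> is_solution P b sigma x B Y ->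
    forall (T : R) (F : (R -> 'cV[R]_d) -> R) (lambda : R),
    1 <= T -> is_lipschitz (@Cpaths R d T) (@dist_T R d T) F -> 0 < lambda ->
    let FY := fun w : Omega => F (path_on T (fun t => Y t w)) in
    P.-integrable setT (EFin \o FY) /\
    ('E_P[fun w => expR (lambda * (FY w - fine 'E_P[FY]))] <=
      (expR (C * lip_norm (@Cpaths R d T) (@dist_T R d T) F ^+ 2 * lambda ^+ 2
             * T `^ Num.max (2 * H) 1))%:E)%E.
Proof.
have C00 : 0 <= C0.
  apply: mulr_ge0; last by rewrite mulr_ge0// powR_ge0.
  by apply: mulr_ge0 => //; exact: sqr_ge0.
(* A grid value has weight 2 l/M, the bound for the integral of a tent. The total over a block is 2
   l <= 4, and 16 is the square of 4; the 1 makes the constant positive. *)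
exists (16 * C0 + 1); split; first by rewrite ltr_wpDl// mulr_ge0.
move=> disp Omega P B Y x fB solY T F lambda T1 lipF lambda0 FY.
set CC := expR _.
have T0 : 0 < T by exact: lt_le_trans T1.
pose n := Num.truncn T; have /andP[nT Tn] := truncn_itv (ltW T0).
have n0 : (0 < n)%N.
  by have := le_lt_trans T1 Tn; rewrite -/n ltr1n ltnS.
pose l := T / n%:R.
have n0R : 0 < n%:R :> R by rewrite ltr0n.
have l1 : 1 <= l by rewrite ler_pdivlMr// mul1r.
have l2 : l <= 2.
  rewrite ler_pdivrMr//; apply: (le_trans (ltW Tn)).
  by rewrite -/n -natr1 mulr2n mulrDl !mul1r lerD2l ler1n.
have l0 : 0 < l by exact: lt_le_trans l1.
have nl : n%:R * l = T by rewrite /l mulrC divfK// gt_eqF.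
pose lip := lip_norm (@Cpaths R d T) (@dist_T R d T) F.
have dT0 u v : 0 <= @dist_T R d T u v by exact: dist_T_ge0.
have lip0 : 0 <= lip by exact: lip_norm_ge0.
have lipP u v : {within `[0, T], continuous u} -> {within `[0, T], continuous v} ->
    `|F (path_on T u) - F (path_on T v)| <= lip * dist_T T u v.
  move=> cu cv; rewrite -dist_T_path_on.
  by apply: (lip_norm_le dT0 lipF); exact: Cpaths_path_on.
have cint h M u : {within `[0, T], continuous (interpolation h n M u)}.
  exact: interpolation_continuous.
have [_ cY _] := solY.
have cYT w : {within `[0, T], continuous (Y ^~ w)}.
  apply: continuous_subspaceW (cY w) => t /=.
  by rewrite !in_itv/= => /andP[-> _].
have [||M|M u v M0|w|mF hle] := @grid_concentration R d b sigma b_cont alpha L alpha_gt0 L_gt0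
  b_contr b_lip H H0 H1 l l0 _ Omega P B Y x fB solY n (lambda * lip) 4
  (fun M m => 2 * (l / M%:R))
  (fun M u => lambda * F (path_on T (interpolation (l / M%:R) n M u))) (fun w => lambda * FY w).
- by rewrite mulr_ge0// ltW.
- by move=> M m; rewrite mulr_ge0// divr_ge0// ltW.
- rewrite sumr_const card_ord -[_ *+ M]mulr_natl.
  case: M => [|M]; first by rewrite mul0r.
  rewrite mulrCA [M.+1%:R * _]mulrC divfK ?pnatr_eq0//.
  by move: l2; lra.
- rewrite -mulrBr normrM gtr0_norm// -mulrA ler_wpM2l ?(ltW lambda0)//.
  apply: (le_trans (lipP _ _ _ _)) => //; rewrite ler_wpM2l//.
  by apply: dist_T_interpolation; rewrite divr_gt0// ltr0n.
- apply/cvgrPdist_le => e e0.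
  have den : 0 < lambda * lip + 1 by rewrite ltr_wpDl// mulr_ge0// ltW.
  have cYn : {within `[0, n%:R * l], continuous (Y ^~ w)} by rewrite nl.
  have := interpolation_converges l0 n0 cYn (divr_gt0 e0 den).
  rewrite nl; apply: filterS => M hM.
  rewrite distrC -mulrBr normrM gtr0_norm//.
  apply: (@le_trans _ _ (lambda * (lip * (e / (lambda * lip + 1))))).
    rewrite ler_wpM2l ?(ltW lambda0)//.
    by apply: (le_trans (lipP _ _ _ _)) => //; rewrite ler_wpM2l.
  rewrite [leLHS](_ : _ = e * (lambda * lip) / (lambda * lip + 1)); last first.
    by move: (_^-1) => z; ring.
  by rewrite ler_pdivrMr// ler_wpM2l ?(ltW e0)// lerDl.
apply: scaled_concentration => //; apply: (le_trans hle).
rewrite lee_fin ler_expR -/lip.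
have N1 : n%:R `^ Num.max (2 * H) 1 <= T `^ Num.max (2 * H) 1.
  by apply: ge0_ler_powR; rewrite ?nnegrE ?(ltW T0)// le_max ler01 orbT.
have N0 : 0 <= n%:R `^ Num.max (2 * H) 1 by exact: powR_ge0.
move: (n%:R `^ _) (T `^ _) N0 N1 => N N' N0 N1.
have q0 : 0 <= lip ^+ 2 * lambda ^+ 2 by apply: mulr_ge0; exact: sqr_ge0.
rewrite (_ : euler_constant _ _ _ _ _ * _ * N =
  euler_constant sigma alpha L H l * (16 * (lip ^+ 2 * lambda ^+ 2) * N)); last by ring.
apply: (@le_trans _ _ (C0 * (16 * (lip ^+ 2 * lambda ^+ 2) * N'))).
  apply: ler_pM; [exact: euler_constant_ge0|by apply: mulr_ge0 => //; exact: mulr_ge0|exact: euler_constant_le|].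
  by rewrite ler_wpM2l//; exact: mulr_ge0.
rewrite -subr_ge0 (_ : _ - _ = lip ^+ 2 * lambda ^+ 2 * N'); last by ring.
by apply: mulr_ge0 => //; exact: le_trans N1.
Qed.

End continuous_observations.

Unset Implicit Arguments.

Theorem proposition2p1 (R : realType) (d : nat)
    (b : 'cV[R]_d -> 'cV[R]_d) (b_cont : continuous b)
    (alpha L : R) (alpha_gt0 : 0 < alpha) (L_gt0 : 0 < L)
    (b_contr : forall y z : 'cV[R]_d,
       dotp (b y - b z) (y - z) <= - alpha * enorm (y - z) ^+ 2)
    (b_lip : forall y z : 'cV[R]_d, enorm (b y - b z) <= L * enorm (y - z))
    (H : R) (H_gt0 : 0 < H) (H_lt1 : H < 1) (sigma : 'M[R]_d) :
  (forall Delta : R, 0 < Delta ->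
    exists C : R, 0 < C /\
      forall (disp : measure_display) (Omega : measurableType disp)
        (P : probability Omega R) (B Y : R -> Omega -> 'cV[R]_d)
        (x : 'cV[R]_d),
      is_fbm P H B -> is_solution P b sigma x B Y ->
      forall (n : nat) (F : ('I_n -> 'cV[R]_d) -> R) (lambda : R),
      (0 < n)%N -> is_lipschitz setT (@dist_n R d n) F -> 0 < lambda ->
      let FY := fun w : Omega => F (fun k => Y (k.+1%:R * Delta) w) in
      P.-integrable setT (EFin \o FY) /\
      ('E_P[fun w => expR (lambda * (FY w - fine 'E_P[FY]))] <=
        (expR (C * lip_norm setT (@dist_n R d n) F ^+ 2 * lambda ^+ 2
               * n%:R `^ Num.max (2 * H) 1))%:E)%E)
  /\
  (exists C : R, 0 < C /\
    forall (disp : measure_display) (Omega : measurableType disp)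
      (P : probability Omega R) (B Y : R -> Omega -> 'cV[R]_d)
      (x : 'cV[R]_d),
    is_fbm P H B -> is_solution P b sigma x B Y ->
    forall (T : R) (F : (R -> 'cV[R]_d) -> R) (lambda : R),
    1 <= T -> is_lipschitz (@Cpaths R d T) (@dist_T R d T) F -> 0 < lambda ->
    let FY := fun w : Omega => F (path_on T (fun t => Y t w)) in
    P.-integrable setT (EFin \o FY) /\
    ('E_P[fun w => expR (lambda * (FY w - fine 'E_P[FY]))] <=
      (expR (C * lip_norm (@Cpaths R d T) (@dist_T R d T) F ^+ 2 * lambda ^+ 2
             * T `^ Num.max (2 * H) 1))%:E)%E).

Proof.
split=> [Delta Delta_gt0|].
  have [C [C_gt0 hC]] := discrete_concentration sigma b_cont alpha_gt0 L_gt0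
    b_contr b_lip H_gt0 H_lt1 Delta_gt0.
  exists C; split=> // disp Omega P B Y x fB solY n F lambda _.
  exact: hC fB solY n F lambda.
exact: (continuous_concentration sigma b_cont alpha_gt0 L_gt0 b_contr b_lip
  H_gt0 H_lt1).
Qed.
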